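(* Let $\mathcal F$ be a codimension one transversely holomorphic foliation on a smooth manifold $M$. If $\mathcal F$ is $\mathbb C$-transversely homogeneous (has a holomorphic homogeneous transverse structure), then $\mathcal F$ is $\mathbb C$-transversely additive, $\mathbb C$-transversely affine or $\mathbb C$-transversely projective.
   Context: A smooth foliation $\mathcal F$ of real codimension two on $M$ is transversely holomorphic of (complex) codimension one if its holonomy pseudogroup is given by biholomorphic maps between open subsets of $\mathbb C$. $\mathcal F$ has a holomorphic homogeneous transverse structure (is $\mathbb C$-transversely homogeneous, of model $G/H$) if there are a complex Lie group $G$ and a connected closed complex subgroup $H<G$ such that $\mathcal F$ admits a (transversely holomorphic) atlas of submersions $y_j\colon U_j\subset M\to G/H$ defining $\mathcal F$, satisfying $y_i=g_{ij}\circ y_j$ on each nonempty $U_i\cap U_j$, for some locally constant map $g_{ij}\colon U_i\cap U_j\to G$, where $G$ acts on $G/H$ by left translations. (As $\mathcal F$ has complex codimension one, $G/H$ is a Riemann surface.) $\mathcal F$ is $\mathbb C$-transversely additive if it admits such an atlas of transversely holomorphic submersions with values in $\mathbb C$ and transition maps $g_{ij}(z)=z+b_{ij}$, $b_{ij}\in\mathbb C$ locally constant; $\mathbb C$-transversely affine if it does with $g_{ij}(z)=a_{ij}z+b_{ij}$, $a_{ij}\in\mathbb C\setminus\{0\}$, $b_{ij}\in\mathbb C$ locally constant; and $\mathbb C$-transversely projective if it does (with submersions taking values in the Riemann sphere $\overline{\mathbb C}$) with $g_{ij}(z)=\frac{a_{ij}z+b_{ij}}{c_{ij}z+d_{ij}}$,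 where $\begin{pmatrix}a_{ij}&b_{ij}\\c_{ij}&d_{ij}\end{pmatrix}\in \mathrm{SL}(2,\mathbb C)$ is locally constant. *)

(* Defs.v *)
From HB Require Import structures.
From mathcomp Require Import all_boot all_order all_algebra.
From mathcomp Require Import complex.
From mathcomp Require Import all_classical all_reals all_analysis.

Set Implicit Arguments.
Unset Strict Implicit.
Unset Printing Implicit Defensive.

Import Order.TTheory GRing.Theory Num.Theory numFieldNormedType.Exports.

Local Open Scope classical_set_scope.
Local Open Scope ring_scope.
Local Open Scope quotient_scope.

(* The complex line over R : realType, with the topology of the modulus and,
   as a normed module over itself, complex differentiability. *)
Notation Cplx R := ((R[i])^o).

(* [fwd] is only meaningful on [dom], and [bwd] only on [fwd @` dom]. *)
Record chart (X E : Type) := Chart {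
  dom : set X;
  fwd : X -> E;
  bwd : E -> X }.

Definition is_chart (X E : topologicalType) (c : chart X E) : Prop :=
  [/\ open (dom c),
      open (fwd c @` dom c),
      forall x, dom c x -> bwd c (fwd c x) = x,
      forall x, dom c x -> {for x, continuous (fwd c)} &
      forall u, (fwd c @` dom c) u -> {for u, continuous (bwd c)}].

Definition is_atlas (X E : topologicalType)
    (regular_on : set E -> (E -> E) -> Prop) (A : set (chart X E)) : Prop :=
  [/\ A `<=` @is_chart X E,
      \bigcup_(c in A) dom c = setT &
      forall c d, A c -> A d ->
        regular_on (fwd c @` (dom c `&` dom d)) (fwd d \o bwd c)].

Definition prod_chart (X Y E F : Type) (c : chart X E) (d : chart Y F) :
    chart (X * Y) (E * F) :=
  Chart (dom c `*` dom d)
        (fun p => (fwd c p.1, fwd d p.2))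
        (fun q => (bwd c q.1, bwd d q.2)).

Definition prod_atlas (X Y E F : Type) (A : set (chart X E))
    (B : set (chart Y F)) : set (chart (X * Y) (E * F)) :=
  [set e | exists c d, [/\ A c, B d & e = prod_chart c d]].

(* Class C^k on an open set U, through directional derivatives. *)
Fixpoint Ck_on (R : realType) (V W : normedModType R) (k : nat) (U : set V)
    (f : V -> W) : Prop :=
  match k with
  | 0 => forall x, U x -> {for x, continuous f}
  | k'.+1 => (forall x, U x -> differentiable f x) /\
             (forall v, Ck_on k' U (fun x => 'd f x v))
  end.

Definition smooth_on (R : realType) (V W : normedModType R) (U : set V)
    (f : V -> W) : Prop :=
  forall k, Ck_on k U f.

Record smoothManifold (R : realType) := SmoothManifold {
  space :> topologicalType;
  mdim : nat;
  smooth_atlas : set (chart space 'rV[R]_mdim);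
  space_hausdorff : hausdorff_space space;
  space_second_countable : @second_countable space;
  smooth_atlasP :
    is_atlas (@smooth_on R 'rV[R]_mdim 'rV[R]_mdim) smooth_atlas }.

Definition submersive_at (K : numFieldType) (V W : normedModType K)
    (f : V -> W) (x : V) : Prop :=
  differentiable f x /\ range ('d f x) = setT.

Definition C_to_R2 (R : realType) (z : Cplx R) : 'rV[R]_2 :=
  \row_(j < 2) (if j == 0 then complex.Re z else complex.Im z).

(* Smooth submersion U -> C, where C is seen as R^2. *)
Definition smooth_submersion (R : realType) (M : smoothManifold R)
    (U : set M) (f : M -> Cplx R) : Prop :=
  open U /\
  forall c, smooth_atlas c ->
    let S := fwd c @` (U `&` dom c) in
    let fc : 'rV[R]_(mdim M) -> 'rV[R]_2 := @C_to_R2 R \o f \o bwd c in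
    smooth_on S fc /\ forall u, S u -> submersive_at fc u.

Definition holomorphic_on (R : realType) (V W : normedModType R[i])
    (U : set V) (f : V -> W) : Prop :=
  forall x, U x -> differentiable f x.

Definition complex_atlas (R : realType) (E : normedModType R[i])
    (X : topologicalType) (A : set (chart X E)) : Prop :=
  is_atlas (@holomorphic_on R E E) A.

(* Complex differentiability at a point; a map is holomorphic on an open set
   when this holds at each of its points. *)
Definition holomorphic_at (R : realType) (E F : normedModType R[i])
    (X Y : topologicalType) (A : set (chart X E)) (B : set (chart Y F))
    (f : X -> Y) (x : X) : Prop :=
  {for x, continuous f} /\
  exists c d, [/\ A c, B d, dom c x, dom d (f x) &
                  differentiable (fwd d \o f \o bwd c) (fwd c x)].

Definition plane_atlas (R : realType) : set (chart (Cplx R) (Cplx R)) :=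
  [set Chart setT id id].

Notation sphere R := (one_point_compactification (Cplx R)).

(* The charts z and 1/z of the Riemann sphere; None is the point at infinity. *)
Definition sphere_chart0 (R : realType) : chart (sphere R) (Cplx R) :=
  Chart [set~ None] (fun p => if p is Some z then z else 0) Some.

Definition sphere_chartoo (R : realType) : chart (sphere R) (Cplx R) :=
  Chart [set~ Some 0] (fun p => if p is Some z then z^-1 else 0)
        (fun w => if w == 0 then None else Some w^-1).

Definition sphere_atlas (R : realType) : set (chart (sphere R) (Cplx R)) :=
  [set sphere_chart0 R; sphere_chartoo R].

(* g is a biholomorphic map from the open subset W of C onto an open subset of
   the Riemann surface X. *)
Definition biholomorphic_on (R : realType) (X : topologicalType)
    (A : set (chart X (Cplx R))) (W : set (Cplx R)) (g : Cplx R -> X) : Prop :=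
  [/\ open W,
      open (g @` W),
      forall w, W w -> holomorphic_at (@plane_atlas R) A g w &
      exists h : X -> Cplx R,
        (forall w, W w -> h (g w) = w) /\
        (forall p, (g @` W) p -> holomorphic_at A (@plane_atlas R) h p)].

(* Near x, y is the composite of f with a biholomorphic map. *)
Definition transversely_related (R : realType) (M X : topologicalType)
    (A : set (chart X (Cplx R))) (f : M -> Cplx R) (y : M -> X) (x : M) : Prop :=
  exists (W : set (Cplx R)) (g : Cplx R -> X),
    [/\ biholomorphic_on A W g, W (f x) & \forall z \near x, y z = g (f z)].

(* The foliation is given by a Haefliger cocycle: smooth submersions u.2 from
   open sets u.1 covering M to C = R^2, whose fibres are the plaques; the
   transition maps, which generate the holonomy pseudogroup, are biholomorphic
   maps between open subsets of C. *)
Record thFoliation (R : realType) (M : smoothManifold R) := ThFoliation {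
  fol_atlas : set (set M * (M -> Cplx R));
  fol_cover : \bigcup_(u in fol_atlas) u.1 = setT;
  fol_submersion : forall u, fol_atlas u -> smooth_submersion u.1 u.2;
  fol_transition : forall u v, fol_atlas u -> fol_atlas v ->
    forall x, u.1 x -> v.1 x ->
      transversely_related (@plane_atlas R) u.2 v.2 x }.

(* y : U -> X is a transversely holomorphic submersion defining F on U: it
   differs from the given submersions of F by biholomorphic maps between open
   subsets of C and of the Riemann surface X, so that in particular y is a
   submersion with the same local fibres. *)
Definition defines_on (R : realType) (M : smoothManifold R)
    (F : thFoliation M) (X : topologicalType) (A : set (chart X (Cplx R)))
    (U : set M) (y : M -> X) : Prop :=
  open U /\
  forall u, fol_atlas F u -> forall x, U x -> u.1 x ->
    transversely_related A u.2 y x.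

Definition locally_constant_on (M : topologicalType) (T : Type) (U : set M)
    (g : M -> T) : Prop :=
  forall x, U x -> \forall z \near x, U z -> g z = g x.

(* F admits an atlas of submersions to the Riemann surface X with
   y_i = g_ij . y_j, where g_ij is locally constant with values in P and T acts
   on X through [act]. *)
Definition has_transverse_structure (R : realType) (M : smoothManifold R)
    (F : thFoliation M) (X : topologicalType) (A : set (chart X (Cplx R)))
    (T : Type) (act : T -> X -> X) (P : set T) : Prop :=
  exists (I : Type) (U : I -> set M) (y : I -> M -> X) (g : I -> I -> M -> T),
    [/\ \bigcup_i U i = setT,
        forall i, defines_on F A (U i) (y i),
        forall i j, locally_constant_on (U i `&` U j) (g i j) &
        forall i j x, (U i `&` U j) x ->
          P (g i j x) /\ y i x = act (g i j x) (y j x)].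

(* No compatibility between topology and group law is required here; it is part
   of [complexLieGroup]. *)
#[short(type="topGroupType")]
HB.structure Definition TopGroup := {G of Topological G & Group G}.

Record complexLieGroup (R : realType) := ComplexLieGroup {
  lie_group :> topGroupType;
  lie_dim : nat;
  lie_atlas : set (chart lie_group 'rV[R[i]]_lie_dim);
  lie_hausdorff : hausdorff_space lie_group;
  lie_second_countable : @second_countable lie_group;
  lie_atlasP : complex_atlas lie_atlas;
  lie_mul : forall p : lie_group * lie_group,
    holomorphic_at (prod_atlas lie_atlas lie_atlas) lie_atlas
      (fun q : lie_group * lie_group => (q.1 * q.2)%g) p;
  lie_inv : forall x : lie_group,
    holomorphic_at lie_atlas lie_atlas (fun z : lie_group => (z^-1)%g) x }.

(* Slice charts: near each of its points, H is a linear subspace (the row space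
   of L) in some holomorphic chart of G. *)
Definition complex_submanifold (R : realType) (G : complexLieGroup R)
    (H : set G) : Prop :=
  forall x, H x ->
    exists (c : chart G 'rV[R[i]]_(lie_dim G)) (L : 'M[R[i]]_(lie_dim G)),
      [/\ complex_atlas (@lie_atlas R G `|` [set c]), dom c x &
          forall z, dom c z -> (H z <-> (fwd c z <= L)%MS)].

Definition closed_complex_subgroup (R : realType) (G : complexLieGroup R)
    (H : set G) : Prop :=
  [/\ H 1%g,
      forall x y, H x -> H y -> H (x * y)%g,
      forall x, H x -> H (x^-1)%g,
      closed H &
      complex_submanifold H].

Section CosetSpace.
Variables (G : topGroupType) (H : set G).

Definition same_coset (x y : G) : bool :=
  `[< [set (x * h)%g | h in H] = [set (y * h)%g | h in H] >].

Lemma same_coset_refl : reflexive same_coset.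
Proof. by move=> x; apply/asboolP. Qed.

Lemma same_coset_sym : symmetric same_coset.
Proof. by move=> x y; apply/asboolP/asboolP => ->. Qed.

Lemma same_coset_trans : transitive same_coset.
Proof. by move=> y x z /asboolP xy /asboolP yz; apply/asboolP; rewrite xy. Qed.

Canonical same_coset_equiv :=
  EquivRel same_coset same_coset_refl same_coset_sym same_coset_trans.

(* G/H, with the quotient topology. *)
Definition coset_space := quotient_topology {eq_quot same_coset_equiv}.

Definition coset_proj (x : G) : coset_space := \pi_coset_space x.

Definition left_translation (g : G) (p : coset_space) : coset_space :=
  coset_proj (g * repr p)%g.

End CosetSpace.

(* The complex structure of the Riemann surface G/H, the only one for which
   the projection from G is a holomorphic submersion: its charts are the
   homeomorphisms from open subsets of G/H to open subsets of C whose composite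
   with the projection is a holomorphic submersion. If G/H is not of complex
   dimension one there are no such charts except with empty domain, so that no
   foliation of complex codimension one on a nonempty manifold is modelled on
   it. *)
Definition coset_atlas (R : realType) (G : complexLieGroup R) (H : set G) :
    set (chart (coset_space H) (Cplx R)) :=
  [set c | is_chart c /\
     forall x : G, dom c (coset_proj H x) ->
       exists e, [/\ lie_atlas e, dom e x &
         submersive_at (fwd c \o coset_proj H \o bwd e) (fwd e x)]].

Definition transversely_homogeneous (R : realType) (M : smoothManifold R)
    (F : thFoliation M) : Prop :=
  exists (G : complexLieGroup R) (H : set G),
    [/\ closed_complex_subgroup H, connected H &
        has_transverse_structure F (@coset_atlas R G H)
          (@left_translation G H) setT].

Definition transversely_additive (R : realType) (M : smoothManifold R)
    (F : thFoliation M) : Prop :=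
  has_transverse_structure F (@plane_atlas R)
    (fun (b z : Cplx R) => z + b) setT.

Definition transversely_affine (R : realType) (M : smoothManifold R)
    (F : thFoliation M) : Prop :=
  has_transverse_structure F (@plane_atlas R)
    (fun (ab : Cplx R * Cplx R) (z : Cplx R) => ab.1 * z + ab.2)
    [set ab | ab.1 != 0].

Definition mobius (R : realType) (A : 'M[R[i]]_2) (p : sphere R) : sphere R :=
  let: (a, b, c, d) := (A 0 0, A 0 1, A 1 0, A 1 1) in
  match p with
  | Some z => if c * z + d == 0 then None else Some ((a * z + b) / (c * z + d))
  | None => if c == 0 then None else Some (a / c)
  end.

Definition transversely_projective (R : realType) (M : smoothManifold R)
    (F : thFoliation M) : Prop :=
  has_transverse_structure F (@sphere_atlas R) (@mobius R)
    [set A | \det A = 1].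

(* Main.v *)
(* In a chart z of the Riemann surface G/H the left translations become a pseudogroup of
   holomorphic maps g, and differentiating the action at 1 gives a finite-dimensional
   space of holomorphic functions v without common zero (the vector fields coming from the Lie
   algebra), such that v(g z) = g'(z) * (Ad v)(z).  On some smaller disc choose such an
   invariant family of least size d; its Wronskian W may be taken without zero, and
   W(g) * g'^m = const * W with m = d(d-3)/2.
   If lambda = lambda(g) * g' + g''/g' for all g, then every g is affine in a coordinate w
   with w'' = lambda * w'.  For d <> 3 one takes lambda = W'/(m W).  For d = 3 and W'
   nonzero, omega = W'/W is an invariant 1-form and lambda = omega'/omega.  For d = 3 and W
   constant the v solve v''' = - b v' - c v and R = c - b'/2 is an invariant cubic differential;
   if it is nonzero, lambda = R'/(3 R).  If R = 0, then Q(v) = 2 v v'' - v'^2 + b v^2 is a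
   constant quadratic form, and an isotropic v with w' = 1/v writes the family as
   v * {1, w, w^2}, so that every g is a Moebius map in w.
   The translates of the resulting chart cover G/H, which gives a transversely projective
   structure; the transition matrices are locally constant since the germ of a Moebius map
   determines its matrix up to sign. *)

Require Import Defs.
From HB Require Import structures.
From mathcomp Require Import all_boot all_order all_algebra.
From mathcomp Require Import complex perm.
From mathcomp Require Import all_classical all_reals all_analysis.
From mathcomp Require Import ring lra.

Set Implicit Arguments.
Unset Strict Implicit.
Unset Printing Implicit Defensive.

Import Order.TTheory GRing.Theory Num.Theory numFieldNormedType.Exports.

Local Open Scope classical_set_scope.
Local Open Scope ring_scope.

(** * Complex derivatives *)

(** Additive and affine structures are projective, so the third alternative is the one proved. The
    exponent m is the sum of k - 1 over k < d: the column of order k of the Wronskian gains g'^k,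
    and a vector field loses one factor g'. For d > 0 it vanishes only at d = 3, the dimension of
    sl(2), where genuine Moebius maps occur. There W' = 0 removes the second order term of the
    equation, and R = 0 makes it the symmetric square of y'' = - (b / 4) y; isotropic v are squares
    of solutions y, and w is a quotient of two solutions. The function theory rests on integrals
    over rectangles. Cauchy's formula is normalised by the integral of 1 / (z - a) itself, of which
    the proof uses that it is non-zero and locally constant in a. The delicate point is that the
    vector fields, derivatives in a group parameter t at t = 0, are holomorphic in z: the maps are
    known to be bounded and holomorphic in t and in z separately, and Cauchy estimates make their
    difference quotients converge uniformly. *)

Section ComplexDerivative.
Variable R : realType.
Implicit Types (z w h l : R[i]) (f g : R[i] -> R[i]) (e d : R).

(* The norm of R[i] as a normed module takes its values in R[i]; this one is R-valued. *)
Definition nm (z : R[i]) : R := Normc.normc z.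

Lemma nm0 : nm 0 = 0. Proof. exact: Normc.normc0. Qed.
Lemma nm1 : nm 1 = 1. Proof. exact: Normc.normc1. Qed.
Lemma nmM z w : nm (z * w) = nm z * nm w. Proof. exact: Normc.normcM. Qed.
Lemma nmV z : nm z^-1 = (nm z)^-1. Proof. exact: Normc.normcV. Qed.
Lemma nmN z : nm (- z) = nm z. Proof. exact: normcN. Qed.
Lemma nmD z w : nm (z + w) <= nm z + nm w. Proof. exact: le_normcD. Qed.
Lemma nm_ge0 z : 0 <= nm z.
Proof. by case: z => a b; rewrite sqrtr_ge0. Qed.
Lemma nm_eq0 z : (nm z == 0) = (z == 0).
Proof.
by apply/eqP/eqP => [/Normc.eq0_normc//|->]; rewrite nm0.
Qed.
Lemma nm_gt0 z : (0 < nm z) = (z != 0).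
Proof. by rewrite lt0r nm_ge0 andbT nm_eq0. Qed.
Lemma nmC z w : nm (z - w) = nm (w - z). Proof. by rewrite -nmN opprB. Qed.
Lemma nmB z w : nm (z - w) <= nm z + nm w.
Proof. by rewrite (le_trans (nmD _ _))// nmN. Qed.
Lemma nm_tri z w u : nm (z - u) <= nm (z - w) + nm (w - u).
Proof. by rewrite (le_trans _ (nmD _ _))// addrA subrK. Qed.
Lemma nm_real (x : R) : nm x%:C%C = `|x|.
Proof. by rewrite /nm /= expr0n /= addr0 sqrtr_sqr. Qed.
Lemma nm_i : nm ('i%C : R[i]) = 1.
Proof. by rewrite /nm /= expr0n /= add0r expr1n sqrtr1. Qed.
Lemma nm_Re z : `|complex.Re z| <= nm z.
Proof.
by case: z => a b; rewrite /nm /= -sqrtr_sqr ler_sqrt ?lerDl ?addr_ge0 ?sqr_ge0.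
Qed.
Lemma nm_Im z : `|complex.Im z| <= nm z.
Proof.
by case: z => a b; rewrite /nm /= -sqrtr_sqr ler_sqrt ?lerDr ?addr_ge0 ?sqr_ge0.
Qed.
Lemma nm_le_ReIm z : nm z <= `|complex.Re z| + `|complex.Im z|.
Proof.
by rewrite {1}(complexE z) (le_trans (nmD _ _))// nmM nm_i mul1r !nm_real.
Qed.

(** Neighbourhoods are given by a real radius, within reach of real linear arithmetic; [nearC_ev]
    identifies them with the filter of the complex line. *)
Definition ev z (P : R[i] -> Prop) := exists2 d, 0 < d & forall w, nm (w - z) < d -> P w.

Lemma evW z (P Q : R[i] -> Prop) : (forall w, P w -> Q w) -> ev z P -> ev z Q.
Proof. by move=> PQ [d d0 H]; exists d => // w /H /PQ. Qed.
Lemma evI z (P Q : R[i] -> Prop) : ev z P -> ev z Q -> ev z (fun w => P w /\ Q w).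
Proof.
move=> [d d0 H] [e e0 K]; exists (Num.min d e); first by rewrite lt_min d0 e0.
by move=> w; rewrite lt_min => /andP[/H ? /K ?].
Qed.
Lemma ev_app z (P Q : R[i] -> Prop) :
  ev z P -> ev z (fun w => P w -> Q w) -> ev z Q.
Proof. by move=> H K; apply: evW (evI H K) => w []; auto. Qed.
Lemma ev_self z P : ev z P -> P z.
Proof. by move=> [d d0]; apply; rewrite subrr nm0. Qed.
Lemma ev_all z (P : R[i] -> Prop) : (forall w, P w) -> ev z P.
Proof. by exists 1. Qed.
Lemma ev_ev z P : ev z P -> ev z (fun w => ev w P).
Proof.
move=> [d d0 H]; exists d => // w wz; exists (d - nm (w - z)); first lra.
by move=> u uw; apply: H; have := nm_tri u w z; lra.
Qed.
Lemma ev_ball z (r : R) : 0 < r -> ev z (fun w => nm (w - z) < r).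
Proof. by exists r. Qed.

Definition ccont f z := forall e, 0 < e -> ev z (fun w => nm (f w - f z) < e).

(** A form without quotients: the non-strict inequality holds trivially at w = z, so no point has to
    be excluded. *)
Definition cderiv f z l :=
  forall e, 0 < e -> ev z (fun w => nm (f w - f z - l * (w - z)) <= e * nm (w - z)).

Lemma cderiv_lip f z l : cderiv f z l ->
  ev z (fun w => nm (f w - f z) <= (nm l + 1) * nm (w - z)).
Proof.
move=> /(_ 1 ltr01); apply: evW => w H.
have := nmD (f w - f z - l * (w - z)) (l * (w - z)).
by rewrite subrK nmM; lra.
Qed.

Lemma cderiv_cont f z l : cderiv f z l -> ccont f z.
Proof.
move=> /cderiv_lip H e e0.
have k0 : 0 < nm l + 1 by have := nm_ge0 l; lra.
apply: ev_app H _; exists (e / (nm l + 1)); first exact: divr_gt0.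
move=> w; rewrite ltr_pdivlMr// => wz H; apply: le_lt_trans H _; lra.
Qed.

Lemma cderiv_ext f g z l : ev z (fun w => f w = g w) -> cderiv f z l -> cderiv g z l.
Proof.
move=> fg H e e0; have fgz := ev_self fg.
by apply: evW (evI fg (H e e0)) => w []; rewrite fgz => ->.
Qed.

Lemma ccont_ext f g z : ev z (fun w => f w = g w) -> ccont f z -> ccont g z.
Proof.
move=> fg H e e0; have fgz := ev_self fg.
by apply: evW (evI fg (H e e0)) => w []; rewrite fgz => ->.
Qed.

Lemma ccont_ev f z P : ccont f z -> ev (f z) P -> ev z (fun w => P (f w)).
Proof. by move=> fz [d d0 H]; apply: evW (fz d d0) => w /H. Qed.

Lemma ccont_comp f g z : ccont g z -> ccont f (g z) -> ccont (f \o g) z.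
Proof. by move=> gz fz e e0; apply: ccont_ev gz (fz e e0). Qed.

Lemma cderiv_cst k z : cderiv (fun=> k) z 0.
Proof.
move=> e e0; apply: ev_all => w.
by rewrite subrr sub0r mul0r oppr0 nm0 mulr_ge0 ?nm_ge0 ?ltW.
Qed.

Lemma cderiv_id z : cderiv id z 1.
Proof.
move=> e e0; apply: ev_all => w.
by rewrite mul1r subrr nm0 mulr_ge0 ?nm_ge0 ?ltW.
Qed.

Lemma cderivD f g z l m : cderiv f z l -> cderiv g z m ->
  cderiv (fun w => f w + g w) z (l + m).
Proof.
move=> fl gm e e0; have e2 : 0 < e / 2 by lra.
apply: evW (evI (fl _ e2) (gm _ e2)) => w [H1 H2].
have := nmD (f w - f z - l * (w - z)) (g w - g z - m * (w - z)).
rewrite (_ : _ + _ = f w + g w - (f z + g z) - (l + m) * (w - z)); last by ring.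
lra.
Qed.

Lemma cderivM f g z l m : cderiv f z l -> cderiv g z m ->
  cderiv (fun w => f w * g w) z (l * g z + f z * m).
Proof.
move=> fl gm e e0.
have fl' := cderiv_lip fl; have gz := cderiv_cont gm.
pose K := nm (g z) + nm (f z) + nm l + 3.
have K0 : 0 < K by have := nm_ge0 (g z); have := nm_ge0 (f z); have := nm_ge0 l; rewrite /K; lra.
have eK : 0 < e / K by exact: divr_gt0.
pose e' := Num.min 1 (e / K).
have e'0 : 0 < e' by rewrite lt_min ltr01 eK.
apply: evW (evI (evI fl' (gz e' e'0)) (evI (fl _ eK) (gm _ eK))) => w [[H1 H2] [H3 H4]].
have -> : f w * g w - f z * g z - (l * g z + f z * m) * (w - z) =
  (f w - f z) * (g w - g z) + (f w - f z - l * (w - z)) * g z +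
  f z * (g w - g z - m * (w - z)) by ring.
apply: le_trans (nmD _ _) _; apply: le_trans (lerD (nmD _ _) (lexx _)) _.
rewrite !nmM.
move: H2; rewrite lt_min => /andP[_ H2].
have n1 := nm_ge0 (g z); have n2 := nm_ge0 (f z); have n3 := nm_ge0 l.
have n4 := nm_ge0 (w - z).
have A1 : nm (f w - f z) * nm (g w - g z) <= (nm l + 1) * nm (w - z) * (e / K).
  by apply: ler_pM => //; [exact: nm_ge0|exact: nm_ge0|exact: ltW].
have A2 := ler_wpM2r n1 H3.
have A3 := ler_wpM2l n2 H4.
have eKK : e = e / K * K by rewrite divfK ?gt_eqF.
rewrite [X in _ <= X * _]eKK.
apply: le_trans (lerD (lerD A1 A2) A3) _.
have := mulr_ge0 (ltW eK) n4; have KE : K = nm (g z) + nm (f z) + nm l + 3 by [].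
move: (e / K) => q qn; rewrite KE; nra.
Qed.

Lemma cderivZ k f z l : cderiv f z l -> cderiv (fun w => k * f w) z (k * l).
Proof.
move=> /(cderivM (cderiv_cst k z)); by rewrite mul0r add0r.
Qed.

Lemma cderivN f z l : cderiv f z l -> cderiv (fun w => - f w) z (- l).
Proof.
move=> /(cderivZ (-1)); rewrite mulN1r; apply: cderiv_ext.
by apply: ev_all => w; rewrite mulN1r.
Qed.

Lemma cderivB f g z l m : cderiv f z l -> cderiv g z m ->
  cderiv (fun w => f w - g w) z (l - m).
Proof. by move=> ? /cderivN ?; apply: cderivD. Qed.

Lemma cderiv_comp f g z l m : cderiv f (g z) l -> cderiv g z m ->
  cderiv (f \o g) z (l * m).
Proof.
move=> fl gm e e0.
have K0 : 0 < nm m + 1 by have := nm_ge0 m; lra.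
have L0 : 0 < nm l + 1 by have := nm_ge0 l; lra.
have e1 : 0 < e / 2 / (nm m + 1) by rewrite divr_gt0//; lra.
have e2 : 0 < e / 2 / (nm l + 1) by rewrite divr_gt0//; lra.
have H1 := ccont_ev (cderiv_cont gm) (fl _ e1).
apply: evW (evI H1 (evI (gm _ e2) (cderiv_lip gm))) => w [{}H1 [H2 H3]] /=.
have -> : f (g w) - f (g z) - l * m * (w - z) =
  (f (g w) - f (g z) - l * (g w - g z)) + l * (g w - g z - m * (w - z)) by ring.
apply: le_trans (nmD _ _) _; rewrite nmM.
apply: le_trans (lerD H1 (ler_wpM2l (nm_ge0 _) H2)) _.
have n4 := nm_ge0 (w - z).
have A1 : e / 2 / (nm m + 1) * nm (g w - g z) <= e / 2 * nm (w - z).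
  by apply: le_trans (ler_wpM2l (ltW e1) H3) _; rewrite mulrA divfK ?gt_eqF.
have A2 : nm l * (e / 2 / (nm l + 1) * nm (w - z)) <= e / 2 * nm (w - z).
  apply: le_trans (ler_wpM2r (mulr_ge0 (ltW e2) n4) (_ : nm l <= nm l + 1)) _; first lra.
  by rewrite mulrA mulrCA divff ?mulr1 ?gt_eqF.
lra.
Qed.

Lemma cderiv_inv z : z != 0 -> cderiv (fun w => w^-1) z (- z ^- 2).
Proof.
move=> z0 e e0; have n0 : 0 < nm z by rewrite nm_gt0.
(* The remainder is (w - z)^2 / (w z^2). The first bound gives |w| > |z| / 2, and the second then
   makes the remainder at most e |w - z|. *)
have d0 : 0 < Num.min (nm z / 2) (e * nm z ^+ 3 / 2).
  by rewrite lt_min !divr_gt0// mulr_gt0// exprn_gt0.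
exists (Num.min (nm z / 2) (e * nm z ^+ 3 / 2)) => // w; rewrite lt_min => /andP[w1 w2].
have nw : nm z / 2 < nm w by have := nm_tri z w 0; rewrite !subr0 nmC; lra.
have w0 : w != 0 by rewrite -nm_gt0; lra.
have -> : w^-1 - z^-1 - - z ^- 2 * (w - z) = (w - z) ^+ 2 / (w * z ^+ 2).
  by field; rewrite w0 z0.
rewrite nmM nmV !nmM ler_pdivrMr; last first.
  by rewrite mulr_gt0 ?mulr_gt0// (lt_trans _ nw)// divr_gt0.
rewrite [_ * _ * (_ * _)]mulrAC [leLHS]mulrC; apply: ler_wpM2r; first exact: nm_ge0.
apply: le_trans (ltW w2) _.
have -> : e * nm z ^+ 3 / 2 = e * ((nm z / 2) * (nm z * nm z)) by field.
by apply: ler_wpM2l; [exact: ltW|apply: ler_wpM2r; [exact: mulr_ge0 (ltW n0) (ltW n0)|exact: ltW]].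
Qed.

Lemma cderivV f z l : f z != 0 -> cderiv f z l ->
  cderiv (fun w => (f w)^-1) z (- l / f z ^+ 2).
Proof.
move=> fz fl; have := cderiv_comp (cderiv_inv fz) fl.
by rewrite !mulNr mulrC.
Qed.

Lemma cderiv_unique f z l m : cderiv f z l -> cderiv f z m -> l = m.
Proof.
move=> fl fm; apply/eqP; rewrite -subr_eq0; apply/negPn/negP; rewrite -nm_gt0 => lm.
have e0 : 0 < nm (l - m) / 4 by lra.
have [d d0 H] := evI (fl _ e0) (fm _ e0).
have d2 : 0 < d / 2 by lra.
have [] := H (z + (d / 2)%:C%C).
  by rewrite addrC addKr nm_real gtr0_norm//; lra.
rewrite (_ : z + (d / 2)%:C%C - z = (d / 2)%:C%C); last by ring.
rewrite nm_real (gtr0_norm d2) => H1 H2.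
have := nmB (f (z + (d / 2)%:C%C) - f z - m * (d / 2)%:C%C) (f (z + (d / 2)%:C%C) - f z - l * (d / 2)%:C%C).
rewrite (_ : _ - _ = (l - m) * (d / 2)%:C%C); last by ring.
by rewrite nmM nm_real (gtr0_norm d2); nra.
Qed.

Lemma cderivX f z l n : cderiv f z l ->
  cderiv (fun w => f w ^+ n) z (n%:R * f z ^+ n.-1 * l).
Proof.
move=> fl; elim: n => [|n IH].
  rewrite !mul0r; apply: cderiv_ext (cderiv_cst 1 z).
  by apply: ev_all => w; rewrite expr0.
have := cderivM fl IH; rewrite (_ : _ + _ = n.+1%:R * f z ^+ n * l).
  by apply: cderiv_ext; apply: ev_all => w; rewrite exprS.
case: n {IH} => [|n]; first by rewrite !expr0; ring.
by rewrite /= exprS -!natr1; ring.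
Qed.

(* Junk value 0 where there is no derivative. *)
Definition cD f z : R[i] := xget 0 [set l | cderiv f z l].

Definition cdiff f z := exists l, cderiv f z l.

Lemma cdiffP f z : cdiff f z -> cderiv f z (cD f z).
Proof. by move=> [l fl]; rewrite /cD; case: xgetP => [y -> //|/(_ l)]. Qed.

Lemma cderiv_cD f z l : cderiv f z l -> cD f z = l.
Proof. by move=> fl; apply: cderiv_unique (cdiffP (ex_intro _ l fl)) fl. Qed.

Lemma cderiv_diff f z l : cderiv f z l -> cdiff f z.
Proof. by exists l. Qed.

Lemma ccont_cst k z : ccont (fun=> k) z. Proof. exact: cderiv_cont (cderiv_cst _ _). Qed.
Lemma ccont_id z : ccont id z. Proof. exact: cderiv_cont (cderiv_id _). Qed.

Lemma ccontD f g z : ccont f z -> ccont g z -> ccont (fun w => f w + g w) z.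
Proof.
move=> F G e e0; have e2 : 0 < e / 2 by lra.
apply: evW (evI (F _ e2) (G _ e2)) => w [H1 H2].
by rewrite opprD addrACA (le_lt_trans (nmD _ _))//; lra.
Qed.

Lemma ccont_neq0 f z : ccont f z -> f z != 0 -> ev z (fun w => f w != 0).
Proof.
move=> F fz; have f0 : 0 < nm (f z) by rewrite nm_gt0.
apply: evW (F _ f0) => w H; apply/eqP => fw; move: H.
by rewrite fw sub0r nmN ltxx.
Qed.

Lemma ccontM f g z : ccont f z -> ccont g z -> ccont (fun w => f w * g w) z.
Proof.
move=> F G e e0.
pose K := nm (g z) + nm (f z) + 1.
have K0 : 0 < K by have := nm_ge0 (g z); have := nm_ge0 (f z); rewrite /K; lra.
pose e' := Num.min 1 (e / K).
have e'0 : 0 < e' by rewrite lt_min ltr01 divr_gt0.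
apply: evW (evI (F _ e'0) (G _ e'0)) => w [H1 H2].
have -> : f w * g w - f z * g z =
  (f w - f z) * (g w - g z) + (f w - f z) * g z + f z * (g w - g z) by ring.
apply: le_lt_trans (nmD _ _) _; apply: le_lt_trans (lerD (nmD _ _) (lexx _)) _.
rewrite !nmM.
have n1 := nm_ge0 (g z); have n2 := nm_ge0 (f z).
have n3 := nm_ge0 (f w - f z); have n4 := nm_ge0 (g w - g z).
have e1 : e' <= 1 by rewrite ge_min lexx.
have : e' <= e / K by rewrite ge_min lexx orbT.
rewrite ler_pdivlMr// /K => eK.
have A1 : nm (f w - f z) * nm (g w - g z) < e'.
  by apply: le_lt_trans (ler_piMr n3 _) H1; lra.
have A2 : nm (f w - f z) * nm (g z) <= e' * nm (g z) by rewrite ler_wpM2r// ltW.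
have A3 : nm (f z) * nm (g w - g z) <= nm (f z) * e' by rewrite ler_wpM2l// ltW.
lra.
Qed.

Lemma ccontV f z : f z != 0 -> ccont f z -> ccont (fun w => (f w)^-1) z.
Proof. by move=> fz F; apply: ccont_comp F (cderiv_cont (cderiv_inv fz)). Qed.

End ComplexDerivative.

(** * Integration over segments *)

Section RealVariable.
Variable R : realType.
Implicit Types (a b x y e : R).

Definition rd (u : R -> R) x (l : R) := forall e, 0 < e ->
  exists2 d, 0 < d & forall y, `|y - x| < d -> `|u y - u x - l * (y - x)| <= e * `|y - x|.

Lemma rd_is_derive u x l : rd u x l -> is_derive x 1 u l.
Proof.
move=> H.
have : (fun h => h^-1 *: ((u \o shift x) (h *: 1) - u x)) @ 0^' --> l.
  apply/cvgrPdist_le => e e0; have [d d0 K] := H e e0.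
  exists d => //= h /=; rewrite sub0r normrN => hd h0.
  have := K (h + x); rewrite addrK => /(_ hd) {}K.
  rewrite /= [h *: 1]mulr1 -[l in leLHS](mulKf h0) [_ *: _]/(_ * _) -mulrBr normrM normfV.
  by rewrite ler_pdivrMl ?normr_gt0// [_ * e]mulrC distrC [h * l]mulrC.
by move=> c; apply: DeriveDef; [apply/cvg_ex; exists l|apply: cvg_lim].
Qed.

Lemma is_derive_rd u x l : is_derive x 1 u l -> rd u x l.
Proof.
move=> [dv <-] e e0.
have /cvgrPdist_le/(_ _ e0)[d /= d0 K] := dv.
exists d => // y yd; have [->|yx] := eqVneq y x; first by rewrite !subrr mulr0 subrr !normr0 mulr0.
have h0 : y - x != 0 by rewrite subr_eq0.
have := K (y - x); rewrite /= sub0r normrN => /(_ yd h0).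
have -> : (y - x) *: (1 : R) = y - x by exact: mulr1.
rewrite subrK -/(derive u x (1 : R)); set l' := derive u x 1.
rewrite -[X in `|X - _| <= _ -> _](mulKf h0) [_ *: _]/(_ * _) -mulrBr normrM normfV.
by rewrite ler_pdivrMl ?normr_gt0// [_ * e]mulrC distrC [(y - x) * l']mulrC.
Qed.

Definition rderiv (H : R -> R[i]) x (l : R[i]) := forall e, 0 < e ->
  exists2 d, 0 < d & forall y, `|y - x| < d ->
    nm (H y - H x - l * (y - x)%:C%C) <= e * `|y - x|.

Lemma ReB (z w : R[i]) : complex.Re (z - w) = complex.Re z - complex.Re w.
Proof. by case: z w => [? ?] [? ?]. Qed.
Lemma ImB (z w : R[i]) : complex.Im (z - w) = complex.Im z - complex.Im w.
Proof. by case: z w => [? ?] [? ?]. Qed.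
Lemma Re_mul_real (l : R[i]) x : complex.Re (l * x%:C%C) = complex.Re l * x.
Proof. by case: l => ? ?; simpc. Qed.
Lemma Im_mul_real (l : R[i]) x : complex.Im (l * x%:C%C) = complex.Im l * x.
Proof. by case: l => ? ?; simpc. Qed.

Lemma rderiv_Re H x l : rderiv H x l -> rd (fun y => complex.Re (H y)) x (complex.Re l).
Proof.
move=> K e /K[d d0 {}K]; exists d => // y /K; apply: le_trans.
by apply: le_trans (nm_Re _); rewrite 2!ReB Re_mul_real.
Qed.
Lemma rderiv_Im H x l : rderiv H x l -> rd (fun y => complex.Im (H y)) x (complex.Im l).
Proof.
move=> K e /K[d d0 {}K]; exists d => // y /K; apply: le_trans.
by apply: le_trans (nm_Im _); rewrite 2!ImB Im_mul_real.
Qed.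
Lemma rderiv_ReIm (u v : R -> R) x (l m : R) : rd u x l -> rd v x m ->
  rderiv (fun y => u y +i* v y)%C x (l +i* m)%C.
Proof.
move=> U V e e0; have e2 : 0 < e / 2 by lra.
have [d d0 D] := U _ e2; have [f f0 F] := V _ e2.
exists (Num.min d f); first by rewrite lt_min d0 f0.
move=> y; rewrite lt_min => /andP[/D D1 /F F1].
apply: le_trans (nm_le_ReIm _) _; simpc => /=; lra.
Qed.

Lemma rd_mvt (u du : R -> R) a b K : a <= b ->
  (forall x, a <= x <= b -> rd u x (du x)) ->
  (forall x, a <= x <= b -> `|du x| <= K) -> `|u b - u a| <= K * (b - a).
Proof.
move=> ab D B.
have [||c] := @MVT_segment _ u du a b ab.
- by move=> x; rewrite in_itv /= => /andP[/ltW ax /ltW xb]; apply/rd_is_derive/D/andP.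
- apply: derivable_within_continuous => x; rewrite in_itv /= => xab.
  by have [] := rd_is_derive (D x xab).
rewrite in_itv /= => cab ->; rewrite normrM (ger0_norm (_ : 0 <= b - a)) ?subr_ge0//.
by rewrite ler_wpM2r ?subr_ge0// B.
Qed.

(** The mean value theorem is applied to the real and the imaginary part, at two different points;
    this costs the factor 2 that runs through all later estimates. *)
Lemma rderiv_mvt (H h : R -> R[i]) a b K : a <= b ->
  (forall x, a <= x <= b -> rderiv H x (h x)) ->
  (forall x, a <= x <= b -> nm (h x) <= K) -> nm (H b - H a) <= 2 * K * (b - a).
Proof.
move=> ab D B; apply: le_trans (nm_le_ReIm _) _.
have := rd_mvt ab (fun x i => rderiv_Re (D x i)) (fun x i => le_trans (nm_Re _) (B x i)).
have := rd_mvt ab (fun x i => rderiv_Im (D x i)) (fun x i => le_trans (nm_Im _) (B x i)).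
by rewrite ReB ImB; lra.
Qed.

Lemma max_lip a x y : `|Num.max a y - Num.max a x| <= `|y - x|.
Proof.
have n1 := ler_norm (y - x); have := ler_norm (x - y); rewrite distrC ler_norml => n2.
by case: (leP a x) => ?; case: (leP a y) => ?; apply/andP; split; lra.
Qed.

Lemma min_lip b x y : `|Num.min b y - Num.min b x| <= `|y - x|.
Proof.
have n1 := ler_norm (y - x); have := ler_norm (x - y); rewrite distrC ler_norml => n2.
by case: (leP b x) => ?; case: (leP b y) => ?; apply/andP; split; lra.
Qed.

Lemma rd_primitive (u : R -> R) a b :
  (forall x, a <= x <= b -> forall e, 0 < e -> exists2 d, 0 < d &
     forall y, a <= y <= b -> `|y - x| < d -> `|u y - u x| < e) ->
  exists U, forall x, a <= x <= b -> rd U x (u x).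
Proof.
move=> cu; have [ab|ba] := leP a b; last by exists u => x /andP[]; lra.
(* Clamping extends [u] continuously to the whole line by its end values. *)
pose cl y := Num.max a (Num.min b y).
have clab y : a <= cl y <= b by rewrite /cl le_max lexx /= ge_max ab ge_min lexx.
have cl_id y : a <= y <= b -> cl y = y.
  by move=> /andP[ay yb]; rewrite /cl (min_idPr yb) (max_idPr ay).
have cl_lip x y : `|cl y - cl x| <= `|y - x|.
  apply: le_trans (max_lip _ _ _) _; exact: min_lip.
pose v := u \o cl.
have cv : continuous v.
  move=> x; apply/cvgrPdist_lt => e e0; have [d d0 D] := cu _ (clab x) e e0.
  exists d => //= y /= xy; rewrite distrC; apply: D => //.
  by rewrite (le_lt_trans (cl_lip _ _))// distrC.
(* Integrating from a - 1 makes every point of [a, b] interior, so that the derivative is two-sided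
   at the ends as well. *)
exists (fun x => (\int[lebesgue_measure]_(t in [set` `[a - 1, x]]) v t)%R) => x xab.
have /andP[ax xb] := xab.
apply: is_derive_rd; have xb1 : x < b + 1 by lra.
have [|||D E] := @continuous_FTC1_closed R v (a - 1) x (b + 1) xb1.
- apply: continuous_compact_integrable; first exact: segment_compact.
  exact: continuous_subspaceT.
- lra.
- exact: cv.
by apply: DeriveDef => //; rewrite -derive1E E /v /= cl_id.
Qed.

Definition rcontin (h : R -> R[i]) a b :=
  forall x, a <= x <= b -> forall e, 0 < e -> exists2 d, 0 < d &
     forall y, a <= y <= b -> `|y - x| < d -> nm (h y - h x) < e.

Lemma rderiv_primitive (h : R -> R[i]) a b : rcontin h a b ->
  exists H, forall x, a <= x <= b -> rderiv H x (h x).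
Proof.
move=> ch.
have [|U HU] := @rd_primitive (fun x => complex.Re (h x)) a b.
  move=> x xab e /(ch x xab)[d d0 D]; exists d => // y yab /(D y yab).
  by apply: le_lt_trans; rewrite -ReB; exact: nm_Re.
have [|V HV] := @rd_primitive (fun x => complex.Im (h x)) a b.
  move=> x xab e /(ch x xab)[d d0 D]; exists d => // y yab /(D y yab).
  by apply: le_lt_trans; rewrite -ImB; exact: nm_Im.
exists (fun x => (U x +i* V x)%C) => x xab.
rewrite (_ : h x = (complex.Re (h x) +i* complex.Im (h x))%C); last by case: (h x).
by apply: rderiv_ReIm; [exact: HU|exact: HV].
Qed.

Lemma rderivD (F G : R -> R[i]) x l m : rderiv F x l -> rderiv G x m ->
  rderiv (fun y => F y + G y) x (l + m).
Proof.
move=> fl gm e e0; have e2 : 0 < e / 2 by lra.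
have [d d0 D] := fl _ e2; have [f f0 D'] := gm _ e2.
exists (Num.min d f); first by rewrite lt_min d0 f0.
move=> y; rewrite lt_min => /andP[/D H1 /D' H2].
have := nmD (F y - F x - l * (y - x)%:C%C) (G y - G x - m * (y - x)%:C%C).
rewrite (_ : _ + _ = F y + G y - (F x + G x) - (l + m) * (y - x)%:C%C); last by ring.
lra.
Qed.

Lemma rderivZ k (F : R -> R[i]) x l : rderiv F x l ->
  rderiv (fun y => k * F y) x (k * l).
Proof.
move=> fl e e0; have k0 : 0 < nm k + 1 by have := nm_ge0 k; lra.
have [d d0 D] := fl _ (divr_gt0 e0 k0).
exists d => // y /D; rewrite -mulrA -!mulrBr nmM => H.
apply: le_trans (ler_wpM2l (nm_ge0 _) H) _; rewrite mulrA ler_wpM2r//.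
by rewrite mulrCA ler_piMr ?ler_pdivrMr ?mul1r ?ltW//; lra.
Qed.

(* The integral of h over [a, b]; only meaningful when a <= b and h is continuous there. *)
Definition rI (h : R -> R[i]) a b : R[i] :=
  xget 0 [set v | exists H, (forall x, a <= x <= b -> rderiv H x (h x)) /\ v = H b - H a].

(** Two primitives differ by a function with derivative 0, so the choice hidden in [rI] is
    immaterial. *)
Lemma rI_eq h H a b : a <= b -> (forall x, a <= x <= b -> rderiv H x (h x)) ->
  rI h a b = H b - H a.
Proof.
move=> ab HH; rewrite /rI; case: xgetP => [v -> [G [HG ->]]|/(_ (H b - H a))[]]; last by exists H.
apply/eqP; rewrite -subr_eq0 -nm_eq0 eq_le nm_ge0 andbT.
have D x : a <= x <= b -> rderiv (fun y => G y + -1 * H y) x 0.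
  move=> xab; have := rderivD (HG x xab) (rderivZ (-1) (HH x xab)).
  by rewrite mulN1r subrr.
have := @rderiv_mvt _ (fun=> 0) a b 0 ab D.
rewrite nm0 mulr0 mul0r => /(_ (fun _ _ => lexx _)).
by rewrite (_ : G b - G a - _ = G b + -1 * H b - (G a + -1 * H a))//; ring.
Qed.

Lemma rID f g a b : a <= b -> rcontin f a b -> rcontin g a b ->
  rI (fun x => f x + g x) a b = rI f a b + rI g a b.
Proof.
move=> ab /rderiv_primitive[F HF] /rderiv_primitive[G HG].
rewrite (rI_eq ab HF) (rI_eq ab HG) (rI_eq ab (fun x i => rderivD (HF x i) (HG x i))).
ring.
Qed.

Lemma rIZ k f a b : a <= b -> rcontin f a b ->
  rI (fun x => k * f x) a b = k * rI f a b.
Proof.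
move=> ab /rderiv_primitive[F HF].
rewrite (rI_eq ab HF) (rI_eq ab (fun x i => rderivZ k (HF x i))).
ring.
Qed.

Lemma rI_bound f a b K : a <= b -> rcontin f a b ->
  (forall x, a <= x <= b -> nm (f x) <= K) -> nm (rI f a b) <= 2 * K * (b - a).
Proof.
move=> ab /rderiv_primitive[F HF] B; rewrite (rI_eq ab HF).
exact: rderiv_mvt HF B.
Qed.

Lemma rI_ext f g a b : (forall x, a <= x <= b -> f x = g x) -> rI f a b = rI g a b.
Proof.
move=> fg; congr xget; apply/seteqP; split=> v /= [H [HH ->]]; exists H; split=> // x xab.
  by rewrite -fg//; exact: HH.
by rewrite fg//; exact: HH.
Qed.

Lemma rcontin_affine f p u a b : (forall x, a <= x <= b -> ccont f (p + u * x%:C%C)) ->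
  rcontin (fun x => f (p + u * x%:C%C)) a b.
Proof.
move=> F x xab e e0; have [d d0 D] := F x xab e e0.
have u0 : 0 < nm u + 1 by have := nm_ge0 u; lra.
exists (d / (nm u + 1)); first exact: divr_gt0.
move=> y _; rewrite ltr_pdivlMr// => yx; apply: D.
rewrite (_ : _ - _ = u * (y - x)%:C%C); last by rewrite rmorphB; ring.
rewrite nmM nm_real; have := normr_ge0 (y - x); nra.
Qed.

Lemma rderiv_affine F p u x l : cderiv F (p + u * x%:C%C) l ->
  rderiv (fun x => F (p + u * x%:C%C)) x (u * l).
Proof.
move=> D e e0; have u0 : 0 < nm u + 1 by have := nm_ge0 u; lra.
have [d d0 {}D] := D _ (divr_gt0 e0 u0).
exists (d / (nm u + 1)); first exact: divr_gt0.
move=> y; rewrite ltr_pdivlMr// => yx.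
have E : p + u * y%:C%C - (p + u * x%:C%C) = u * (y - x)%:C%C by rewrite rmorphB; ring.
have := D (p + u * y%:C%C); rewrite E nmM nm_real.
have -> : u * l * (y - x)%:C%C = l * (u * (y - x)%:C%C) by ring.
have n0 := normr_ge0 (y - x); have nu := nm_ge0 u.
have K : nm u * `|y - x| < d by nra.
move=> /(_ K)/le_trans; apply; rewrite mulrA ler_wpM2r//.
by rewrite mulrAC ler_pdivrMr// ler_wpM2l ?ltW//; lra.
Qed.

End RealVariable.

(** * Contour integrals along segments and around rectangles *)

Section Segments.
Variable R : realType.
Implicit Types (s t u v x y e : R) (p w z : R[i]) (f g F : R[i] -> R[i]).
Notation Re := (@complex.Re R).
Notation Im := (@complex.Im R).

(** The contour integral of f dz; the factor [w] is the velocity of the path. *)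
Definition seg f p w s : R[i] := rI (fun x => w * f (p + w * x%:C%C)) 0 s.

Definition scont f p w s := forall x, 0 <= x <= s -> ccont f (p + w * x%:C%C).

Lemma scont_rcontin f p w s : scont f p w s -> rcontin (fun x => w * f (p + w * x%:C%C)) 0 s.
Proof.
move=> F; apply: (@rcontin_affine _ (fun z => w * f z)) => x /F.
by apply: ccontM; exact: ccont_cst.
Qed.

Lemma seg_split f p w s t : 0 <= s -> 0 <= t -> scont f p w (s + t) ->
  seg f p w (s + t) = seg f p w s + seg f (p + w * s%:C%C) w t.
Proof.
move=> s0 t0 /scont_rcontin/rderiv_primitive[H HH].
rewrite /seg (rI_eq _ HH); last lra.
rewrite (rI_eq s0 (H := H)); last by move=> x /andP[? ?]; apply: HH; apply/andP; split; lra.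
rewrite (rI_eq t0 (H := fun x => H (s + x))); first by rewrite addr0; ring.
move=> x /andP[x0 xt] e e0.
have [|d d0 D] := HH (s + x) _ e e0; first by apply/andP; split; lra.
exists d => // y yx; have := D (s + y); rewrite (_ : s + y - (s + x) = y - x); last by ring.
by move=> /(_ yx); rewrite rmorphD mulrDr addrA.
Qed.

Lemma segD f g p w s : 0 <= s -> scont f p w s -> scont g p w s ->
  seg (fun z => f z + g z) p w s = seg f p w s + seg g p w s.
Proof.
move=> s0 /scont_rcontin F /scont_rcontin G; rewrite /seg -rID//.
by apply: rI_ext => x _; rewrite mulrDr.
Qed.

Lemma segZ k f p w s : 0 <= s -> scont f p w s ->
  seg (fun z => k * f z) p w s = k * seg f p w s.
Proof.
move=> s0 /scont_rcontin F; rewrite /seg -rIZ//.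
by apply: rI_ext => x _; rewrite mulrCA.
Qed.

Lemma seg_ext f g p w s : (forall x, 0 <= x <= s -> f (p + w * x%:C%C) = g (p + w * x%:C%C)) ->
  seg f p w s = seg g p w s.
Proof. by move=> fg; apply: rI_ext => x /fg ->. Qed.

Lemma seg_bound f p w s K : 0 <= s -> nm w = 1 -> scont f p w s ->
  (forall x, 0 <= x <= s -> nm (f (p + w * x%:C%C)) <= K) -> nm (seg f p w s) <= 2 * K * s.
Proof.
move=> s0 w1 /scont_rcontin F B.
have := rI_bound s0 F; rewrite -[s in _ -> nm _ <= _ * s]subr0; apply => x /B.
by rewrite nmM w1 mul1r.
Qed.

Lemma seg_prim f F p w s : 0 <= s ->
  (forall x, 0 <= x <= s -> cderiv F (p + w * x%:C%C) (f (p + w * x%:C%C))) ->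
  seg f p w s = F (p + w * s%:C%C) - F p.
Proof.
move=> s0 D; rewrite /seg (rI_eq s0 (H := fun x => F (p + w * x%:C%C))).
  by rewrite mulr0 addr0.
by move=> x xs; apply: rderiv_affine; apply: D.
Qed.

(** The integral around the rectangle, counterclockwise: bottom, right, top, left. The last two
    sides are parametrised against the orientation, hence the signs. *)
Definition PHI f p u v : R[i] :=
  seg f p 1 u + seg f (p + u%:C%C) 'i%C v - seg f (p + 'i%C * v%:C%C) 1 u - seg f p 'i%C v.

Definition inrect p u v z : Prop :=
  [/\ Re p <= Re z, Re z <= Re p + u, Im p <= Im z & Im z <= Im p + v].

Definition bdry p u v z : Prop := inrect p u v z /\
  (Re z = Re p \/ Re z = Re p + u \/ Im z = Im p \/ Im z = Im p + v).

Lemma ReD z w : Re (z + w) = Re z + Re w.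
Proof. by case: z w => [? ?] [? ?]. Qed.
Lemma ImD z w : Im (z + w) = Im z + Im w.
Proof. by case: z w => [? ?] [? ?]. Qed.
Lemma Re_real x : Re x%:C%C = x. Proof. by []. Qed.
Lemma Im_real x : Im x%:C%C = 0. Proof. by []. Qed.
Lemma Re_imul x : Re ('i%C * x%:C%C) = 0.
Proof. by rewrite /=; ring. Qed.
Lemma Im_imul x : Im ('i%C * x%:C%C) = x.
Proof. by rewrite /=; ring. Qed.
Definition ReImE := (ReD, ImD, ReB, ImB, Re_imul, Im_imul, Re_real, Im_real, mul1r, addr0, add0r).

Lemma complexP z w : Re z = Re w -> Im z = Im w -> z = w.
Proof. by case: z w => [? ?] [? ?] /= -> ->. Qed.

Variables (p : R[i]) (u v : R).
Hypotheses (u0 : 0 <= u) (v0 : 0 <= v).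

Lemma bdry_edges (P : R[i] -> Prop) : (forall z, bdry p u v z -> P z) ->
  [/\ forall x, 0 <= x <= u -> P (p + 1 * x%:C%C),
      forall x, 0 <= x <= v -> P (p + u%:C%C + 'i%C * x%:C%C),
      forall x, 0 <= x <= u -> P (p + 'i%C * v%:C%C + 1 * x%:C%C) &
      forall x, 0 <= x <= v -> P (p + 'i%C * x%:C%C)].
Proof.
have [u1 v1] := (u0, v0).
move=> H; split=> x /andP[x0 x1]; apply: H; rewrite /bdry /inrect !ReImE; split;
  try (split; lra).
- by right; right; left.
- by right; left.
- by right; right; right.
- by left.
Qed.

Lemma PHI_ext f g : (forall z, bdry p u v z -> f z = g z) -> PHI f p u v = PHI g p u v.
Proof.
move=> /bdry_edges[h1 h2 h3 h4]; rewrite /PHI.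
by rewrite (seg_ext h1) (seg_ext h2) (seg_ext h3) (seg_ext h4).
Qed.

Lemma PHID f g : (forall z, bdry p u v z -> ccont f z) -> (forall z, bdry p u v z -> ccont g z) ->
  PHI (fun z => f z + g z) p u v = PHI f p u v + PHI g p u v.
Proof.
move=> /bdry_edges[h1 h2 h3 h4] /bdry_edges[k1 k2 k3 k4]; rewrite /PHI.
rewrite (segD u0 h1 k1) (segD v0 h2 k2) (segD u0 h3 k3) (segD v0 h4 k4); ring.
Qed.

Lemma PHIZ k f : (forall z, bdry p u v z -> ccont f z) ->
  PHI (fun z => k * f z) p u v = k * PHI f p u v.
Proof.
move=> /bdry_edges[h1 h2 h3 h4]; rewrite /PHI.
rewrite (segZ k u0 h1) (segZ k v0 h2) (segZ k u0 h3) (segZ k v0 h4); ring.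
Qed.

Lemma PHI_bound f K : (forall z, bdry p u v z -> ccont f z) ->
  (forall z, bdry p u v z -> nm (f z) <= K) -> nm (PHI f p u v) <= 4 * K * (u + v).
Proof.
move=> /bdry_edges[h1 h2 h3 h4] /bdry_edges[k1 k2 k3 k4].
have B1 := seg_bound u0 (nm1 R) h1 k1; have B2 := seg_bound v0 (nm_i R) h2 k2.
have B3 := seg_bound u0 (nm1 R) h3 k3; have B4 := seg_bound v0 (nm_i R) h4 k4.
rewrite /PHI; apply: le_trans (nmB _ _) _.
apply: le_trans (lerD (nmB _ _) (lexx _)) _.
apply: le_trans (lerD (lerD (nmD _ _) (lexx _)) (lexx _)) _; lra.
Qed.

Lemma PHI_prim f F : (forall z, bdry p u v z -> cderiv F z (f z)) -> PHI f p u v = 0.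
Proof.
move=> /bdry_edges[h1 h2 h3 h4]; rewrite /PHI.
rewrite (seg_prim u0 h1) (seg_prim v0 h2) (seg_prim u0 h3) (seg_prim v0 h4) !mul1r.
by rewrite [p + 'i%C * _ + _]addrAC; ring.
Qed.

End Segments.

Section Split.
Variable R : realType.
Implicit Types (s t u v x y e : R) (p w z : R[i]) (f g F : R[i] -> R[i]).

Definition rcont f p u v := forall z, inrect p u v z -> ccont f z.

Lemma PHI_hsplit f p u1 u2 v : 0 <= u1 -> 0 <= u2 -> 0 <= v -> rcont f p (u1 + u2) v ->
  PHI f p (u1 + u2) v = PHI f p u1 v + PHI f (p + u1%:C%C) u2 v.
Proof.
move=> h1 h2 hv F; rewrite /PHI seg_split// ?(seg_split (p := p + 'i%C * v%:C%C))//.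
- have -> : p + (u1 + u2)%:C%C = p + u1%:C%C + u2%:C%C by rewrite rmorphD addrA.
  rewrite !mul1r [p + 'i%C * v%:C%C + u1%:C%C]addrAC; ring.
- by move=> x /andP[x0 x1]; apply: F; rewrite /inrect ?ReImE; split; lra.
- by move=> x /andP[x0 x1]; apply: F; rewrite /inrect ?ReImE; split; lra.
Qed.

Lemma PHI_vsplit f p u v1 v2 : 0 <= v1 -> 0 <= v2 -> 0 <= u -> rcont f p u (v1 + v2) ->
  PHI f p u (v1 + v2) = PHI f p u v1 + PHI f (p + 'i%C * v1%:C%C) u v2.
Proof.
move=> h1 h2 hv F; rewrite /PHI seg_split// ?(seg_split (p := p))//.
- have -> : p + 'i%C * (v1 + v2)%:C%C = p + 'i%C * v1%:C%C + 'i%C * v2%:C%C.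
    by rewrite rmorphD mulrDr addrA.
  rewrite [p + u%:C%C + 'i%C * v1%:C%C]addrAC; ring.
- by move=> x /andP[x0 x1]; apply: F; rewrite /inrect ?ReImE; split; lra.
- by move=> x /andP[x0 x1]; apply: F; rewrite /inrect ?ReImE; split; lra.
Qed.

Lemma geom_le0 (x K : R) : (forall k : nat, x <= K / 2 ^+ k) -> x <= 0.
Proof.
move=> H; rewrite leNgt; apply/negP => x0.
have K0 : 0 < K by have := H 0%N; rewrite expr0 divr1; lra.
have [n Hn] : exists n : nat, K / x < n%:R.
  by exists (Num.bound (K / x)); apply: archi_boundP; apply: divr_ge0; exact: ltW.
have : (n <= 2 ^ n)%N by apply: ltnW; apply: ltn_expl.
rewrite -(ler_nat R) natrX => n2.
have := H n; rewrite ler_pdivlMr ?exprn_gt0//.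
by move: Hn; rewrite ltr_pdivrMr// => Hn; nra.
Qed.

(** The intervals with centre [a k] and radius the tail of the geometric series are nested; the
    supremum of their left ends lies in all of them. *)
Lemma geom_limitR (a : nat -> R) (K : R) : (forall k, `|a k.+1 - a k| <= K / 2 ^+ k) ->
  exists l, forall k, `|l - a k| <= 2 * K / 2 ^+ k.
Proof.
move=> H; pose q k : R := 2 * K / 2 ^+ k.
have qS k : q k = K / 2 ^+ k + q k.+1.
  by rewrite /q exprS; field; rewrite expf_neq0.
have K0 : 0 <= K by have := H 0%N; rewrite expr0 divr1; apply: le_trans; exact: normr_ge0.
have q0 k : 0 <= q k by rewrite /q divr_ge0 ?mulr_ge0 ?exprn_ge0.
have lo : {homo (fun k => a k - q k) : m n / (m <= n)%N >-> m <= n}.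
  apply: homo_leq => [//|??? /le_trans|k]; first exact.
  by rewrite qS; have := H k; rewrite ler_norml; lra.
have hi : {homo (fun k => - (a k + q k)) : m n / (m <= n)%N >-> m <= n}.
  apply: homo_leq => [//|??? /le_trans|k]; first exact.
  by rewrite [q k]qS; have := H k; rewrite ler_norml; lra.
have lohi m n : a m - q m <= a n + q n.
  have := lo _ _ (leq_maxl m n); have := hi _ _ (leq_maxr m n); have := q0 (maxn m n); lra.
pose A := [set a m - q m | m in setT].
have supA : has_sup A.
  split; first by exists (a 0%N - q 0%N); exists 0%N.
  by exists (a 0%N + q 0%N) => _ [m _ <-].
exists (sup A) => k; rewrite ler_norml; apply/andP; split.
  by have := ub_le_sup supA.2 (ex_intro2 _ _ k I erefl : A (a k - q k)); rewrite /q; lra.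
have := @ge_sup _ A (a k + q k) supA.1; rewrite /q => S.
suff : sup A <= a k + 2 * K / 2 ^+ k by lra.
by apply: S => _ [m _ <-]; exact: lohi.
Qed.

Lemma geom_limit (a : nat -> R[i]) (K : R) : (forall k, nm (a k.+1 - a k) <= K / 2 ^+ k) ->
  exists l, forall k, nm (l - a k) <= 4 * K / 2 ^+ k.
Proof.
move=> H.
have [|l L] := @geom_limitR (fun k => complex.Re (a k)) K.
  by move=> k; rewrite -ReB; exact: le_trans (nm_Re _) (H k).
have [|m M] := @geom_limitR (fun k => complex.Im (a k)) K.
  by move=> k; rewrite -ImB; exact: le_trans (nm_Im _) (H k).
exists (l +i* m)%C => k; apply: le_trans (nm_le_ReIm _) _; rewrite ReB ImB /=.
have := L k; have := M k; lra.
Qed.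

End Split.

(** * Goursat, Morera and Cauchy *)

Section Goursat.
Variable R : realType.
Implicit Types (s t u v x y e : R) (p w z a : R[i]) (f g F : R[i] -> R[i]).
Notation Re := (@complex.Re R).
Notation Im := (@complex.Im R).

Definition rdiff f p u v := forall z, inrect p u v z -> cdiff f z.

(** The contributions of the inner edges cancel, so the integral is the sum over the four quarters,
    one of which carries at least a fourth of it. *)
Lemma PHI_quad f p u v : 0 <= u -> 0 <= v -> rcont f p u v ->
  exists q, [/\ (q = p \/ q = p + (u / 2)%:C%C \/ q = p + 'i%C * (v / 2)%:C%C \/
                 q = p + (u / 2)%:C%C + 'i%C * (v / 2)%:C%C)
    & nm (PHI f p u v) <= 4 * nm (PHI f q (u / 2) (v / 2))].
Proof.
move=> u0 v0 F.
pose q1 := p + (u / 2)%:C%C; pose q2 := p + 'i%C * (v / 2)%:C%C.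
pose q3 := q1 + 'i%C * (v / 2)%:C%C.
have u2 : 0 <= u / 2 by lra.
have v2 : 0 <= v / 2 by lra.
have E : PHI f p u v = PHI f p (u / 2) (v / 2) + PHI f q2 (u / 2) (v / 2) +
  (PHI f q1 (u / 2) (v / 2) + PHI f q3 (u / 2) (v / 2)).
  have uE : u = u / 2 + u / 2 by lra.
  have vE : v = v / 2 + v / 2 by lra.
  have H0 := @PHI_hsplit R f p _ _ v u2 u2 v0; rewrite -uE in H0.
  have H1 := @PHI_vsplit R f p (u / 2) _ _ v2 v2 u2; rewrite -vE in H1.
  have H2 := @PHI_vsplit R f q1 (u / 2) _ _ v2 v2 u2; rewrite -vE in H2.
  rewrite H0// H1 ?H2//; rewrite /q1.
    by move=> z []; rewrite ?ReImE => *; apply: F; split; lra.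
  by move=> z []; rewrite ?ReImE => *; apply: F; split; lra.
set A := PHI f p u v in E *; set B := PHI f p _ _ in E; set C := PHI f q2 _ _ in E.
set D := PHI f q1 _ _ in E; set G := PHI f q3 _ _ in E.
have T : nm A <= nm B + nm C + (nm D + nm G).
  by rewrite E; apply: le_trans (nmD _ _) _; apply: lerD; exact: nmD.
have [HB|HB] := leP (nm A) (4 * nm B); first by exists p; split=> //; left.
have [HC|HC] := leP (nm A) (4 * nm C); first by exists q2; split=> //; right; right; left.
have [HD|HD] := leP (nm A) (4 * nm D); first by exists q1; split=> //; right; left.
exists q3; split; first by right; right; right.
by rewrite -/G; lra.
Qed.

Lemma inrect_nm p u v z : inrect p u v z -> nm (z - p) <= u + v.
Proof.
move=> [h1 h2 h3 h4]; apply: le_trans (nm_le_ReIm _) _; rewrite ReB ImB.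
by rewrite !ger0_norm; lra.
Qed.

Theorem goursat f p u v : 0 <= u -> 0 <= v -> rdiff f p u v -> PHI f p u v = 0.
Proof.
move=> u0 v0 F.
pose U k : R := u / 2 ^+ k; pose V k : R := v / 2 ^+ k.
have pos2 k : (0 : R) < 2 ^+ k by rewrite exprn_gt0.
have U0 k : 0 <= U k by exact: divr_ge0 u0 (ltW (pos2 k)).
have V0 k : 0 <= V k by exact: divr_ge0 v0 (ltW (pos2 k)).
have US k : U k.+1 = U k / 2 by rewrite /U exprS invfM mulrA mulrAC.
have VS k : V k.+1 = V k / 2 by rewrite /V exprS invfM mulrA mulrAC.
(* Choosing a quarter for every corner and every depth at once turns the descent into a plain
   recursion on corners. *)
have [step Hstep] : exists step : nat -> R[i] -> R[i], forall k q, rcont f q (U k) (V k) ->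
  [/\ (step k q = q \/ step k q = q + (U k / 2)%:C%C \/ step k q = q + 'i%C * (V k / 2)%:C%C \/
       step k q = q + (U k / 2)%:C%C + 'i%C * (V k / 2)%:C%C)
    & nm (PHI f q (U k) (V k)) <= 4 * nm (PHI f (step k q) (U k / 2) (V k / 2))].
  have H k q : exists q', rcont f q (U k) (V k) ->
    [/\ (q' = q \/ q' = q + (U k / 2)%:C%C \/ q' = q + 'i%C * (V k / 2)%:C%C \/
       q' = q + (U k / 2)%:C%C + 'i%C * (V k / 2)%:C%C)
    & nm (PHI f q (U k) (V k)) <= 4 * nm (PHI f q' (U k / 2) (V k / 2))].
    have [h|h] := pselect (rcont f q (U k) (V k)); last by exists q.
    by have [q' ?] := PHI_quad (U0 k) (V0 k) h; exists q'.
  have [s Hs] := choice (fun kq : nat * R[i] => H kq.1 kq.2).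
  by exists (fun k q => s (k, q)) => k q; exact: (Hs (k, q)).
pose a := fix a k := if k is k'.+1 then step k' (a k') else p.
have sub k : forall z, inrect (a k) (U k) (V k) z -> inrect p u v z.
  elim: k => [|k IH] z; first by rewrite /U /V expr0 !divr1.
  move=> H; apply: (IH); have [] := Hstep k (a k).
    by move=> z' /IH/F[l]; exact: cderiv_cont.
  have := U0 k; have := V0 k.
  move: H; rewrite /inrect /= US VS.
  move=> [h1 h2 h3 h4] ? ? H _; move: h1 h2 h3 h4.
  by case: H => [|[|[|]]] ->; rewrite ?ReImE => *; split; lra.
have ck k : rcont f (a k) (U k) (V k) by move=> z /sub/F[l]; exact: cderiv_cont.
have big k : nm (PHI f p u v) <= 4 ^+ k * nm (PHI f (a k) (U k) (V k)).
  elim: k => [|k IH]; first by rewrite expr0 mul1r /U /V expr0 !divr1.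
  have [_ H] := Hstep k (a k) (ck k); apply: le_trans IH _.
  rewrite exprSr -mulrA ler_wpM2l ?exprn_ge0//.
  by rewrite US VS.
have [|z0 Hz0] := @geom_limit R a (u + v).
  move=> k; have [H _] := Hstep k (a k) (ck k).
  apply: le_trans (nm_le_ReIm _) _ => /=.
  have E : (u + v) / 2 ^+ k = U k + V k by rewrite mulrDl.
  rewrite E; have := U0 k; have := V0 k.
  by case: H => [|[|[|]]] -> ? ?; rewrite ?ReImE !ger0_norm; lra.
have z0in : inrect p u v z0.
  have ain k : inrect p u v (a k).
    by apply: (sub k); have := U0 k; have := V0 k => ? ?; split; lra.
  have LR k := le_trans (nm_Re _) (Hz0 k); have LI k := le_trans (nm_Im _) (Hz0 k).
  split.
  - rewrite -subr_le0; apply: (@geom_le0 _ _ (4 * (u + v))) => k.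
    by have [? ? ? ?] := ain k; have := LR k; rewrite ReB ler_norml; lra.
  - rewrite -subr_le0; apply: (@geom_le0 _ _ (4 * (u + v))) => k.
    by have [? ? ? ?] := ain k; have := LR k; rewrite ReB ler_norml; lra.
  - rewrite -subr_le0; apply: (@geom_le0 _ _ (4 * (u + v))) => k.
    by have [? ? ? ?] := ain k; have := LI k; rewrite ImB ler_norml; lra.
  - rewrite -subr_le0; apply: (@geom_le0 _ _ (4 * (u + v))) => k.
    by have [? ? ? ?] := ain k; have := LI k; rewrite ImB ler_norml; move=> /andP[? ?]; lra.
have [l Hl] := F _ z0in.
(* D / 2^k bounds the distance from [z0] on the k-th rectangle: (u + v) / 2^k for its extent plus 4
   (u + v) / 2^k for the distance from its corner to the limit. *)
pose D : R := 5 * (u + v).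
have key e : 0 < e -> nm (PHI f p u v) <= e * (4 * D * (u + v)).
  move=> e0; have [d d0 Hd] := Hl e e0.
  have [k Dk] : exists k : nat, D / 2 ^+ k < d.
    apply/not_existsP => H.
    suff : d <= 0 by rewrite leNgt d0.
    by apply: (@geom_le0 _ _ D) => k; rewrite leNgt; apply/negP; exact: H.
  have DE : D / 2 ^+ k = (U k + V k) + 4 * (u + v) / 2 ^+ k by rewrite /D /U /V; field; rewrite gt_eqF.
  have near z : inrect (a k) (U k) (V k) z -> nm (z - z0) <= D / 2 ^+ k.
    move=> /inrect_nm H; have T := nm_tri z (a k) z0; have := Hz0 k.
    rewrite [nm (z0 - _)]nmC DE => H'; exact: le_trans T (lerD H H').
  (* The affine part of [f] at [z0] has the primitive [G], so only the error of differentiability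
     contributes to the integral. *)
  pose g z := f z0 + l * (z - z0).
  pose G z := f z0 * z + l * ((z - z0) ^+ 2 / 2).
  have dg z : cderiv g z l.
    have := cderivD (cderiv_cst (f z0) z) (cderivZ l (cderivB (cderiv_id z) (cderiv_cst z0 z))).
    by rewrite add0r subr0 mulr1.
  have dG z : cderiv G z (g z).
    have := cderivD (cderivZ (f z0) (cderiv_id z))
      (cderivZ l (cderivM (cderivX 2 (cderivB (cderiv_id z) (cderiv_cst z0 z))) (cderiv_cst 2^-1 z))).
    by rewrite (_ : _ + _ = g z)// /g /=; field.
  pose h z := f z + -1 * g z.
  have ch z : inrect (a k) (U k) (V k) z -> ccont h z.
    move=> /ck cf; apply: ccontD cf _; apply: ccontM; first exact: ccont_cst.
    exact: cderiv_cont (dg z).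
  apply: le_trans (big k) _.
  have -> : PHI f (a k) (U k) (V k) = PHI (fun z => h z + g z) (a k) (U k) (V k).
    by apply: PHI_ext => // z _; rewrite /h mulN1r subrK.
  rewrite PHID//; last 2 first.
  - by move=> z [/ch].
  - by move=> z _; exact: cderiv_cont (dg z).
  rewrite (PHI_prim (U0 k) (V0 k) (fun z _ => dG z)) addr0.
  have := @PHI_bound _ (a k) (U k) (V k) (U0 k) (V0 k) h (e * (D / 2 ^+ k)).
  move=> /(_ (fun z B => ch z B.1)) H.
  have {H} : nm (PHI h (a k) (U k) (V k)) <= 4 * (e * (D / 2 ^+ k)) * (U k + V k).
    apply: H => z [/near zz _].
    have := Hd z (le_lt_trans zz Dk).
    rewrite /h /g mulN1r opprD addrA => /le_trans; apply.
    by rewrite ler_wpM2l// ltW.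
  move=> H; apply: le_trans (ler_wpM2l (exprn_ge0 _ _) H) _ => //.
  rewrite le_eqVlt; apply/orP; left; apply/eqP.
  rewrite /U /V (_ : 4 ^+ k = 2 ^+ k * 2 ^+ k :> R); last by rewrite -exprMn; congr (_ ^+ _); lra.
  by field; rewrite gt_eqF.
apply/eqP; rewrite -nm_eq0 eq_le nm_ge0 andbT leNgt; apply/negP => n0.
set N := nm _ in key n0; set B := 4 * D * (u + v) in key.
have B0 : 0 <= B by rewrite !mulr_ge0// ?addr_ge0.
have := key (N / (2 * (B + 1))); rewrite divr_gt0//; last lra.
by move=> /(_ isT); rewrite mulrAC ler_pdivlMr; [nra|lra].
Qed.

End Goursat.

Section Goursat.
Variable R : realType.
Implicit Types (s t u v x y e : R) (p w z a : R[i]) (f g F : R[i] -> R[i]).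
Notation Re := (@complex.Re R).
Notation Im := (@complex.Im R).

(** Left, right, lower and upper strips are cut off around the square of half side [e] at [a]. None
    of them contains [a], so [goursat] makes their integrals vanish. *)
Lemma PHI_shrink f p u v a e : rcont f p u v ->
  (forall z, inrect p u v z -> z != a -> cdiff f z) ->
  0 < e -> Re p <= Re a - e -> Re a + e <= Re p + u -> Im p <= Im a - e -> Im a + e <= Im p + v ->
  PHI f p u v = PHI f ((Re a - e) +i* (Im a - e))%C (2 * e) (2 * e).
Proof.
move=> cf F e0 a1 a2 a3 a4.
have sub q s t : Re p <= Re q -> Re q + s <= Re p + u -> Im p <= Im q -> Im q + t <= Im p + v ->
    forall z, inrect q s t z -> inrect p u v z.
  move=> b1 b2 b3 b4 z [c1 c2 c3 c4]; split.
  - exact: le_trans c1.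
  - exact: le_trans c2 _.
  - exact: le_trans c3.
  - exact: le_trans c4 _.
have F' q s t : 0 <= s -> 0 <= t ->
    Re p <= Re q -> Re q + s <= Re p + u -> Im p <= Im q -> Im q + t <= Im p + v ->
    (Re q + s < Re a \/ Re a < Re q) \/ (Im q + t < Im a \/ Im a < Im q) ->
    PHI f q s t = 0.
  move=> s0 t0 b1 b2 b3 b4 H; apply: goursat => // z zq; apply: F; first exact: sub b1 b2 b3 b4 z zq.
  apply/eqP => zE; move: zq; rewrite zE => -[c1 c2 c3 c4].
  by case: H => -[] H; [move: c2|move: c1|move: c4|move: c3]; rewrite leNgt H.
have cf' q s t : Re p <= Re q -> Re q + s <= Re p + u -> Im p <= Im q -> Im q + t <= Im p + v ->
    rcont f q s t by move=> b1 b2 b3 b4 z /(sub q s t b1 b2 b3 b4); exact: cf.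
pose s1 := Re a - e - Re p; pose s3 := Re p + u - Re a - e.
pose t1 := Im a - e - Im p; pose t3 := Im p + v - Im a - e.
have e2 : 0 <= 2 * e by lra.
have s10 : 0 <= s1 by rewrite /s1; lra.
have s30 : 0 <= s3 by rewrite /s3; lra.
have t10 : 0 <= t1 by rewrite /t1; lra.
have t30 : 0 <= t3 by rewrite /t3; lra.
have uE : u = s1 + (2 * e + s3) by rewrite /s1 /s3; lra.
have vE : v = t1 + (2 * e + t3) by rewrite /t1 /t3; lra.
have v0 : 0 <= v by rewrite vE (addr_ge0 t10 (addr_ge0 e2 t30)).
have P1 : Re p + s1 = Re a - e by rewrite /s1; lra.
have P2 : Re a - e + (2 * e + s3) = Re p + u by rewrite /s3; lra.
have P3 : Im p + t1 = Im a - e by rewrite /t1; lra.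
have P4 : Im a - e + (2 * e + t3) = Im p + v by rewrite /t3; lra.
have P5 : Re a - e + 2 * e = Re a + e by lra.
have P6 : Im a - e + 2 * e = Im a + e by lra.
have ua : Re a - e <= Re p + u by rewrite -P2 lerDl addr_ge0.
have va : Im a - e <= Im p + v by rewrite -P4 lerDl addr_ge0.
have U3 : Re a + e + s3 = Re p + u by rewrite /s3; lra.
have V3 : Im a + e + t3 = Im p + v by rewrite /t3; lra.
have lt1 (x : R) : x - e < x by rewrite ltrBlDr ltrDl.
have lt2 (x : R) : x < x + e by rewrite ltrDl.
clearbody s1 s3 t1 t3.
rewrite {1}uE PHI_hsplit ?addr_ge0 // -?uE //.
rewrite [PHI f p s1 v]F' ?P1 //; last by left; left.
rewrite add0r; set p1 := p + s1%:C%C.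
have Rp1 : Re p1 = Re a - e by rewrite /p1 !ReImE.
have Ip1 : Im p1 = Im p by rewrite /p1 !ReImE.
rewrite PHI_hsplit //; last by apply: cf'; rewrite ?Rp1 ?Ip1 ?P2.
have Rp1' : Re (p1 + (2 * e)%:C%C) = Re a + e by rewrite ReD Re_real Rp1 P5.
have Ip1' : Im (p1 + (2 * e)%:C%C) = Im p by rewrite ImD Im_real addr0.
have ua' : Re p <= Re a + e by apply: le_trans a1 _; rewrite lerD2l lerNl ltW // (lt_trans _ e0) // oppr_lt0.
rewrite [PHI f (p1 + _) s3 v]F' ?Rp1' ?Ip1' ?U3 //; last by left; right.
rewrite addr0 {1}vE PHI_vsplit ?addr_ge0 // -?vE; last by apply: cf'; rewrite ?Rp1 ?Ip1 ?P5.
rewrite [PHI f p1 _ t1]F' ?Rp1 ?Ip1 ?P3 ?P5 //; last by right; left.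
rewrite add0r; set p2 := p1 + 'i%C * t1%:C%C.
have Rp2 : Re p2 = Re a - e by rewrite ReD Re_imul Rp1 addr0.
have Ip2 : Im p2 = Im a - e by rewrite ImD Im_imul Ip1 P3.
rewrite PHI_vsplit //; last by apply: cf'; rewrite ?Rp2 ?Ip2 ?P4 ?P5.
have Rp2' : Re (p2 + 'i%C * (2 * e)%:C%C) = Re a - e by rewrite ReD Re_imul Rp2 addr0.
have Ip2' : Im (p2 + 'i%C * (2 * e)%:C%C) = Im a + e by rewrite ImD Im_imul Ip2 P6.
have va' : Im p <= Im a + e by apply: le_trans a3 _; rewrite lerD2l lerNl ltW // (lt_trans _ e0) // oppr_lt0.
rewrite [PHI f (p2 + _) _ t3]F' ?Rp2' ?Ip2' ?P5 ?V3 //; last by right; right.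
rewrite addr0; congr (PHI f _ _ _); apply: complexP; by rewrite ?Rp2 ?Ip2.
Qed.

(** Continuity at [a] bounds [f] there, while the perimeter of the square left by [PHI_shrink] tends
    to 0. *)
Lemma goursat1 f p u v a : rcont f p u v ->
  (forall z, inrect p u v z -> z != a -> cdiff f z) ->
  Re p < Re a < Re p + u -> Im p < Im a < Im p + v -> PHI f p u v = 0.
Proof.
move=> cf F /andP[a1 a2] /andP[a3 a4].
have ain : inrect p u v a by split; lra.
have [d d0 Hd] := cf a ain 1 ltr01.
pose m := Num.min (Num.min (Re a - Re p) (Re p + u - Re a))
                  (Num.min (Im a - Im p) (Im p + v - Im a)).
have m0 : 0 < m by rewrite /m !lt_min; repeat (apply/andP; split); lra.
have mE : [/\ m <= Re a - Re p, m <= Re p + u - Re a, m <= Im a - Im p & m <= Im p + v - Im a].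
  by rewrite /m; split; rewrite !ge_min lexx ?orbT.
case: mE => m1 m2 m3 m4.
pose B := nm (f a) + 1.
have B0 : 0 < B by have := nm_ge0 (f a); rewrite /B; lra.
have key e : 0 < e -> e < m -> e < d / 4 -> nm (PHI f p u v) <= 16 * B * e.
  move=> e0 em ed.
  rewrite (PHI_shrink cf F e0); [|lra|lra|lra|lra].
  set p2 := (_ +i* _)%C; have e2 : 0 <= 2 * e by rewrite mulr_ge0 // ltW.
  have inr z : inrect p2 (2 * e) (2 * e) z -> inrect p u v z /\ nm (z - a) < d.
    rewrite /inrect /= => -[h1 h2 h3 h4].
    have A : `|Re z - Re a| <= e by clear -h1 h2; rewrite ler_norml; apply/andP; split; lra.
    have B' : `|Im z - Im a| <= e by clear -h3 h4; rewrite ler_norml; apply/andP; split; lra.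
    split; first by clear -h1 h2 h3 h4 m1 m2 m3 m4 em; split; lra.
    by apply: le_lt_trans (nm_le_ReIm _) _; rewrite ReB ImB; clear -A B' ed d0; lra.
  apply: le_trans (@PHI_bound _ p2 (2 * e) (2 * e) e2 e2 f B _ _) _.
  - by move=> z [/inr[+ _] _]; exact: cf.
  - move=> z [/inr[_ /Hd] + _] => H; have := nm_tri (f z) (f a) 0.
    by rewrite !subr0 /B; lra.
  - lra.
apply/eqP; rewrite -nm_eq0 eq_le nm_ge0 andbT leNgt; apply/negP => n0.
set N := nm _ in key n0.
pose e := Num.min (Num.min (m / 2) (d / 8)) (N / (32 * B)).
have e0 : 0 < e by rewrite /e !lt_min !divr_gt0// mulr_gt0.
have e1 : e <= m / 2 by rewrite /e !ge_min lexx.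
have e2 : e <= d / 8 by rewrite /e !ge_min lexx orbT.
have : e <= N / (32 * B) by rewrite /e !ge_min lexx !orbT.
rewrite ler_pdivlMr ?mulr_gt0// => e3.
have := key e e0; have e4 : e < m by lra.
have e5 : e < d / 4 by lra.
by move=> /(_ e4 e5); lra.
Qed.

End Goursat.

(** * Primitives from vanishing rectangle integrals *)

Section Morera.
Variable R : realType.
Implicit Types (s t u v x y e : R) (p w z a : R[i]) (f g F : R[i] -> R[i]).
Notation Re := (@complex.Re R).
Notation Im := (@complex.Im R).

Lemma seg_approx f z w s k K : 0 <= s -> nm w = 1 -> scont f z w s ->
  (forall x, 0 <= x <= s -> nm (f (z + w * x%:C%C) - k) <= K) ->
  nm (seg f z w s - k * (w * s%:C%C)) <= 2 * K * s.
Proof.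
move=> s0 w1 cf B.
have -> : seg f z w s - k * (w * s%:C%C) = seg (fun z => f z + - k) z w s.
  rewrite segD//; last by move=> x _; exact: ccont_cst.
  rewrite (@seg_prim _ (fun=> - k) (fun z => - k * z)) //; first ring.
  move=> x _; have := cderivZ (- k) (cderiv_id (z + w * x%:C%C)).
  by rewrite mulr1.
apply: seg_bound => // x xs.
by apply: ccontD (cf x xs) _; exact: ccont_cst.
Qed.

Lemma corner_shift p z : p + (Re z - Re p)%:C%C + 'i%C * (Im z - Im p)%:C%C = z.
Proof. by apply: complexP; rewrite !ReImE addrC subrK. Qed.

Variables (f : R[i] -> R[i]) (p : R[i]) (u v : R).
Hypothesis cf : rcont f p u v.
Hypothesis Pf : forall q s t, 0 <= s -> 0 <= t ->
  (forall z, inrect q s t z -> inrect p u v z) -> PHI f q s t = 0.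

Let F z := seg f p 1 (Re z - Re p) + seg f (p + (Re z - Re p)%:C%C) 'i%C (Im z - Im p).

Lemma scont_rect q w s : (forall x, 0 <= x <= s -> inrect p u v (q + w * x%:C%C)) -> scont f q w s.
Proof. by move=> H x /H/cf. Qed.

(** The two paths that define [F] and the segment from z to z' bound a rectangle, around which the
    integral vanishes by [Pf]. *)
Lemma morera_hor z z' : inrect p u v z -> inrect p u v z' -> Im z = Im z' -> Re z <= Re z' ->
  F z' - F z = seg f z 1 (Re z' - Re z).
Proof.
move=> [h1 h2 h3 h4] [k1 k2 k3 k4] I zz.
have H1 : 0 <= Re z - Re p by lra.
have H2 : 0 <= Re z' - Re z by lra.
have H3 : 0 <= Im z - Im p by lra.
have := @Pf (p + (Re z - Re p)%:C%C) (Re z' - Re z) (Im z - Im p) H2 H3.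
have -> : F z' = seg f p 1 ((Re z - Re p) + (Re z' - Re z)) +
   seg f (p + (Re z - Re p)%:C%C + (Re z' - Re z)%:C%C) 'i%C (Im z - Im p).
  rewrite /F -I; congr (seg _ _ _ _ + seg _ _ _ _); first by ring.
  by rewrite -addrA -rmorphD; congr (p + (_)%:C%C); ring.
rewrite seg_split//; last first.
  by apply: scont_rect => x /andP[? ?]; rewrite /inrect !ReImE; split; lra.
rewrite /PHI /F mul1r corner_shift => H; apply/eqP; rewrite -subr_eq0 -H; first by apply/eqP; ring.
by move=> w [] ; rewrite ?ReImE => *; split; lra.
Qed.

Lemma morera_ver z z' : inrect p u v z -> inrect p u v z' -> Re z = Re z' -> Im z <= Im z' ->
  F z' - F z = seg f z 'i%C (Im z' - Im z).
Proof.
move=> [h1 h2 h3 h4] [k1 k2 k3 k4] I zz.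
have H2 : 0 <= Im z' - Im z by lra.
have H3 : 0 <= Im z - Im p by lra.
rewrite /F -I; have -> : Im z' - Im p = (Im z - Im p) + (Im z' - Im z) by ring.
rewrite [seg f _ 'i%C (_ + _)]seg_split//; last first.
  by apply: scont_rect => x /andP[? ?]; rewrite /inrect !ReImE; split; lra.
by rewrite corner_shift; ring.
Qed.

Lemma morera z : Re p < Re z < Re p + u -> Im p < Im z < Im p + v -> cderiv F z (f z).
Proof.
move=> /andP[h1 h2] /andP[h3 h4] e e0.
have zin : inrect p u v z by split; lra.
have e4 : 0 < e / 4 by lra.
have [d d0 Hd] := cf zin e4.
pose m := Num.min (Num.min (Re z - Re p) (Re p + u - Re z))
                  (Num.min (Im z - Im p) (Im p + v - Im z)).
have m0 : 0 < m by rewrite /m !lt_min; repeat (apply/andP; split); lra.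
have [m1 m2 m3 m4] : [/\ m <= Re z - Re p, m <= Re p + u - Re z, m <= Im z - Im p & m <= Im p + v - Im z].
  by rewrite /m; split; rewrite !ge_min lexx ?orbT.
exists (Num.min (d / 2) m); first by rewrite lt_min m0 divr_gt0.
move=> w; rewrite lt_min => /andP[w1 w2].
have r1 := nm_Re (w - z); have i1 := nm_Im (w - z); rewrite ?ReB ?ImB in r1 i1.
have win (q : R[i]) : `|Re q - Re z| <= nm (w - z) -> `|Im q - Im z| <= nm (w - z) ->
    inrect p u v q /\ nm (f q - f z) <= e / 4.
  move=> a1 a2; split.
    move: a1 a2; rewrite !ler_norml => /andP[? ?] /andP[? ?]; split; lra.
  apply/ltW/Hd; apply: le_lt_trans (nm_le_ReIm _) _; rewrite ReB ImB; lra.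
(* The increment of [F] is split at this corner. Each leg is at most |w - z| long and carries half
   of the error; its direction decides which end the segment starts from. *)
pose q := (Re w +i* Im z)%C.
have n0 := nm_ge0 (w - z).
have hor : nm (F q - F z - f z * (q - z)) <= e / 2 * nm (w - z).
  have iq : Im q = Im z by [].
  have [[zi _] [qi _]] : (inrect p u v z /\ nm (f z - f z) <= e / 4) /\
      (inrect p u v q /\ nm (f q - f z) <= e / 4).
    by split; apply: win; rewrite ?subrr ?normr0.
  have [zw|wz] := leP (Re z) (Re w).
    rewrite (morera_hor zi qi)// (_ : q - z = 1 * (Re q - Re z)%:C%C); last first.
      by apply: complexP; rewrite ?ReB ?ImB ?ReImE ?subrr.
    apply: le_trans (@seg_approx f z 1 (Re q - Re z) (f z) (e / 4) _ (nm1 R) _ _) _ => /=.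
    - by rewrite subr_ge0.
    - apply: scont_rect => x /andP[x0 xq]; have [] // := win (z + 1 * x%:C%C).
        by rewrite !ReImE addrAC subrr add0r (le_trans _ r1)// !ger0_norm//; clear -x0 xq zw; lra.
      by rewrite !ReImE subrr normr0.
    - move=> x /andP[x0 xq]; have [] // := win (z + 1 * x%:C%C).
        by rewrite !ReImE addrAC subrr add0r (le_trans _ r1)// !ger0_norm//; clear -x0 xq zw; lra.
      by rewrite !ReImE subrr normr0.
    - by have := ler_norm (Re w - Re z); nra.
  have -> : nm (F q - F z - f z * (q - z)) = nm (F z - F q - f z * (1 * (Re z - Re q)%:C%C)).
    have <- : z - q = 1 * (Re z - Re q)%:C%C by apply: complexP; rewrite ?ReB ?ImB ?ReImE ?subrr.
    by rewrite -[LHS]nmN; congr nm; ring.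
  rewrite (morera_hor qi zi)//; last exact: ltW.
  apply: le_trans (@seg_approx f q 1 (Re z - Re q) (f z) (e / 4) _ (nm1 R) _ _) _ => /=.
  - by rewrite subr_ge0 ltW.
  - apply: scont_rect => x /andP[x0 xq]; have [] // := win (q + 1 * x%:C%C).
      by rewrite !ReImE (le_trans _ r1)// distrC [leRHS]distrC !ger0_norm//=; move: xq => /= xq; clear -x0 xq wz; lra.
    by rewrite !ReImE subrr normr0.
  - move=> x /andP[x0 xq]; have [] // := win (q + 1 * x%:C%C).
      by rewrite !ReImE (le_trans _ r1)// distrC [leRHS]distrC !ger0_norm//=; move: xq => /= xq; clear -x0 xq wz; lra.
    by rewrite !ReImE subrr normr0.
  - by have := ler_norm (Re z - Re w); rewrite distrC in r1; nra.
have ver : nm (F w - F q - f z * (w - q)) <= e / 2 * nm (w - z).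
  have iq : Re q = Re w by [].
  have [[wi _] [qi _]] : (inrect p u v w /\ nm (f w - f z) <= e / 4) /\
      (inrect p u v q /\ nm (f q - f z) <= e / 4).
    by split; apply: win; rewrite ?subrr ?normr0.
  have [zw|wz] := leP (Im z) (Im w).
    rewrite (morera_ver qi wi)// (_ : w - q = 'i%C * (Im w - Im q)%:C%C); last first.
      by apply: complexP; rewrite ?ReB ?ImB ?ReImE ?subrr.
    apply: le_trans (@seg_approx f q 'i%C (Im w - Im q) (f z) (e / 4) _ (nm_i R) _ _) _ => /=.
    - by rewrite subr_ge0.
    - apply: scont_rect => x /andP[x0 xq]; have [] // := win (q + 'i%C * x%:C%C).
        by rewrite !ReImE.
      by rewrite !ReImE /= addrAC subrr add0r (le_trans _ i1)// !ger0_norm//; move: xq => /= xq; clear -x0 xq zw; lra.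
    - move=> x /andP[x0 xq]; have [] // := win (q + 'i%C * x%:C%C).
        by rewrite !ReImE.
      by rewrite !ReImE /= addrAC subrr add0r (le_trans _ i1)// !ger0_norm//; move: xq => /= xq; clear -x0 xq zw; lra.
    - by have := ler_norm (Im w - Im z); nra.
  have -> : nm (F w - F q - f z * (w - q)) = nm (F q - F w - f z * ('i%C * (Im q - Im w)%:C%C)).
    have <- : q - w = 'i%C * (Im q - Im w)%:C%C by apply: complexP; rewrite ?ReB ?ImB ?ReImE ?subrr.
    by rewrite -[LHS]nmN; congr nm; ring.
  rewrite (morera_ver wi qi)//; last exact: ltW.
  apply: le_trans (@seg_approx f w 'i%C (Im q - Im w) (f z) (e / 4) _ (nm_i R) _ _) _ => /=.
  - by rewrite subr_ge0 ltW.
  - apply: scont_rect => x /andP[x0 xq]; have [] // := win (w + 'i%C * x%:C%C).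
      by rewrite !ReImE.
    by rewrite !ReImE (le_trans _ i1)// distrC [leRHS]distrC !ger0_norm//=; move: xq => /= xq; clear -x0 xq wz; lra.
  - move=> x /andP[x0 xq]; have [] // := win (w + 'i%C * x%:C%C).
      by rewrite !ReImE.
    by rewrite !ReImE (le_trans _ i1)// distrC [leRHS]distrC !ger0_norm//=; move: xq => /= xq; clear -x0 xq wz; lra.
  - by have := ler_norm (Im z - Im w); rewrite distrC in i1; nra.
rewrite (_ : F w - _ - _ = (F w - F q - f z * (w - q)) + (F q - F z - f z * (q - z))); last ring.
apply: le_trans (nmD _ _) _; lra.
Qed.

End Morera.

(** * Cauchy integrals over a rectangle *)

Section CauchyKernel.
Variable R : realType.
Implicit Types (s t u v x y e M B : R) (p w z a b c : R[i]) (f g F : R[i] -> R[i]).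
Notation Re := (@complex.Re R).
Notation Im := (@complex.Im R).

Lemma cmvt F g a b K : (forall x, 0 <= x <= 1 -> cderiv F (a + (b - a) * x%:C%C) (g (a + (b - a) * x%:C%C))) ->
  (forall x, 0 <= x <= 1 -> nm (g (a + (b - a) * x%:C%C)) <= K) -> nm (F b - F a) <= 2 * K * nm (b - a).
Proof.
move=> D B.
have := @rderiv_mvt _ (fun x => F (a + (b - a) * x%:C%C)) (fun x => (b - a) * g (a + (b - a) * x%:C%C)) 0 1
  (nm (b - a) * K) ler01.
rewrite mulr1 mulr0 addr0 subrKC subr0 mulr1 mulrA => H.
rewrite mulrAC; apply: H => x x01; first exact: rderiv_affine (D x x01).
by rewrite nmM ler_wpM2l ?nm_ge0// B.
Qed.

Lemma ImV z : Im z^-1 = - Im z / (Re z ^+ 2 + Im z ^+ 2).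
Proof. by case: z => a b /=; rewrite mulNr. Qed.
Lemma ReV z : Re z^-1 = Re z / (Re z ^+ 2 + Im z ^+ 2).
Proof. by case: z. Qed.
Lemma Im_mulI z : Im ('i%C * z) = Re z.
Proof. by case: z => a b /=; ring. Qed.

(** In contrast to [rI_bound] this keeps the sign of the integrand, which [kernel1_neq0] relies
    on. *)
Lemma rI_Im_mvt (h : R -> R[i]) x y : x <= y -> rcontin h x y ->
  exists2 t, x <= t <= y & Im (rI h x y) = Im (h t) * (y - x).
Proof.
move=> xy /rderiv_primitive[H HH]; rewrite (rI_eq xy HH) ImB.
have D t : x <= t <= y -> is_derive t 1 (fun t => Im (H t)) (Im (h t)).
  by move=> txy; apply/rd_is_derive/rderiv_Im/HH.
have [||t] := @MVT_segment _ (fun t => Im (H t)) (fun t => Im (h t)) x y xy.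
- by move=> t; rewrite in_itv /= => /andP[/ltW ? /ltW ?]; apply: D; apply/andP.
- apply: derivable_within_continuous => t; rewrite in_itv /= => txy.
  by have [] := D t txy.
by rewrite in_itv /= => txy E; exists t.
Qed.

Lemma cderiv_sub a z : cderiv (fun w => w - a) z 1.
Proof. by have := cderivB (cderiv_id z) (cderiv_cst a z); rewrite subr0. Qed.

Definition interior_rect p u v a := [/\ Re p < Re a, Re a < Re p + u, Im p < Im a & Im a < Im p + v].

Lemma bdry_dist p u v a : interior_rect p u v a ->
  exists2 d, 0 < d & forall z, bdry p u v z -> d <= nm (z - a).
Proof.
move=> [a1 a2 a3 a4].
pose m := Num.min (Num.min (Re a - Re p) (Re p + u - Re a))
                  (Num.min (Im a - Im p) (Im p + v - Im a)).
have m0 : 0 < m by rewrite /m !lt_min; repeat (apply/andP; split); lra.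
have [m1 m2 m3 m4] : [/\ m <= Re a - Re p, m <= Re p + u - Re a, m <= Im a - Im p & m <= Im p + v - Im a].
  by rewrite /m; split; rewrite !ge_min lexx ?orbT.
exists m => // z [_ H]; have := nm_Re (z - a); have := nm_Im (z - a).
rewrite ReB ImB !ler_norml => /andP[? ?] /andP[? ?].
by case: H => [|[|[|]]] H; lra.
Qed.

Section Kernel.
Variables (p : R[i]) (u v : R).
Hypotheses (u0 : 0 < u) (v0 : 0 < v).
Let u0' := ltW u0.
Let v0' := ltW v0.
(** Unnormalised Cauchy integrals: up to a constant factor, the derivative of order n - 1 of [f] at
    [a] when [f] is holomorphic. *)
Notation K n f a := (PHI (fun z => f z * (z - a) ^- n) p u v).

Lemma kernel_cont f a n : interior_rect p u v a -> (forall z, bdry p u v z -> ccont f z) ->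
  forall z, bdry p u v z -> ccont (fun z => f z * (z - a) ^- n) z.
Proof.
move=> /bdry_dist[d d0 D] cf z zb; apply: ccontM (cf z zb) _.
apply: ccontV.
  by rewrite expf_neq0// -nm_gt0; exact: lt_le_trans d0 (D z zb).
exact: cderiv_cont (cderivX n (cderiv_sub a z)).
Qed.

(* The first order Taylor remainders of (z - b)^-1 and (z - b)^-2 at b = a are
   (b - a)^2 times a kernel which is bounded uniformly in z. *)
Lemma kernel_rem1 a b z : z - a != 0 -> z - b != 0 ->
  (z - b) ^- 1 - (z - a) ^- 1 - (b - a) * (z - a) ^- 2 =
  (b - a) ^+ 2 * ((z - b) ^- 1 * (z - a) ^- 2).
Proof. by move=> *; field; apply/andP. Qed.

Lemma kernel_rem2 a b z : z - a != 0 -> z - b != 0 ->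
  (z - b) ^- 2 - (z - a) ^- 2 - (b - a) * (2 * (z - a) ^- 3) =
  (b - a) ^+ 2 * ((z - b) ^- 2 * (z - a) ^- 2 + 2 * ((z - b) ^- 1 * (z - a) ^- 3)).
Proof. by move=> *; field; apply/andP. Qed.

Lemma PHI_combo f g1 g2 g3 k : (forall z, bdry p u v z -> ccont (fun z => f z * g1 z) z) ->
  (forall z, bdry p u v z -> ccont (fun z => f z * g2 z) z) ->
  (forall z, bdry p u v z -> ccont (fun z => f z * g3 z) z) ->
  PHI (fun z => f z * g1 z) p u v - PHI (fun z => f z * g2 z) p u v - k * PHI (fun z => f z * g3 z) p u v =
  PHI (fun z => f z * (g1 z - g2 z - k * g3 z)) p u v.
Proof.
move=> c1 c2 c3.
have -> : PHI (fun z => f z * (g1 z - g2 z - k * g3 z)) p u v =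
   PHI (fun z => (f z * g1 z + (-1) * (f z * g2 z)) + (- k) * (f z * g3 z)) p u v.
  by apply: PHI_ext => // z _; ring.
have cc k' g : (forall z, bdry p u v z -> ccont g z) -> forall z, bdry p u v z -> ccont (fun z => k' * g z) z.
  by move=> cg z /cg; apply: ccontM; exact: ccont_cst.
rewrite PHID//; [|by move=> z zb; apply: ccontD; [exact: c1|exact: (cc _ (fun z => f z * g2 z))]
   |exact: (cc _ (fun z => f z * g3 z))].
rewrite PHID//; last exact: (cc _ (fun z => f z * g2 z)).
rewrite (@PHIZ _ p u v u0' v0' _ (fun z => f z * g2 z))//.
by rewrite (@PHIZ _ p u v u0' v0' _ (fun z => f z * g3 z))//; ring.
Qed.

Lemma ev_interior a : interior_rect p u v a -> ev a (interior_rect p u v).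
Proof.
move=> [a1 a2 a3 a4].
pose m := Num.min (Num.min (Re a - Re p) (Re p + u - Re a))
                  (Num.min (Im a - Im p) (Im p + v - Im a)).
have m0 : 0 < m by rewrite /m !lt_min; repeat (apply/andP; split); lra.
have [m1 m2 m3 m4] : [/\ m <= Re a - Re p, m <= Re p + u - Re a, m <= Im a - Im p & m <= Im p + v - Im a].
  by rewrite /m; split; rewrite !ge_min lexx ?orbT.
exists m => // b ba; have := nm_Re (b - a); have := nm_Im (b - a).
by rewrite ReB ImB !ler_norml => /andP[? ?] /andP[? ?]; split; lra.
Qed.

Lemma kernel_est f n k M B a b : 0 <= M -> 0 <= B ->
  (forall z, bdry p u v z -> ccont f z) -> (forall z, bdry p u v z -> nm (f z) <= M) ->
  interior_rect p u v a -> interior_rect p u v b ->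
  (forall z, bdry p u v z ->
     nm ((z - b) ^- n - (z - a) ^- n - (b - a) * (k * (z - a) ^- n.+1)) <= nm (b - a) ^+ 2 * B) ->
  nm (K n f b - K n f a - (b - a) * (k * K n.+1 f a)) <= nm (b - a) ^+ 2 * (4 * (M * B) * (u + v)).
Proof.
move=> M0 B0 cf fM ai bi H.
have ck g' : (forall z, bdry p u v z -> ccont g' z) -> forall z, bdry p u v z -> ccont (fun z => k * g' z) z.
  by move=> cg z /cg; apply: ccontM; exact: ccont_cst.
have -> : k * K n.+1 f a = PHI (fun z => f z * (k * (z - a) ^- n.+1)) p u v.
  rewrite -PHIZ//; last exact: kernel_cont.
  by apply: PHI_ext => // z _; ring.
have c3 : forall z, bdry p u v z -> ccont (fun z => f z * (k * (z - a) ^- n.+1)) z.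
  move=> z zb; apply: (@ccont_ext _ (fun z => k * (f z * (z - a) ^- n.+1))).
    by apply: ev_all => w; ring.
  by apply: (ck (fun z => f z * (z - a) ^- n.+1)) => // z' zb'; apply: kernel_cont.
rewrite PHI_combo//; try exact: kernel_cont.
apply: le_trans (@PHI_bound _ p u v u0' v0' _ (M * (nm (b - a) ^+ 2 * B)) _ _) _.
- move=> z zb.
  apply: (@ccont_ext _ (fun z => (f z * (z - b) ^- n + -1 * (f z * (z - a) ^- n)) +
     - (b - a) * (f z * (k * (z - a) ^- n.+1)))).
    by apply: ev_all => w; ring.
  apply: ccontD; first apply: ccontD.
  + exact: (kernel_cont (f := f)).
  + by apply: ccontM; [exact: ccont_cst|exact: (kernel_cont (f := f))].
  + by apply: ccontM; [exact: ccont_cst|exact: c3].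
- by move=> z zb; rewrite nmM; apply: ler_pM; rewrite ?nm_ge0 ?fM ?H.
- by rewrite le_eqVlt; apply/orP; left; apply/eqP; ring.
Qed.

Lemma quad_cderiv (F : R[i] -> R[i]) a l C : 0 <= C ->
  ev a (fun b => nm (F b - F a - (b - a) * l) <= nm (b - a) ^+ 2 * C) -> cderiv F a l.
Proof.
move=> C0 H e e0; have c0 : 0 < C + 1 by lra.
apply: evW (evI H (ev_ball a (divr_gt0 e0 c0))) => b [].
rewrite ltr_pdivlMr// [l * _]mulrC => /le_trans + E; apply.
by rewrite expr2 -mulrA mulrC ler_wpM2r ?nm_ge0//; have := nm_ge0 (b - a); nra.
Qed.

Lemma kernel_inv_bound a d : 0 < d -> (forall z, bdry p u v z -> d <= nm (z - a)) ->
  forall b, nm (b - a) < d / 2 -> forall z, bdry p u v z ->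
  [/\ z - a != 0, z - b != 0, nm (z - a)^-1 <= 2 / d & nm (z - b)^-1 <= 2 / d].
Proof.
move=> d0 D b ba z zb; have za := D z zb.
have zb' : d / 2 <= nm (z - b) by have := nm_tri z b a; lra.
split; first by rewrite -nm_gt0; lra.
- by rewrite -nm_gt0; lra.
- by rewrite nmV -[leRHS]invrK invf_div lef_pV2 ?posrE; lra.
- by rewrite nmV -[leRHS]invrK invf_div lef_pV2 ?posrE; lra.
Qed.

(** The constant depends on [f] through [M] only, so it serves a whole family at once;
    [param_derivative] exploits this. *)
Lemma kernel1_taylor f M a : 0 <= M ->
  (forall z, bdry p u v z -> ccont f z) -> (forall z, bdry p u v z -> nm (f z) <= M) ->
  interior_rect p u v a -> forall d, 0 < d -> (forall z, bdry p u v z -> d <= nm (z - a)) ->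
  forall b, interior_rect p u v b -> nm (b - a) < d / 2 ->
  nm (K 1 f b - K 1 f a - (b - a) * K 2 f a) <= nm (b - a) ^+ 2 * (4 * (M * (2 / d) ^+ 3) * (u + v)).
Proof.
move=> M0 cf fM ai d d0 D b bi ba.
have B0 : 0 <= (2 / d) ^+ 3 by rewrite exprn_ge0// divr_ge0// ltW.
have := @kernel_est f 1 1 M _ a b M0 B0 cf fM ai bi; rewrite mul1r; apply.
move=> z zb; have [h1 h2 h3 h4] := kernel_inv_bound d0 D ba zb.
rewrite mul1r kernel_rem1// nmM expr2 nmM -expr2 ler_wpM2l ?exprn_ge0 ?nm_ge0//.
rewrite expr1 -[(z - a) ^- 2]exprVn expr2 !nmM !exprS expr0 mulr1.
by apply: ler_pM; rewrite ?mulr_ge0 ?nm_ge0//; apply: ler_pM; rewrite ?nm_ge0.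
Qed.

Lemma kernel1_deriv f M a : 0 <= M ->
  (forall z, bdry p u v z -> ccont f z) -> (forall z, bdry p u v z -> nm (f z) <= M) ->
  interior_rect p u v a -> cderiv (fun a => K 1 f a) a (K 2 f a).
Proof.
move=> M0 cf fM ai; have [d d0 D] := bdry_dist ai.
apply: (@quad_cderiv _ _ _ (4 * (M * (2 / d) ^+ 3) * (u + v))); last first.
  apply: evW (evI (ev_interior ai) (ev_ball a (divr_gt0 d0 (ltr0n R 2)))) => b [bi ba].
  exact: kernel1_taylor.
by rewrite !mulr_ge0 ?exprn_ge0 ?addr_ge0 ?invr_ge0// ltW.
Qed.

Lemma kernel2_deriv f M a : 0 <= M ->
  (forall z, bdry p u v z -> ccont f z) -> (forall z, bdry p u v z -> nm (f z) <= M) ->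
  interior_rect p u v a -> cderiv (fun a => K 2 f a) a (2 * K 3 f a).
Proof.
move=> M0 cf fM ai; have [d d0 D] := bdry_dist ai.
(* The kernel in [kernel_rem2] has two terms of weights 1 and 2, each a product of four inverse
   distances of size at most 2 / d. *)
have B0 : 0 <= 3 * (2 / d) ^+ 4 by rewrite mulr_ge0// exprn_ge0// divr_ge0// ltW.
apply: (@quad_cderiv _ _ _ (4 * (M * (3 * (2 / d) ^+ 4)) * (u + v))).
  by rewrite !mulr_ge0 ?exprn_ge0 ?addr_ge0 ?invr_ge0// ltW.
apply: evW (evI (ev_interior ai) (ev_ball a (divr_gt0 d0 (ltr0n R 2)))) => b [bi ba].
apply: kernel_est => // z zb; have [h1 h2 h3 h4] := kernel_inv_bound d0 D ba zb.
rewrite kernel_rem2// nmM expr2 nmM -expr2 ler_wpM2l ?exprn_ge0 ?nm_ge0//.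
set A := nm (z - a)^-1 in h3; set B := nm (z - b)^-1 in h4.
have A0 : 0 <= A by exact: nm_ge0.
have B0' : 0 <= B by exact: nm_ge0.
apply: le_trans (nmD _ _) _; rewrite -!exprVn !exprS !expr0 !mulr1 !nmM -/A -/B.
have n2 : nm (2 : R[i]) = 2.
  by rewrite -[2 in LHS](rmorph_nat (real_complex R)) nm_real normr_nat.
rewrite n2; set q := 2 / d in h3 h4 *.
have AA : A * A <= q * q by apply: ler_pM.
have AB : B * A <= q * q by apply: ler_pM.
have BB : B * B <= q * q by apply: ler_pM.
have X1 : (B * B) * (A * A) <= (q * q) * (q * q) by apply: ler_pM; rewrite ?mulr_ge0.
have X2 : (B * A) * (A * A) <= (q * q) * (q * q) by apply: ler_pM; rewrite ?mulr_ge0.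
lra.
Qed.

(** The integrand has the single-valued primitive - 1 / (z - a). Consequently the normalising
    integral [K 1 (fun=> 1)] has derivative 0. *)
Lemma kernel2_one a : interior_rect p u v a -> K 2 (fun=> 1) a = 0.
Proof.
move=> ai; have [d d0 D] := bdry_dist ai.
apply: (@PHI_prim _ p u v u0' v0' _ (fun z => - (z - a)^-1)) => z zb.
have za : z - a != 0 by rewrite -nm_gt0; exact: lt_le_trans d0 (D z zb).
have := cderivN (cderivV (f := fun w => w - a) za (cderiv_sub a z)).
by rewrite mulNr opprK.
Qed.

(** Seen from [a], each side is traversed counterclockwise and adds a positive amount to the
    imaginary part. *)
Lemma kernel1_neq0 a : interior_rect p u v a -> K 1 (fun=> 1) a != 0.
Proof.
move=> ai; have [a1 a2 a3 a4] := ai.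
have := kernel_cont 1 ai (fun z _ => ccont_cst 1 z).
move=> /(bdry_edges u0' v0')[].
pose k z := 1 * (z - a) ^- 1.
move=> /(@scont_rcontin _ k) e1 /(@scont_rcontin _ k) e2 /(@scont_rcontin _ k) e3 /(@scont_rcontin _ k) e4.
have [t1 t1i I1] := rI_Im_mvt u0' e1; have [t2 t2i I2] := rI_Im_mvt v0' e2.
have [t3 t3i I3] := rI_Im_mvt u0' e3; have [t4 t4i I4] := rI_Im_mvt v0' e4.
suff : 0 < Im (K 1 (fun=> 1) a) by apply: contraTneq => ->; rewrite ltxx.
rewrite /PHI !ImB !ImD /seg -/k {}I1 {}I2 {}I3 {}I4 /k !subr0 !mul1r.
rewrite !Im_mulI !ImV !ReV.
set q1 := p + _ - a; set q2 := p + _ + _ - a; set q3 := p + _ + _ - a; set q4 := p + _ - a.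
have E1 : Im q1 < 0 by rewrite /q1 !ReImE; lra.
have E2 : 0 < Re q2 by rewrite /q2 !ReImE; have := u0; lra.
have E3 : 0 < Im q3 by rewrite /q3 !ReImE; lra.
have E4 : Re q4 < 0 by rewrite /q4 !ReImE; lra.
have D1 : 0 < Re q1 ^+ 2 + Im q1 ^+ 2 by have := sqr_ge0 (Re q1); nra.
have D2 : 0 < Re q2 ^+ 2 + Im q2 ^+ 2 by have := sqr_ge0 (Im q2); nra.
have D3 : 0 < Re q3 ^+ 2 + Im q3 ^+ 2 by have := sqr_ge0 (Re q3); nra.
have D4 : 0 < Re q4 ^+ 2 + Im q4 ^+ 2 by have := sqr_ge0 (Im q4); nra.
have F1 : 0 < - Im q1 / (Re q1 ^+ 2 + Im q1 ^+ 2) by rewrite divr_gt0// oppr_gt0.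
have F2 := divr_gt0 E2 D2.
have F3 : - Im q3 / (Re q3 ^+ 2 + Im q3 ^+ 2) < 0 by rewrite pmulr_llt0 ?invr_gt0// oppr_lt0.
have F4 : Re q4 / (Re q4 ^+ 2 + Im q4 ^+ 2) < 0 by rewrite pmulr_llt0 ?invr_gt0.
have [? ?] := (u0, v0).
by move: F1 F2 F3 F4; do 4!move: (_ / _) => ?; nra.
Qed.

(** The difference quotient of [f] at [a], completed by the derivative there, is continuous at [a]
    and differentiable elsewhere, so [goursat1] applies to it. *)
Theorem cauchy f a : rdiff f p u v -> interior_rect p u v a ->
  K 1 f a = f a * K 1 (fun=> 1) a.
Proof.
move=> df ai; have [a1 a2 a3 a4] := ai; have [d d0 D] := bdry_dist ai.
have [l fl] : cdiff f a by apply: df; split; exact: ltW.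
pose h z := if z == a then l else (f z - f a) / (z - a).
have hE z : z != a -> h z = (f z - f a) / (z - a) by rewrite /h => /negPf ->.
have hev z : z != a -> ev z (fun w => (f w - f a) / (w - a) = h w).
  move=> za; have := ccont_neq0 (cderiv_cont (cderiv_sub a z)).
  by rewrite subr_eq0 => /(_ za); apply: evW => w; rewrite subr_eq0 => /hE.
have dh z : inrect p u v z -> z != a -> cdiff h z.
  move=> /df[m fm] za; have za' : z - a != 0 by rewrite subr_eq0.
  have := cderivM (cderivB fm (cderiv_cst (f a) z)) (cderivV (f := fun w => w - a) za' (cderiv_sub a z)).
  by move=> /(cderiv_ext (hev z za))/cderiv_diff.
have ch : rcont h p u v.
  move=> z zi; have [->|/(dh z zi)[m]] := eqVneq z a; last exact: cderiv_cont.
  move=> e e0; have e2 : 0 < e / 2 by lra.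
  apply: evW (fl _ e2) => w; have [->|wa] := eqVneq w a; first by rewrite [h a - h a]subrr nm0.
  rewrite {2}/h eqxx hE// => H.
  have w0 : w - a != 0 by rewrite subr_eq0.
  have -> : (f w - f a) / (w - a) - l = (f w - f a - l * (w - a)) / (w - a) by field.
  rewrite nmM nmV ltr_pdivrMr ?nm_gt0//; apply: le_lt_trans H _.
  by rewrite ltr_pM2r ?nm_gt0//; lra.
have bi z : bdry p u v z -> ccont f z by move=> [/df[m /cderiv_cont]].
have P0 : PHI h p u v = 0.
  by apply: (goursat1 ch dh); apply/andP.
apply/eqP; rewrite -subr_eq0 -P0 -PHIZ//; last exact: (kernel_cont (f := fun=> 1) 1 ai (fun z _ => ccont_cst 1 z)).
rewrite -[X in _ - X]mul1r -mulNr -PHIZ//; last first.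
  move=> z zb; apply: ccontM; first exact: ccont_cst.
  exact: (kernel_cont (f := fun=> 1) 1 ai (fun z _ => ccont_cst 1 z)).
rewrite -PHID//; first last.
- move=> z zb; apply: ccontM; first exact: ccont_cst.
  apply: ccontM; first exact: ccont_cst.
  exact: (kernel_cont (f := fun=> 1) 1 ai (fun z _ => ccont_cst 1 z)).
- exact: kernel_cont.
apply/eqP; apply: PHI_ext => // z zb.
have za : z - a != 0 by rewrite -nm_gt0; exact: lt_le_trans d0 (D z zb).
have zna : z != a by rewrite -subr_eq0.
rewrite (hE z zna) (mul1r (_^-1)) (mulN1r (_ * _)) -(mulrBl (z - a)^-1).
reflexivity.
Qed.

End Kernel.
End CauchyKernel.

(** * Local properties of holomorphic functions *)

Section Holomorphic.
Variable R : realType.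
Implicit Types (s t u v x y e r M B : R) (p w z a b c : R[i]) (f g F : R[i] -> R[i]).
Notation Re := (@complex.Re R).
Notation Im := (@complex.Im R).

Lemma ev_ball_open c r z : nm (z - c) < r -> ev z (fun w => nm (w - c) < r).
Proof.
move=> zr; exists (r - nm (z - c)); first lra.
by move=> w wz; have := nm_tri w z c; lra.
Qed.

(** The lower left corner of the square with centre [c] and side 2 s. *)
Definition ll c s : R[i] := c - (s +i* s)%C.

Lemma sq_near c s z : inrect (ll c s) (2 * s) (2 * s) z -> nm (z - c) <= 2 * s.
Proof.
move=> []; rewrite /ll !ReB !ImB /= => h1 h2 h3 h4.
apply: le_trans (nm_le_ReIm _) _; rewrite ReB ImB.
have A : `|Re z - Re c| <= s by rewrite ler_norml; apply/andP; split; lra.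
have B : `|Im z - Im c| <= s by rewrite ler_norml; apply/andP; split; lra.
lra.
Qed.

Lemma sq_interior c s z : nm (z - c) < s -> interior_rect (ll c s) (2 * s) (2 * s) z.
Proof.
move=> zc; have := nm_Re (z - c); have := nm_Im (z - c).
rewrite ReB ImB !ler_norml => /andP[? ?] /andP[? ?].
by rewrite /interior_rect /ll !ReB !ImB /=; split; lra.
Qed.

Lemma nm_segment c r z w x : nm (z - c) < r -> nm (w - c) < r -> 0 <= x <= 1 ->
  nm (z + (w - z) * x%:C%C - c) < r.
Proof.
move=> zr wr /andP[x0 x1].
have -> : z + (w - z) * x%:C%C - c = (1 - x)%:C%C * (z - c) + x%:C%C * (w - c).
  by rewrite rmorphB /= rmorph1; ring.
apply: le_lt_trans (nmD _ _) _; rewrite !nmM !nm_real !ger0_norm; [|lra|lra].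
have [x_lt|x_eq] : x < 1 \/ x = 1 by move: x1; rewrite le_eqVlt => /orP[/eqP|]; [right|left].
  have n1 := nm_ge0 (w - c); nra.
by rewrite x_eq subrr mul0r add0r mul1r.
Qed.

Lemma cderiv0_const F c r : (forall z, nm (z - c) < r -> cderiv F z 0) ->
  forall z w, nm (z - c) < r -> nm (w - c) < r -> F w = F z.
Proof.
move=> D z w zr wr; apply/eqP; rewrite -subr_eq0 -nm_eq0 eq_le nm_ge0 andbT.
have := @cmvt R F (fun=> 0) z w 0 _ _; rewrite mulr0 mul0r; apply.
- by move=> x x01; apply: D; exact: nm_segment.
- by move=> x _; rewrite nm0.
Qed.

Lemma ccont_bounded f c : ccont f c -> ev c (fun z => nm (f z) <= nm (f c) + 1).
Proof.
move=> /(_ 1 ltr01); apply: evW => w H.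
by have := nm_tri (f w) (f c) 0; rewrite !subr0; lra.
Qed.

Lemma cdiff_local_square f c : ev c (cdiff f) -> exists2 s, 0 < s &
  rdiff f (ll c s) (2 * s) (2 * s) /\
  forall z, inrect (ll c s) (2 * s) (2 * s) z -> nm (f z) <= nm (f c) + 1.
Proof.
move=> df; have [l /cderiv_cont/ccont_bounded bf] := ev_self df.
have [d d0 D] := evI df bf; exists (d / 4); first by rewrite divr_gt0.
suff H z : inrect (ll c (d / 4)) (2 * (d / 4)) (2 * (d / 4)) z ->
  cdiff f z /\ nm (f z) <= nm (f c) + 1 by split=> z /H[].
by move=> /sq_near H; apply: D; lra.
Qed.

(** By [cauchy], [f] is a quotient of two first order Cauchy integrals, and the denominator has
    derivative 0 by [kernel2_one]. *)
Lemma cD_kernel f p u v M : 0 < u -> 0 < v -> rdiff f p u v -> 0 <= M ->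
  (forall z, inrect p u v z -> nm (f z) <= M) ->
  forall a, interior_rect p u v a ->
  cderiv f a (PHI (fun z => f z * (z - a) ^- 2) p u v * (PHI (fun z => 1 * (z - a) ^- 1) p u v)^-1).
Proof.
move=> u0 v0 df M0 fM a ai.
have cf z : bdry p u v z -> ccont f z by move=> [/df[l /cderiv_cont]].
have fM' z : bdry p u v z -> nm (f z) <= M by move=> [/fM].
have c1 z : bdry p u v z -> ccont (fun=> 1 : R[i]) z by move=> _; exact: ccont_cst.
have m1 z : bdry p u v z -> nm (1 : R[i]) <= 1 by rewrite nm1.
have k1 := kernel1_deriv u0 v0 M0 cf fM' ai.
have k2 := kernel1_deriv u0 v0 ler01 c1 m1 ai.
rewrite (kernel2_one u0 v0 ai) in k2.
have n0 := kernel1_neq0 u0 v0 ai.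
pose k b := PHI (fun z => 1 * (z - b) ^- 1) p u v.
have := cderivM k1 (@cderivV _ k a 0 n0 k2); rewrite oppr0 mul0r mulr0 addr0.
apply: cderiv_ext; apply: evW (ev_interior ai) => b bi.
by rewrite (cauchy u0 v0 df bi) mulfK// (kernel1_neq0 u0 v0 bi).
Qed.

(** The formula of [cD_kernel] for the derivative can be differentiated once more under the
    integral, by [kernel2_deriv]. *)
Theorem cdiff_cD f c : ev c (cdiff f) -> cdiff (cD f) c.
Proof.
move=> /cdiff_local_square[s s0 [df fM]].
have u0 : 0 < 2 * s by lra.
have M0 : 0 <= nm (f c) + 1 by have := nm_ge0 (f c); lra.
have ci : interior_rect (ll c s) (2 * s) (2 * s) c by apply: sq_interior; rewrite subrr nm0.
have cf z : bdry (ll c s) (2 * s) (2 * s) z -> ccont f z by move=> [/df[l /cderiv_cont]].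
have fM' z : bdry (ll c s) (2 * s) (2 * s) z -> nm (f z) <= nm (f c) + 1 by move=> [/fM].
have c1 z : bdry (ll c s) (2 * s) (2 * s) z -> ccont (fun=> 1 : R[i]) z by move=> _; exact: ccont_cst.
have m1 z : bdry (ll c s) (2 * s) (2 * s) z -> nm (1 : R[i]) <= 1 by rewrite nm1.
pose k b := PHI (fun z => 1 * (z - b) ^- 1) (ll c s) (2 * s) (2 * s).
have := cderivM (kernel2_deriv u0 u0 M0 cf fM' ci)
  (@cderivV _ k c _ (kernel1_neq0 u0 u0 ci) (kernel1_deriv u0 u0 ler01 c1 m1 ci)).
move=> D; apply: cderiv_diff; apply: cderiv_ext D.
apply: evW (ev_interior ci) => a ai; symmetry; apply: cderiv_cD.
exact: cD_kernel M0 fM _ ai.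
Qed.

Lemma ev_cdiff_cD f c : ev c (cdiff f) -> ev c (cdiff (cD f)).
Proof. by move=> /ev_ev; apply: evW => z /cdiff_cD. Qed.

Lemma morera_local f c r : 0 < r -> (forall z, nm (z - c) < r -> ccont f z) ->
  (forall q s t, 0 <= s -> 0 <= t -> (forall z, inrect q s t z -> nm (z - c) < r) -> PHI f q s t = 0) ->
  exists F, ev c (fun z => cderiv F z (f z)).
Proof.
move=> r0 cf P.
pose s := r / 4; have s0 : 0 < s by rewrite divr_gt0.
have sr z : inrect (ll c s) (2 * s) (2 * s) z -> nm (z - c) < r.
  by move=> /sq_near; rewrite /s; lra.
have cf' : rcont f (ll c s) (2 * s) (2 * s) by move=> z /sr/cf.
have P' q t y : 0 <= t -> 0 <= y ->
  (forall z, inrect q t y z -> inrect (ll c s) (2 * s) (2 * s) z) -> PHI f q t y = 0.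
  by move=> t0 y0 H; apply: P => // z /H/sr.
have := morera cf' P'; set F := (fun z => seg _ _ _ _ + _) => H.
exists F; exists s => // w /sq_interior[h1 h2 h3 h4].
by apply: H; apply/andP.
Qed.

Lemma primitive f c : ev c (cdiff f) -> exists F, ev c (fun z => cderiv F z (f z)).
Proof.
move=> [r r0 df]; apply: (morera_local r0); first by move=> z /df[l /cderiv_cont].
by move=> q s t s0 t0 H; apply: goursat => // z /H/df.
Qed.

(** Vanishing rectangle integrals pass to the limit, so the limit has a primitive; as the derivative
    of a holomorphic function it is holomorphic. *)
Lemma uniform_limit (h : R[i] -> R[i]) c r : 0 < r ->
  (forall e, 0 < e -> exists g, forall z, nm (z - c) < r -> cdiff g z /\ nm (g z - h z) <= e) ->
  ev c (cdiff h).
Proof.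
move=> r0 H.
have cv z : nm (z - c) < r -> ccont h z.
  move=> zr e e0; have e4 : 0 < e / 4 by lra.
  have [g G] := H _ e4; have [[l /cderiv_cont cg] gv] := G z zr.
  have zr' : ev z (fun w => nm (w - c) < r).
    exact: ev_ball_open.
  apply: evW (evI zr' (cg _ e4)) => w [wr gw].
  have [_ gw'] := G w wr.
  have := nm_tri (h w) (g w) (h z); have := nm_tri (g w) (g z) (h z).
  by rewrite [nm (h w - g w)]nmC; lra.
have [|F [d d0 D]] := @morera_local h c r r0 cv.
  move=> q s t s0 t0 qr; apply/eqP; rewrite -nm_eq0 eq_le nm_ge0 andbT leNgt; apply/negP => n0.
  set N := nm _ in n0; have K0 : 0 < 8 * (s + t + 1) by lra.
  have [g G] := H _ (divr_gt0 n0 K0).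
  have cg z : bdry q s t z -> ccont g z by move=> [/qr/G[[l /cderiv_cont]]].
  have cv' z : bdry q s t z -> ccont h z by move=> [/qr/cv].
  have cm z : bdry q s t z -> ccont (fun z => h z + -1 * g z) z.
    by move=> zb; apply: ccontD; [exact: cv'|apply: ccontM; [exact: ccont_cst|exact: cg]].
  have g0 : PHI g q s t = 0 by apply: goursat => // z /qr/G[].
  have E : PHI h q s t = PHI (fun z => h z + -1 * g z) q s t.
    have c' z : bdry q s t z -> ccont (fun z => -1 * g z) z.
      by move=> zb; apply: ccontM; [exact: ccont_cst|exact: cg].
    by rewrite PHID// PHIZ// g0 mulr0 addr0.
  have := @PHI_bound _ q s t s0 t0 _ (N / (8 * (s + t + 1))) cm.
  rewrite -E -/N => H'; have {H'} : N <= 4 * (N / (8 * (s + t + 1))) * (s + t).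
    by apply: H' => z [/qr/G[_ gz] _]; rewrite mulN1r nmC.
  have -> : 4 * (N / (8 * (s + t + 1))) * (s + t) = N * (s + t) / (2 * (s + t + 1)).
    by field; lra.
  rewrite ler_pdivlMr; last lra.
  nra.
have dF : ev c (cdiff F) by exists d => // z /D; exact: cderiv_diff.
have E : ev c (fun z => cD F z = h z) by exists d => // z /D/cderiv_cD.
apply: evW (evI (ev_cdiff_cD dF) (ev_ev E)) => z [[l Fl] Ez].
exact: cderiv_diff (cderiv_ext Ez Fl).
Qed.

End Holomorphic.

(** * Derivatives in a parameter and local inverses *)

Section ParameterAndInverse.
Variable R : realType.
Implicit Types (e r M B : R) (p w z a b c l x y : R[i]) (f g : R[i] -> R[i]).

(** By [kernel1_taylor] the difference quotients in t approach the derivative at a rate uniform in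
    z, and each of them is holomorphic in z, so [uniform_limit] applies. *)
Lemma param_derivative (F : R[i] -> R[i] -> R[i]) c r M : 0 < r -> 0 <= M ->
  (forall t z : R[i], nm t < r -> nm (z - c) < r ->
     [/\ nm (F t z) <= M, cdiff (F^~ z) t & cdiff (F t) z]) ->
  ev c (cdiff (fun z => cD (F^~ z) 0)).
Proof.
move=> r0 M0 H.
pose s := r / 4; have s0 : 0 < s by rewrite divr_gt0.
have u0 : 0 < 2 * s by lra.
pose p := ll 0 s.
have inr t : inrect p (2 * s) (2 * s) t -> nm t < r.
  by move=> /sq_near; rewrite subr0 /s; lra.
have zi : interior_rect p (2 * s) (2 * s) 0 by apply: sq_interior; rewrite subrr nm0.
have [d d0 D] := bdry_dist zi.
pose kap b := PHI (fun z => 1 * (z - b) ^- 1) p (2 * s) (2 * s).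
have kap0 : kap 0 != 0 by exact: kernel1_neq0.
(* A common denominator for the Cauchy formulas at t and at 0, by [kernel2_one]. *)
have kapE t : nm t < s -> kap t = kap 0.
  move=> ts; apply: (@cderiv0_const _ kap 0 s); rewrite ?subrr ?subr0 ?nm0// => w ws.
  have wi : interior_rect p (2 * s) (2 * s) w by exact: sq_interior.
  rewrite -(kernel2_one u0 u0 wi); apply: (kernel1_deriv u0 u0 ler01 _ _ wi).
    by move=> z _; exact: ccont_cst.
  by move=> z _; rewrite nm1.
pose C := 4 * (M * (2 / d) ^+ 3) * (2 * s + 2 * s).
have C0 : 0 <= C by rewrite !mulr_ge0 ?exprn_ge0 ?addr_ge0 ?invr_ge0 ?mulr_ge0// ltW.
have nk : 0 < nm (kap 0) by rewrite nm_gt0.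
have est t z : nm t < s -> nm t < d / 2 -> nm (z - c) < r ->
  nm (F t z - F 0 z - t * cD (F^~ z) 0) <= nm t ^+ 2 * (C / nm (kap 0)).
  move=> ts td zr; pose f := F^~ z.
  have df : rdiff f p (2 * s) (2 * s) by move=> w /inr wr; have [] := H w z wr zr.
  have fM w : inrect p (2 * s) (2 * s) w -> nm (f w) <= M by move=> /inr wr; have [] := H w z wr zr.
  have cf w : bdry p (2 * s) (2 * s) w -> ccont f w by move=> [/df[l /cderiv_cont]].
  have fM' w : bdry p (2 * s) (2 * s) w -> nm (f w) <= M by move=> [/fM].
  have ti : interior_rect p (2 * s) (2 * s) t by apply: sq_interior; rewrite subr0.
  have fE w : interior_rect p (2 * s) (2 * s) w -> nm w < s ->
      f w = PHI (fun z => f z * (z - w) ^- 1) p (2 * s) (2 * s) / kap 0.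
    by move=> wi ws; rewrite (cauchy u0 u0 df wi) -/(kap w) kapE// mulfK.
  have f'E := cderiv_cD (cD_kernel u0 u0 df M0 fM zi).
  rewrite -/(f t) -/(f 0) -/f f'E (fE t)// (fE 0 zi) ?nm0// -/(kap 0).
  set A := PHI _ _ _ _; set A0 := PHI _ _ _ _; set A1 := PHI _ _ _ _.
  have -> : A / kap 0 - A0 / kap 0 - t * (A1 * (kap 0)^-1) = (A - A0 - t * A1) / kap 0 by ring.
  rewrite nmM nmV mulrA ler_wpM2r ?invr_ge0 ?(ltW nk)//.
  have t0 : nm (t - 0) < d / 2 by rewrite subr0.
  by have := kernel1_taylor u0 u0 M0 cf fM' zi d0 D ti t0; rewrite subr0.
apply: (uniform_limit r0) => e e0.
have C1 : 0 < C / nm (kap 0) + 1 by have := divr_ge0 C0 (ltW nk); lra.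
pose m := Num.min (Num.min s (d / 2)) (e / (C / nm (kap 0) + 1)).
have m0 : 0 < m by rewrite /m !lt_min !divr_gt0// s0.
pose x : R := m / 2; have x0 : 0 < x by rewrite divr_gt0.
have xm : x < m by rewrite /x; lra.
have [xs xd xe] : [/\ x < s, x < d / 2 & x * (C / nm (kap 0) + 1) < e].
  by move: xm; rewrite /m !lt_min [_ < e / _]ltr_pdivlMr// => /andP[/andP[? ?] ?]; split.
pose t : R[i] := x%:C%C.
have nt : nm t = x by rewrite nm_real gtr0_norm.
have t0 : t != 0 by rewrite -nm_gt0 nt.
have tr : nm t < r by rewrite nt; move: xs; rewrite /s; lra.
exists (fun z => t^-1 * (F t z - F 0 z)) => z zr; split.
  have [_ _ [l1 D1]] := H t z tr zr.
  have [_ _ [l2 D2]] : [/\ nm (F 0 z) <= M, cdiff (F^~ z) 0 & cdiff (F 0) z] by apply: H; rewrite ?nm0.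
  exact: cderiv_diff (cderivZ t^-1 (cderivB D1 D2)).
have -> : t^-1 * (F t z - F 0 z) - cD (F^~ z) 0 = t^-1 * (F t z - F 0 z - t * cD (F^~ z) 0).
  by rewrite [RHS]mulrBr mulKf.
rewrite nmM nmV ler_pdivrMl nt//.
apply: le_trans (est t z _ _ zr) _; rewrite ?nt//.
rewrite expr2 -mulrA ler_wpM2l ?(ltW x0)//.
by have := ltW x0; lra.
Qed.

(** Newton's iteration with slope fixed at l = f'(c) contracts on a disc where f' stays within |l| /
    8 of l; the factor 2 of [cmvt] turns this into the Lipschitz constant |l| / 4. *)
Lemma inverse_function f c r0 : 0 < r0 -> (forall z, nm (z - c) < r0 -> cdiff f z) ->
  cD f c != 0 -> exists r rho (sg : R[i] -> R[i]),
  [/\ 0 < r <= r0, 0 < rho,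
      forall w, nm (w - f c) < rho -> [/\ nm (sg w - c) < r, f (sg w) = w & cderiv sg w (cD f (sg w))^-1],
      forall z z', nm (z - c) < r -> nm (z' - c) < r -> f z = f z' -> z = z' &
      forall z, nm (z - c) < r -> cD f z != 0].
Proof.
move=> r00 df l0; set l := cD f c in l0.
have L : 0 < nm l by rewrite nm_gt0.
have [l2 /cderiv_cont dl] : cdiff (cD f) c by apply: cdiff_cD; exists r0.
have L8 : 0 < nm l / 8 by rewrite divr_gt0.
have [r1 r10 Hr1] := dl _ L8.
pose r := Num.min r0 r1.
have [rr0 rr1] : r <= r0 /\ r <= r1 by rewrite /r !ge_min !lexx orbT.
have rpos : 0 < r by rewrite lt_min r00.
have cl z : nm (z - c) < r -> nm (cD f z - l) <= nm l / 8.
  by move=> zr; apply/ltW/Hr1; exact: lt_le_trans zr rr1.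
have dfr z : nm (z - c) < r -> cderiv f z (cD f z).
  by move=> zr; apply: cdiffP; apply: df; exact: lt_le_trans zr rr0.
have lip z w : nm (z - c) < r -> nm (w - c) < r ->
    nm (f w - f z - l * (w - z)) <= nm l / 4 * nm (w - z).
  move=> zr wr.
  have D y : nm (y - c) < r -> cderiv (fun y => f y - l * y) y (cD f y - l).
    by move=> /dfr fy; have := cderivB fy (cderivZ l (cderiv_id y)); rewrite mulr1.
  have := @cmvt R (fun y => f y - l * y) (fun y => cD f y - l) z w (nm l / 8) _ _.
  have -> : f w - l * w - (f z - l * z) = f w - f z - l * (w - z) by ring.
  have -> : 2 * (nm l / 8) = nm l / 4 by field.
  apply=> x x01; [apply: D|apply: cl]; exact: nm_segment.
have lipl z w : nm (z - c) < r -> nm (w - c) < r -> nm l * nm (w - z) <= 4 / 3 * nm (f w - f z).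
  move=> zr wr; have := lip z w zr wr; rewrite -nmM.
  have := nmB (f w - f z) (f w - f z - l * (w - z)); rewrite opprB addrCA subrr addr0 nmM.
  lra.
have lipu z w : nm (z - c) < r -> nm (w - c) < r -> nm (f w - f z) <= 2 * nm l * nm (w - z).
  move=> zr wr; have := lip z w zr wr.
  have := nmD (f w - f z - l * (w - z)) (l * (w - z)); rewrite subrK nmM.
  have := mulr_ge0 (ltW L) (nm_ge0 (w - z)); lra.
have inj z z' : nm (z - c) < r -> nm (z' - c) < r -> f z = f z' -> z = z'.
  move=> zr zr' E; have := lipl z z' zr zr'; rewrite E subrr nm0 mulr0 => H.
  apply/esym/eqP; rewrite -subr_eq0 -nm_eq0 eq_le nm_ge0 andbT.
  by rewrite -(pmulr_rle0 _ L).
(* The first step of the iteration then has length at most r / 8 and the steps are at least halved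
   each time, so all iterates stay within r / 4 of [c]. *)
pose rho := nm l * (r / 8).
have rho0 : 0 < rho by rewrite mulr_gt0// divr_gt0.
have surj w : nm (w - f c) < rho -> exists z, nm (z - c) < r /\ f z = w.
  move=> wr.
  pose T x := x + (w - f x) / l.
  pose a k := iter k T c.
  have TE x : T x - x = (w - f x) / l by rewrite /T addrAC subrr add0r.
  have TT x y : nm (x - c) < r -> nm (y - c) < r -> nm (T x - T y) <= nm (x - y) / 2.
    move=> xr yr.
    have -> : T x - T y = - (f x - f y - l * (x - y)) / l by rewrite /T; field.
    rewrite nmM nmN nmV ler_pdivrMr//; apply: le_trans (lip _ _ yr xr) _.
    by have := mulr_ge0 (ltW L) (nm_ge0 (x - y)); lra.
  have pos2 k : (0 : R) < 2 ^+ k by rewrite exprn_gt0.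
  have A k : nm (a k - c) <= r / 4 * (1 - (2 ^+ k)^-1) /\ nm (a k.+1 - a k) <= r / 8 / 2 ^+ k.
    elim: k => [|k [IH1 IH2]].
      split; first by rewrite /a /= subrr nm0 expr0 invr1 subrr mulr0.
      rewrite /a /= TE nmM nmV expr0 divr1 ler_pdivrMr//.
      by rewrite mulrC; exact: ltW.
    have i0 : 0 < (2 ^+ k : R)^-1 by rewrite invr_gt0.
    have iS : (2 ^+ k.+1 : R)^-1 = (2 ^+ k)^-1 / 2 by rewrite exprS invfM mulrC.
    have B : nm (a k.+1 - c) <= r / 4 * (1 - (2 ^+ k.+1)^-1).
      have := nm_tri (a k.+1) (a k) c; rewrite iS; lra.
    split=> //; apply: le_trans (TT (a k.+1) (a k) _ _) _.
    - by apply: le_lt_trans B _; rewrite iS; nra.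
    - by apply: le_lt_trans IH1 _; nra.
    - by rewrite iS; lra.
  have [z Hz] := geom_limit (fun k => (A k).2).
  have zr : nm (z - c) < r by have := Hz 0%N; rewrite expr0 divr1 /a /=; lra.
  exists z; split=> //; apply/eqP; rewrite -subr_eq0 -nm_eq0 eq_le nm_ge0 andbT.
  apply: (@geom_le0 _ _ (2 * nm l * r)) => k.
  have ar : nm (a k - c) < r.
    by have [+ _] := A k; have : 0 < (2 ^+ k : R)^-1 by [rewrite invr_gt0]; nra.
  have S1 : nm (f z - f (a k)) <= 2 * nm l * (r / 2 / 2 ^+ k).
    apply: le_trans (lipu _ _ ar zr) _; rewrite ler_wpM2l ?mulr_ge0 ?(ltW L)//.
    by apply: le_trans (Hz k) _; lra.
  have S2 : nm (w - f (a k)) <= nm l * (r / 8 / 2 ^+ k).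
    have [_] := A k; have -> : a k.+1 - a k = (w - f (a k)) / l by exact: TE.
    by rewrite nmM nmV ler_pdivrMr// mulrC.
  have := nm_tri (f z) (f (a k)) w; rewrite [nm (f (a k) - w)]nmC.
  have := mulr_ge0 (ltW L) (divr_ge0 (ltW rpos) (ltW (pos2 k))); lra.
pose sg w := xget c [set z | nm (z - c) < r /\ f z = w].
have sgP w : nm (w - f c) < rho -> nm (sg w - c) < r /\ f (sg w) = w.
  by move=> /surj[z [zr fz]]; rewrite /sg; case: xgetP => [y -> //|/(_ z)[]].
have cD0 z : nm (z - c) < r -> cD f z != 0.
  move=> /cl zl; apply/eqP => E; move: zl; rewrite E sub0r nmN; lra.
exists r, rho, sg; split=> //; first by rewrite rpos rr0.
move=> w wr; have [s1 s2] := sgP w wr; split=> //.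
set x0 := sg w in s1 s2 *; set m := cD f x0.
have m0 : m != 0 by exact: cD0.
have M0 : 0 < nm m by rewrite nm_gt0.
move=> e e0.
pose e' := e * nm m * nm l * (3 / 4).
have e'0 : 0 < e' by rewrite !mulr_gt0// divr_gt0.
have [d d0 D] := dfr x0 s1 _ e'0.
have dl0 : 0 < d * nm l * (3 / 4) by rewrite !mulr_gt0// divr_gt0.
apply: evW (evI (ev_ball_open wr) (ev_ball w dl0)) => w' [wr' ww'].
have [t1 t2] := sgP w' wr'; set x := sg w' in t1 t2 *.
have Lx : nm l * nm (x - x0) <= 4 / 3 * nm (w' - w) by rewrite -[w']t2 -[w]s2; exact: lipl.
have xd : nm (x - x0) < d by rewrite -(ltr_pM2l L); lra.
have := D x xd; rewrite -/m t2 s2 => H.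
have -> : x - x0 - m^-1 * (w' - w) = - (m^-1 * (w' - w - m * (x - x0))).
  by rewrite [m^-1 * (w' - w - _)]mulrBr mulKf // opprB.
rewrite nmN nmM nmV ler_pdivrMl//; apply: le_trans H _; rewrite /e'.
have -> : e * nm m * nm l * (3 / 4) * nm (x - x0) = (e * nm m * (3 / 4)) * (nm l * nm (x - x0)) by ring.
apply: le_trans (ler_wpM2l _ Lx) _; first by rewrite !mulr_ge0// ltW.
by rewrite le_eqVlt; apply/orP; left; apply/eqP; field.
Qed.

End ParameterAndInverse.

(** * Coordinates in which a pseudogroup acts by Moebius maps *)

Section LocalCalculus.
Variable R : realType.
Implicit Types (e r : R) (p w z a b c l x y k : R[i]) (f g h F : R[i] -> R[i]).

Lemma ev_const F z : ev z (fun y => cderiv F y 0) -> ev z (fun y => F y = F z).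
Proof.
move=> [d d0 D]; exists d => // y yz.
by apply: (@cderiv0_const R F z d) => //; rewrite subrr nm0.
Qed.

Lemma ev_cD f g z : ev z (fun y => f y = g y) -> ev z (cdiff f) -> ev z (fun y => cD f y = cD g y).
Proof.
move=> E D; apply: evW (evI (ev_ev E) D) => y [Ey /cdiffP fy].
by apply/esym/cderiv_cD; exact: cderiv_ext Ey fy.
Qed.

Lemma cdiff_ext f g z : ev z (fun y => f y = g y) -> cdiff f z -> cdiff g z.
Proof. by move=> E [l fl]; exists l; exact: cderiv_ext E fl. Qed.

Lemma ev_cdiff_ext f g z : ev z (fun y => f y = g y) -> ev z (cdiff f) -> ev z (cdiff g).
Proof. by move=> /ev_ev E D; apply: evW (evI E D) => y [Ey Dy]; exact: cdiff_ext Ey Dy. Qed.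

Lemma cdiff_cont f z : cdiff f z -> ccont f z. Proof. by move=> [l]; exact: cderiv_cont. Qed.
Lemma cdiff_cst k z : cdiff (fun=> k) z. Proof. by exists 0; exact: cderiv_cst. Qed.
Lemma cdiffD f g z : cdiff f z -> cdiff g z -> cdiff (fun y => f y + g y) z.
Proof. by move=> [l F] [m G]; exists (l + m); exact: cderivD. Qed.
Lemma cdiffB f g z : cdiff f z -> cdiff g z -> cdiff (fun y => f y - g y) z.
Proof. by move=> [l F] [m G]; exists (l - m); exact: cderivB. Qed.
Lemma cdiffM f g z : cdiff f z -> cdiff g z -> cdiff (fun y => f y * g y) z.
Proof. by move=> [l F] [m G]; exists (l * g z + f z * m); exact: cderivM. Qed.
Lemma cdiffV f z : f z != 0 -> cdiff f z -> cdiff (fun y => (f y)^-1) z.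
Proof. by move=> fz [l F]; exists (- l / f z ^+ 2); exact: cderivV. Qed.
Lemma cdiff_comp f g z : cdiff f (g z) -> cdiff g z -> cdiff (f \o g) z.
Proof. by move=> [l F] [m G]; exists (l * m); exact: cderiv_comp. Qed.

(** The exponential as the inverse of a primitive of 1 / z, with its argument translated to a
    neighbourhood of [l]. *)
Lemma local_exp l : exists E : R[i] -> R[i], ev l (fun z => cderiv E z (E z) /\ E z != 0).
Proof.
have one0 : (1 : R[i]) != 0 by exact: oner_neq0.
have dinv : ev 1 (cdiff (fun z : R[i] => z^-1)).
  apply: evW (ccont_neq0 (ccont_id _) one0) => z z0.
  by exists (- z ^- 2); exact: cderiv_inv.
have [lg Hlg] := primitive dinv.
have [d d0 D] := evI Hlg (ccont_neq0 (ccont_id _) one0).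
have lgE z : nm (z - 1) < d -> cD lg z = z^-1 by move=> /D[/cderiv_cD].
have [||r [rho [sg [_ rho0 S _ _]]]] := @inverse_function R lg 1 d d0.
- by move=> z /D[/cderiv_diff].
- by rewrite lgE ?subrr ?nm0// invr1.
have [||r' [rho' [sg' [/andP[_ r'd] rho'0 S' _ _]]]] := @inverse_function R lg 1 d d0.
- by move=> z /D[/cderiv_diff].
- by rewrite lgE ?subrr ?nm0// invr1.
exists (fun z => sg' (z - (l - lg 1))); exists rho' => // z zl.
have [|s1 s2 s3] := S' (z - (l - lg 1)).
  by rewrite (_ : z - (l - lg 1) - lg 1 = z - l)//; ring.
have s4 : nm (sg' (z - (l - lg 1)) - 1) < d by apply: lt_le_trans s1 _.
split; last by have [_] := D _ s4.
have := cderiv_comp (g := fun z => z - (l - lg 1)) s3 (cderiv_sub _ z).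
by rewrite lgE// invrK mulr1.
Qed.

Definition subball c r c' r' := 0 < r' /\ forall y, nm (y - c') < r' -> nm (y - c) < r.

Lemma subball_refl c r : 0 < r -> subball c r c r. Proof. by []. Qed.
Lemma subball_trans c r c' r' c'' r'' :
  subball c r c' r' -> subball c' r' c'' r'' -> subball c r c'' r''.
Proof. by move=> [? H] [? H']; split=> // y /H'/H. Qed.

Lemma ev_subball c r z (P : R[i] -> Prop) : nm (z - c) < r -> ev z P ->
  exists r', subball c r z r' /\ forall y, nm (y - z) < r' -> P y.
Proof.
move=> /ev_ball_open zr Pz; have [d d0 D] := evI zr Pz.
by exists d; split; [split=> // y /D[]|move=> y /D[]].
Qed.

Lemma subball_center c r c' r' : subball c r c' r' -> nm (c' - c) < r.
Proof. by move=> [r0 H]; apply: H; rewrite subrr nm0. Qed.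

(* [G g z] says that the germ of [g] at [z] belongs to the pseudogroup. *)
Section Pseudogroup.
Variables (G : (R[i] -> R[i]) -> R[i] -> Prop).
Hypothesis G_diff : forall g z, G g z -> ev z (cdiff g).
Hypothesis G_neq0 : forall g z, G g z -> cD g z != 0.

(** The coordinate may live on a smaller disc. Its values are finite, so the Moebius relation is
    written with a non-zero denominator and cross-multiplied; the matrix belongs to the germ of [g]
    at z. *)
Definition moebius_coord c0 r0 := exists c r (w : R[i] -> R[i]),
  [/\ subball c0 r0 c r, forall y, nm (y - c) < r -> cdiff w y /\ cD w y != 0 &
      forall g z, G g z -> nm (z - c) < r -> nm (g z - c) < r ->
        exists2 A : 'M[R[i]]_2, \det A = 1 &
          ev z (fun y => A 1 0 * w y + A 1 1 != 0 /\
                         w (g y) * (A 1 0 * w y + A 1 1) = A 0 0 * w y + A 0 1)].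

Lemma moebius_coord_sub c r c' r' : subball c r c' r' -> moebius_coord c' r' -> moebius_coord c r.
Proof.
by move=> S [d [s [w' [S' ? ?]]]]; exists d, s, w'; split=> //; exact: subball_trans S S'.
Qed.

Lemma det22 (A : 'M[R[i]]_2) : \det A = A 0 0 * A 1 1 - A 0 1 * A 1 0.
Proof.
rewrite (expand_det_row _ 0) !big_ord_recl big_ord0 addr0 /cofactor !det_mx11 !mxE /=.
rewrite expr0 expr1 mul1r mulN1r mulrN.
have e1 : lift 0 (0 : 'I_1) = 1 :> 'I_2 by apply/val_inj.
by rewrite !e1; congr (A 0 _ * A 1 1 - A 0 1 * A 1 _); exact/val_inj.
Qed.

Lemma moebius_normalize a b c d : a * d - b * c != 0 ->
  exists2 A : 'M[R[i]]_2, \det A = 1 & forall x y, c * x + d != 0 -> y * (c * x + d) = a * x + b ->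
    A 1 0 * x + A 1 1 != 0 /\ y * (A 1 0 * x + A 1 1) = A 0 0 * x + A 0 1.
Proof.
move=> D0; pose s := sqrtc (a * d - b * c).
have sE : s * s = a * d - b * c by rewrite -expr2 sqr_sqrtc.
have s0 : s != 0 by apply: contraNneq D0 => s0; rewrite -sE s0 mul0r.
pose A : 'M[R[i]]_2 := \matrix_(i, j) ((if i == 0 then if j == 0 then a else b
   else if j == 0 then c else d) / s).
have [A00 A01 A10 A11] : [/\ A 0 0 = a / s, A 0 1 = b / s, A 1 0 = c / s & A 1 1 = d / s].
  by rewrite !mxE.
exists A; first by rewrite det22 A00 A01 A10 A11 mulrACA [b / s * _]mulrACA -mulrBl -sE -invfM divff ?mulf_neq0.
move=> x y cx0 E; rewrite A00 A01 A10 A11.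
have -> : c / s * x + d / s = (c * x + d) / s by ring.
have -> : a / s * x + b / s = (a * x + b) / s by ring.
by rewrite mulf_neq0 ?invr_eq0// mulrA E.
Qed.

Lemma G_ev g z : G g z -> ev z (fun y => cdiff g y /\ cdiff (cD g) y /\ cD g y != 0).
Proof.
move=> Ggz; have dg := G_diff Ggz; have dg' := ev_cdiff_cD dg.
have n0 := ccont_neq0 (cdiff_cont (ev_self dg')) (G_neq0 Ggz).
by apply: evI dg (evI dg' n0).
Qed.

Lemma G_ball g z c r : G g z -> nm (z - c) < r -> nm (g z - c) < r ->
  ev z (fun y => nm (y - c) < r /\ nm (g y - c) < r).
Proof.
move=> /G_diff/ev_self/cdiff_cont cg zr gr; apply: evI (ev_ball_open zr) _.
exact: ccont_ev cg (ev_ball_open gr).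
Qed.

(** The hypothesis on [lam] is the transformation law of an affine connection, and [w] is its affine
    parameter: w' is the exponential of a primitive of [lam]. *)
Lemma affine_coord (lam : R[i] -> R[i]) c r : 0 < r -> (forall y, nm (y - c) < r -> cdiff lam y) ->
  (forall g z, G g z -> nm (z - c) < r -> nm (g z - c) < r ->
    ev z (fun y => lam y = lam (g y) * cD g y + cD (cD g) y / cD g y)) ->
  moebius_coord c r.
Proof.
move=> r0 dl Hl.
have [L HL] : exists F, ev c (fun z => cderiv F z (lam z)) by apply: primitive; exists r.
have [E HE] := local_exp (L c).
have cL : ccont L c by exact: cderiv_cont (ev_self HL).
pose h := E \o L.
have Hh : ev c (fun z => cderiv h z (lam z * h z) /\ h z != 0).
  apply: evW (evI HL (ccont_ev cL HE)) => z [Lz [Ez hz]]; split=> //.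
  by rewrite mulrC; exact: cderiv_comp Ez Lz.
have [w Hw] : exists w : R[i] -> R[i], ev c (fun z => cderiv w z (h z)).
  by apply: primitive; apply: evW Hh => z [/cderiv_diff].
have [r' [S H]] := ev_subball (subball_center (subball_refl c r0)) (evI Hh Hw).
exists c, r', w; split=> //.
  by move=> y /H[[_ hy] wy]; rewrite (cderiv_cD wy); split=> //; exact: cderiv_diff wy.
move=> g z Ggz zr gr.
have B := G_ball Ggz zr gr.
have Hlz := Hl g z Ggz (S.2 _ zr) (S.2 _ gr).
pose q y := h (g y) * cD g y / h y.
have dq : ev z (fun y => cderiv q y 0).
  apply: evW (evI B (evI Hlz (G_ev Ggz))) => y [[y1 y2] [ly [dg [dg' g0]]]].
  have [[hy hy0] _] := H y y1; have [[hg hg0] _] := H (g y) y2.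
  have := cderivM (cderivM (cderiv_comp hg (cdiffP dg)) (cdiffP dg')) (cderivV hy0 hy).
  rewrite (_ : _ + _ = 0)// ly /=; field; rewrite hy0 g0; exact: isT.
pose a := q z.
have qa : ev z (fun y => q y = a) := ev_const dq.
have a0 : a != 0.
  have [[[_ hz] _] [[_ hg] _]] := (H z zr, H (g z) gr).
  by rewrite /a /q !mulf_neq0 ?invr_eq0 ?G_neq0.
pose F y := w (g y) - a * w y.
have dF : ev z (fun y => cderiv F y 0).
  apply: evW (evI B (evI qa (G_ev Ggz))) => y [[y1 y2] [qy [dg _]]].
  have [[hy hy0] wy] := H y y1; have [_ wg] := H (g y) y2.
  have := cderivB (cderiv_comp wg (cdiffP dg)) (cderivZ a wy).
  have Ea : a * h y = h (g y) * cD g y by rewrite -qy /q (divfK hy0).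
  by rewrite Ea subrr.
have [|A A1 HA] := @moebius_normalize a (F z) 0 1 _; first by rewrite mulr0 mulr1 subr0.
exists A => //; apply: evW (ev_const dF) => y Fy; apply: HA.
  by rewrite mul0r add0r oner_neq0.
by rewrite mul0r add0r mulr1 -Fy /F addrC subrK.
Qed.

(** The logarithmic derivative of the invariance of [om], divided by n + 1, is the law required by
    [affine_coord]. It serves 1-forms (n = 0) and cubic differentials (n = 2). *)
Lemma form_coord n (om : R[i] -> R[i]) c r c1 : 0 < r -> (forall y, nm (y - c) < r -> cdiff om y) ->
  nm (c1 - c) < r -> om c1 != 0 ->
  (forall g z, G g z -> nm (z - c) < r -> nm (g z - c) < r ->
    ev z (fun y => om y = om (g y) * cD g y ^+ n.+1)) ->
  moebius_coord c r.
Proof.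
move=> r0 dom c1r om0 Hom.
have evom : ev c1 (fun y => om y != 0) by exact: ccont_neq0 (cdiff_cont (dom _ c1r)) om0.
have [r1 [S H]] := ev_subball c1r evom.
apply: (moebius_coord_sub S).
pose N : R[i] := n.+1%:R; have N0 : N != 0 by rewrite pnatr_eq0.
apply: (@affine_coord (fun y => cD om y / (N * om y))); first by case: S.
  move=> y yr; apply: cdiffM.
    by apply: cdiff_cD; have := ev_ball_open (S.2 _ yr); apply: evW => u; exact: dom.
  apply: cdiffV; first by rewrite mulf_neq0// H.
  by apply: cdiffM (dom _ (S.2 _ yr)); exact: cdiff_cst.
move=> g z Ggz zr gr.
have B := G_ball Ggz zr gr.
apply: evW (evI B (evI (ev_ev (Hom g z Ggz (S.2 _ zr) (S.2 _ gr))) (G_ev Ggz))).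
move=> y [[y1 y2] [Ey [dg [dg' g0]]]].
have D1 := cdiffP (dom _ (S.2 _ y2)).
have := cderiv_ext (_ : ev y (fun u => om (g u) * cD g u ^+ n.+1 = om u)) 
   (cderivM (cderiv_comp D1 (cdiffP dg)) (cderivX n.+1 (cdiffP dg'))).
have Ey' : ev y (fun u => om (g u) * cD g u ^+ n.+1 = om u) by apply: evW Ey.
move=> /(_ Ey')/cderiv_cD ->; rewrite (ev_self Ey) /= -/N exprS.
have o1 : om (g y) != 0 by apply: H.
have gn : cD g y ^+ n != 0 by rewrite expf_neq0.
field; rewrite g0 o1 gn andbT nat1r; exact: N0.
Qed.

End Pseudogroup.
End LocalCalculus.

(** * Wronskians of invariant families *)

Section Wronskian.
Variable R : realType.
Implicit Types (e r : R) (p z a b c x y : R[i]) (k l : nat) (f g h F : R[i] -> R[i]).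

Lemma ev_forall (T : finType) z (P : T -> R[i] -> Prop) :
  (forall i, ev z (P i)) -> ev z (fun y => forall i, P i y).
Proof.
move=> H.
have K (s : seq T) : ev z (fun y => forall i, i \in s -> P i y).
  elim: s => [|i s IH]; first by apply: ev_all.
  apply: evW (evI (H i) IH) => y [Pi Ps] j; rewrite inE => /orP[/eqP -> //|]; exact: Ps.
by apply: evW (K (enum T)) => y Py i; apply: Py; rewrite mem_enum.
Qed.

Lemma cderiv_sum (I : Type) (s : seq I) (P : pred I) (F : I -> R[i] -> R[i]) L z :
  (forall i, cderiv (F i) z (L i)) ->
  cderiv (fun y => \sum_(i <- s | P i) F i y) z (\sum_(i <- s | P i) L i).
Proof.
move=> H; elim: s => [|i s IH].
  rewrite big_nil; apply: cderiv_ext (cderiv_cst 0 z).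
  by apply: ev_all => y; rewrite big_nil.
rewrite big_cons; case: ifPn => Pi.
  by apply: cderiv_ext (cderivD (H i) IH); apply: ev_all => y; rewrite big_cons Pi.
by apply: cderiv_ext IH; apply: ev_all => y; rewrite big_cons (negPf Pi).
Qed.

Lemma cdiff_sum (I : Type) (s : seq I) (P : pred I) (F : I -> R[i] -> R[i]) z :
  (forall i, cdiff (F i) z) -> cdiff (fun y => \sum_(i <- s | P i) F i y) z.
Proof.
by move=> H; exists (\sum_(i <- s | P i) cD (F i) z); apply: cderiv_sum => i; exact: cdiffP.
Qed.

Lemma cdiff_prod (I : Type) (s : seq I) (P : pred I) (F : I -> R[i] -> R[i]) z :
  (forall i, cdiff (F i) z) -> cdiff (fun y => \prod_(i <- s | P i) F i y) z.
Proof.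
move=> H; elim: s => [|i s IH].
  by apply: cdiff_ext (cdiff_cst 1 z); apply: ev_all => y; rewrite big_nil.
have [Pi|Pi] := boolP (P i).
  by apply: cdiff_ext (cdiffM (H i) IH); apply: ev_all => y; rewrite big_cons Pi.
by apply: cdiff_ext IH; apply: ev_all => y; rewrite big_cons (negPf Pi).
Qed.

Lemma cderiv_prod_log (I : Type) (s : seq I) (F : I -> R[i] -> R[i]) (m : I -> R[i]) sig z :
  (forall i, cderiv (F i) z (m i * sig * F i z)) ->
  cderiv (fun y => \prod_(i <- s) F i y) z ((\sum_(i <- s) m i) * sig * \prod_(i <- s) F i z).
Proof.
move=> H; elim: s => [|i s IH].
  rewrite !big_nil !mul0r; apply: cderiv_ext (cderiv_cst 1 z).
  by apply: ev_all => y; rewrite big_nil.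
have := cderivM (H i) IH; rewrite !big_cons.
rewrite (_ : _ + _ = (m i + \sum_(j <- s) m j) * sig * (F i z * \prod_(j <- s) F j z)); last by ring.
by apply: cderiv_ext; apply: ev_all => y; rewrite big_cons.
Qed.

Definition cDn n f := iter n (@cD R) f.

Lemma ev_cdiff_cDn f z n : ev z (cdiff f) -> ev z (cdiff (cDn n f)).
Proof. by move=> df; elim: n => // n IH; exact: ev_cdiff_cD. Qed.

Lemma ev_cDn f g z n : ev z (cdiff f) -> ev z (fun y => f y = g y) ->
  ev z (fun y => cDn n f y = cDn n g y).
Proof.
move=> df E; elim: n => // n IH; apply: ev_cD IH _; exact: ev_cdiff_cDn.
Qed.

Lemma cDn_sum (T : finType) (F : T -> R[i] -> R[i]) (A : T -> R[i]) z n :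
  (forall i, ev z (cdiff (F i))) ->
  ev z (fun y => cDn n (fun u => \sum_i A i * F i u) y = \sum_i A i * cDn n (F i) y).
Proof.
move=> dF; elim: n => [|n IH]; first by apply: ev_all.
have D : ev z (fun y => forall i, cdiff (cDn n (F i)) y).
  by apply: ev_forall => i; exact: ev_cdiff_cDn.
apply: evW (evI (ev_ev IH) D) => y [Ey Dy]; apply: cderiv_cD.
apply: cderiv_ext (_ : cderiv (fun u => \sum_i A i * cDn n (F i) u) y _).
  by apply: evW Ey => u; exact: esym.
by apply: cderiv_sum => i; apply: cderivZ; exact: cdiffP.
Qed.

Definition wron d (v : 'I_d -> R[i] -> R[i]) z := \det (\matrix_(i < d, k < d) cDn k (v i) z).

Lemma cdiff_wron d (v : 'I_d -> R[i] -> R[i]) z : (forall i, ev z (cdiff (v i))) -> cdiff (wron v) z.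
Proof.
move=> dv; rewrite /wron /determinant.
apply: (@cdiff_ext _ (fun y => \sum_(s : {perm 'I_d}) (-1) ^+ s * \prod_i cDn (s i) (v i) y)).
  apply: ev_all => y; apply: eq_bigr => s _; congr (_ * _); apply: eq_bigr => i _.
  by rewrite mxE.
apply: cdiff_sum => s; apply: cdiffM; first exact: cdiff_cst.
by apply: cdiff_prod => i; exact: ev_self (ev_cdiff_cDn (s i) (dv i)).
Qed.

Lemma wron_lin d (A : 'M[R[i]]_d) (v w : 'I_d -> R[i] -> R[i]) z :
  (forall i, ev z (cdiff (v i))) ->
  ev z (fun y => forall i, w i y = \sum_j A i j * v j y) ->
  ev z (fun y => wron w y = \det A * wron v y).
Proof.
move=> dv E.
have H : ev z (fun y => forall ik : 'I_d * 'I_d, cDn ik.2 (w ik.1) y = \sum_j A ik.1 j * cDn ik.2 (v j) y).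
  apply: ev_forall => -[i k] /=.
  have ds : ev z (cdiff (fun u => \sum_j A i j * v j u)).
    apply: evW (ev_forall dv) => y dy; apply: cdiff_sum => j.
    by apply: cdiffM (dy j); exact: cdiff_cst.
  have Ei : ev z (fun y => \sum_j A i j * v j y = w i y) by apply: evW E => y ->.
  by apply: evW (evI (ev_cDn k ds Ei) (cDn_sum (A i) k dv)) => y [<- ->].
apply: evW H => y Ey; rewrite /wron -det_mulmx; congr (\det _); apply/matrixP => i k.
by rewrite !mxE (Ey (i, k)); apply: eq_bigr => j _; rewrite !mxE.
Qed.

(* (f * (v o g))^(k) = sum_l (pull_coef f g k l) * (v^(l) o g) *)
Fixpoint pull_coef f g k l : R[i] -> R[i] :=
  match k with
  | 0 => if l == 0 then f else fun=> 0
  | k'.+1 => fun y => cD (pull_coef f g k' l) y +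
      (if l is l'.+1 then pull_coef f g k' l' y * cD g y else 0)
  end.

Lemma pull_coef_gt f g k l : (k < l)%N -> pull_coef f g k l = fun=> 0.
Proof.
elim: k l => [|k IH] [|l] //= kl; apply/funext => y.
rewrite !IH//; last exact: ltnW.
by rewrite (cderiv_cD (cderiv_cst 0 y)) add0r mul0r.
Qed.

Lemma pull_coef_diag f g k : pull_coef f g k k = fun y => f y * cD g y ^+ k.
Proof.
elim: k => [|k IH] /=; apply/funext => y; first by rewrite expr0 mulr1.
by rewrite pull_coef_gt// IH (cderiv_cD (cderiv_cst 0 y)) add0r exprSr mulrA.
Qed.

Lemma pull_coef_diff f g k l z : ev z (cdiff f) -> ev z (cdiff g) -> ev z (cdiff (pull_coef f g k l)).
Proof.
move=> df dg; elim: k l => [|k IH] l /=.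
  by case: ifP => // _; apply: ev_all => y; exact: cdiff_cst.
case: l => [|l].
  apply: evW (ev_cdiff_cD (IH 0)) => y H; apply: cdiffD H _; exact: cdiff_cst.
apply: evW (evI (ev_cdiff_cD (IH l.+1)) (evI (IH l) (ev_cdiff_cD dg))) => y [H1 [H2 H3]].
by apply: cdiffD H1 _; exact: cdiffM.
Qed.

(** [N] is any bound above k, so that all columns of a Wronskian can share one summation range. *)
Lemma cDn_pull f g (v : R[i] -> R[i]) z k N : (k < N)%N -> ev z (cdiff f) -> ev z (cdiff g) ->
  ev z (fun y => ev (g y) (cdiff v)) ->
  ev z (fun y => cDn k (fun u => f u * v (g u)) y = \sum_(l < N) pull_coef f g k l y * cDn l v (g y)).
Proof.
move=> kN df dg dv; elim: k N kN => [|k IH] [//|N] kN.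
  apply: ev_all => y /=; rewrite big_ord_recl /= big1 ?addr0// => i _.
  by rewrite mul0r.
have D : ev z (fun y => forall l : 'I_N.+1, cdiff (pull_coef f g k l) y).
  by apply: ev_forall => l; exact: pull_coef_diff.
apply: evW (evI (ev_ev (IH N.+1 (ltnW kN))) (evI D (evI dg dv))) => y [Ey [Dy [dgy dvy]]].
apply: cderiv_cD; apply: cderiv_ext (_ : cderiv (fun u => \sum_(l < N.+1) pull_coef f g k l u * cDn l v (g u)) y _).
  by apply: evW Ey => u; exact: esym.
have -> : \sum_(l < N.+1) pull_coef f g k.+1 l y * cDn l v (g y) =
    \sum_(l < N.+1) (cD (pull_coef f g k l) y * cDn l v (g y) +
       pull_coef f g k l y * (cDn l.+1 v (g y) * cD g y)).
  rewrite big_split /= [X in _ = _ + X]big_ord_recr /= (pull_coef_gt f g (l := N))//.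
  rewrite mul0r addr0.
  rewrite (eq_bigr (fun l : 'I_N.+1 => cD (pull_coef f g k l) y * cDn l v (g y) +
     (if nat_of_ord l is l'.+1 then pull_coef f g k l' y * cD g y else 0) * cDn l v (g y))); last first.
    by move=> l _; rewrite mulrDl.
  rewrite big_split /=; congr (_ + _); rewrite big_ord_recl /= mul0r add0r.
  by apply: eq_bigr => l _; rewrite -mulrA [cD g y * _]mulrC.
apply: cderiv_sum => l; apply: cderivM; first exact: cdiffP.
apply: (@cderiv_comp _ (cDn l v) g); last exact: cdiffP.
exact: cdiffP (ev_self (ev_cdiff_cDn l dvy)).
Qed.

(** The derivatives of f * (v o g) arise from those of v at g by the triangular matrix [pull_coef],
    with diagonal entries f * g'^k. *)
Lemma wron_pull d (v w : 'I_d -> R[i] -> R[i]) f g z : ev z (cdiff f) -> ev z (cdiff g) ->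
  (forall i, ev z (fun y => ev (g y) (cdiff (v i)))) ->
  (forall i, ev z (fun y => f y * v i (g y) = w i y)) ->
  ev z (fun y => wron w y = wron v (g y) * \prod_(k < d) (f y * cD g y ^+ k)).
Proof.
move=> df dg dv E.
have H : ev z (fun y => forall ik : 'I_d * 'I_d,
    cDn ik.2 (w ik.1) y = \sum_(l < d) pull_coef f g ik.2 l y * cDn l (v ik.1) (g y)).
  apply: ev_forall => -[i k] /=.
  have D : ev z (cdiff (fun u => f u * v i (g u))).
    apply: evW (evI df (evI dg (dv i))) => y [fy [gy /ev_self vy]].
    by apply: cdiffM fy _; exact: (@cdiff_comp _ (v i) g).
  by apply: evW (evI (ev_cDn k D (E i)) (cDn_pull (ltn_ord k) df dg (dv i))) => y [<- ->].
apply: evW H => y Ey; rewrite /wron.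
pose T : 'M[R[i]]_d := \matrix_(k, l) pull_coef f g k l y.
have -> : \prod_(k < d) (f y * cD g y ^+ k) = \det T^T.
  rewrite det_tr det_trig; last by apply/is_trig_mxP => i j ij; rewrite mxE pull_coef_gt.
  by apply: eq_bigr => i _; rewrite mxE pull_coef_diag.
rewrite -det_mulmx; congr (\det _); apply/matrixP => i k.
by rewrite !mxE (Ey (i, k)); apply: eq_bigr => l _; rewrite !mxE mulrC.
Qed.

(** Required on every smaller disc so that it survives shrinking; for holomorphic functions this
    amounts to independence on the disc itself. *)
Definition indep d (w : 'I_d -> R[i] -> R[i]) c r := forall c' r', subball c r c' r' ->
  forall e : 'I_d -> R[i], (forall y, nm (y - c') < r' -> \sum_j e j * w j y = 0) -> forall j, e j = 0.

(** Induction by reduction of order: after division by [w ord0] the family is 1, u_1, ..., u_d,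
    whose Wronskian is that of the derivatives of the u_i. *)
Lemma wron_neq0 d (w : 'I_d -> R[i] -> R[i]) c r : 0 < r ->
  (forall i y, nm (y - c) < r -> cdiff (w i) y) -> indep w c r ->
  exists2 c', nm (c' - c) < r & wron w c' != 0.
Proof.
elim: d w c r => [|d IH] w c r r0 dw iw.
  by exists c; rewrite ?subrr ?nm0// /wron det_mx00 oner_neq0.
have [c1 c1r w1] : exists2 c1, nm (c1 - c) < r & w ord0 c1 != 0.
  apply: contrapT => H.
  have H1 y : nm (y - c) < r -> \sum_(j < d.+1) (j == ord0)%:R * w j y = 0.
    move=> yr; rewrite big_ord_recl /= big1 ?addr0; last by move=> i _; rewrite mul0r.
    rewrite mul1r; apply/eqP; apply: contrapT => /negP wy; apply: H; by exists y.
  by have /eqP := iw c r (subball_refl c r0) _ H1 ord0; rewrite eqxx oner_eq0.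
have [r1 [S n0]] := ev_subball c1r (ccont_neq0 (cdiff_cont (dw ord0 _ c1r)) w1).
pose u (i : 'I_d) y := w (lift ord0 i) y / w ord0 y.
have r10 : 0 < r1 by case: S.
have du i y : nm (y - c1) < r1 -> cdiff (u i) y.
  by move=> yr; apply: cdiffM (dw _ _ (S.2 _ yr)) (cdiffV (n0 y yr) (dw _ _ (S.2 _ yr))).
have [||c2 c2r W2] := IH (fun i => cD (u i)) c1 r1 r10.
- by move=> i y yr; apply: cdiff_cD; apply: evW (ev_ball_open yr) => y'; exact: du.
- move=> c' r' S' e He j.
  have r'0 : 0 < r' by case: S'.
  pose F y := \sum_j e j * u j y.
  have dF y : nm (y - c') < r' -> cderiv F y 0.
    move=> yr; rewrite -(He y yr); apply: cderiv_sum => i; apply: cderivZ; apply: cdiffP.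
    exact: du (S'.2 _ yr).
  have FE y : nm (y - c') < r' -> F y = F c'.
    by move=> yr; apply: (cderiv0_const dF) => //; rewrite subrr nm0.
  (* A relation between the derivatives of the u_i integrates to one between the u_i and 1; its
     constant term becomes the coefficient of [w ord0]. *)
  have := iw c' r' (subball_trans S S') (fun k : 'I_d.+1 => if unlift ord0 k is Some i then e i else - F c').
  move=> /(_ _ (lift ord0 j)); rewrite liftK; apply=> y yr.
  rewrite big_ord_recl unlift_none -(FE y yr) /F mulNr mulr_suml addrC.
  apply/eqP; rewrite subr_eq0; apply/eqP; apply: eq_bigr => i _.
  by rewrite liftK /u mulrA divfK// n0//; exact: (S'.2 _ yr).
exists c2; first exact: S.2 _ c2r.
pose U (i : 'I_d.+1) := if unlift ord0 i is Some j then u j else fun=> 1.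
have evc2 := ev_ball_open c2r.
have dU i : ev c2 (cdiff (U i)).
  apply: evW evc2 => y yr; rewrite /U; case: unliftP => [j _|_]; [exact: du|exact: cdiff_cst].
have dw0 : ev c2 (cdiff (w ord0)) by apply: evW evc2 => y yr; apply: dw; exact: S.2.
have dvU i : ev c2 (fun y => ev (id y) (cdiff (U i))) by exact: ev_ev (dU i).
have EU i : ev c2 (fun y => w ord0 y * U i (id y) = w i y).
  apply: evW evc2 => y yr; rewrite /U; case: unliftP => [j ->|->]; last by rewrite mulr1.
  by rewrite /u mulrC divfK// n0.
have did : ev c2 (cdiff (@id R[i])) by apply: ev_all => y; exists 1; exact: cderiv_id.
have -> := ev_self (wron_pull dw0 did dvU EU).
rewrite mulf_neq0//; last first.
  apply/prodf_neq0 => k _; rewrite mulf_neq0 ?n0// (cderiv_cD (cderiv_id c2)) expr1n oner_neq0//.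
suff -> : wron U c2 = wron (fun i => cD (u i)) c2 by [].
rewrite /wron (expand_det_row _ ord0) big_ord_recl big1 ?addr0; last first.
  move=> k _; rewrite mxE /U unlift_none (_ : cDn _ _ _ = 0) ?mul0r// lift0 /cDn iterSr.
  have -> : cD (fun=> 1) = (fun=> 0 : R[i]).
    by apply/funext => y; exact: cderiv_cD (cderiv_cst 1 y).
  elim: (nat_of_ord k) (c2) => // n IHn y /=; rewrite -[RHS](cderiv_cD (cderiv_cst 0 y)).
  by congr (cD _ y); apply/funext => y'; exact: IHn.
rewrite mxE /U unlift_none /= mul1r /cofactor addn0 expr0 mul1r; congr (\det _).
apply/matrixP => i k; rewrite !mxE /U liftK lift0 /cDn iterSr.
reflexivity.
Qed.

End Wronskian.

(** * Invariant families of least size *)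

Section MinimalSpan.
Variable R : realType.
Implicit Types (e r : R) (p z a b c x y : R[i]) (f g h F : R[i] -> R[i]).
Variables (G : (R[i] -> R[i]) -> R[i] -> Prop).
Hypothesis G_diff : forall g z, G g z -> ev z (cdiff g).
Hypothesis G_neq0 : forall g z, G g z -> cD g z != 0.

(** The transformation law of coefficients of vector fields: the pullback by [g] of each field is a
    constant combination of the family. *)
Definition invariant_family d (w : 'I_d -> R[i] -> R[i]) c r :=
  forall g z, G g z -> nm (z - c) < r -> nm (g z - c) < r ->
    exists A : 'M[R[i]]_d, ev z (fun y => forall i, w i (g y) = cD g y * \sum_j A i j * w j y).

Lemma indep_sub d (w : 'I_d -> R[i] -> R[i]) c r c' r' : subball c r c' r' -> indep w c r -> indep w c' r'.
Proof. by move=> S H c2 r2 S2; apply: H; exact: subball_trans S S2. Qed.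

Lemma invariant_sub d (w : 'I_d -> R[i] -> R[i]) c r c' r' : subball c r c' r' ->
  invariant_family w c r -> invariant_family w c' r'.
Proof. by move=> [_ S] H g z Gg zr gr; apply: H Gg (S _ zr) (S _ gr). Qed.

Lemma minimal_span n (v : 'I_n -> R[i] -> R[i]) c r : 0 < r ->
  (forall i y, nm (y - c) < r -> cdiff (v i) y) ->
  (forall y, nm (y - c) < r -> exists i, v i y != 0) -> invariant_family v c r ->
  exists d c' r' (w : 'I_d.+1 -> R[i] -> R[i]), [/\ subball c r c' r',
    forall i y, nm (y - c') < r' -> cdiff (w i) y, indep w c' r' & invariant_family w c' r'].
Proof.
move=> r0 dv vnz vinv.
pose comb d (B : 'M[R[i]]_(d, n)) i y := \sum_j B i j * v j y.
(* [B] forms d combinations of the [v], from which [S] recovers all of [v]. The disc varies together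
   with d, so that minimality yields independence on every smaller disc. *)
pose P d := exists c' r' (B : 'M[R[i]]_(d, n)) (S : 'M[R[i]]_(n, d)), subball c r c' r' /\
  forall y, nm (y - c') < r' -> forall i, v i y = \sum_j S i j * comb d B j y.
have exP : exists d, `[< P d >].
  exists n; apply/asboolP; exists c, r, 1%:M, 1%:M; split; first exact: subball_refl.
  have sum1 i (F : 'I_n -> R[i]) : \sum_j (1%:M : 'M[R[i]]_n) i j * F j = F i.
    rewrite (bigD1 i)//= big1 ?addr0 ?mxE ?eqxx ?mul1r// => j ji.
    by rewrite mxE eq_sym (negPf ji) mul0r.
  by move=> y yr i; rewrite sum1 /comb sum1.
case: (ex_minnP exP) => -[|m] /asboolP[c' [r' [B [S [sub vE]]]]] minP.
  have [j] := vnz c' (subball_center sub).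
  by rewrite vE ?big_ord0 ?eqxx// subrr nm0; case: sub.
exists m, c', r', (comb m.+1 B); split=> //.
- move=> i y yr; apply: cdiff_sum => j; apply: cdiffM; first exact: cdiff_cst.
  by apply: dv; exact: sub.2.
- move=> c2 r2 S2 e He j; apply/eqP; apply: contraT => ej.
  suff /asboolP/minP : P m by rewrite ltnn.
  (* A relation with non-zero j-th coefficient eliminates the j-th combination, which contradicts
     minimality. *)
  exists c2, r2, (\matrix_(k, l) B (lift j k) l), (\matrix_(i, k) (S i (lift j k) - S i j * (e (lift j k) / e j))).
  split; first exact: subball_trans sub S2.
  move=> y yr i; rewrite vE; last exact: S2.2.
  have := He y yr; rewrite !(bigD1_ord j)//= => /eqP; rewrite addr_eq0 => /eqP E.
  have combE k : comb m (\matrix_(k, l) B (lift j k) l) k y = comb m.+1 B (lift j k) y.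
    by apply: eq_bigr => l _; rewrite mxE.
  under [in RHS]eq_bigr do rewrite mxE combE mulrBl.
  rewrite big_split /= addrC sumrN; congr (_ + _).
  have -> : comb m.+1 B j y = - (\sum_k e (lift j k) * comb m.+1 B (lift j k) y) / e j.
    by rewrite -E mulrC mulKf.
  rewrite mulNr mulrN mulr_suml mulr_sumr; congr (- _); apply: eq_bigr => k _.
  by rewrite -!mulrA [(e j)^-1 * _]mulrC.
- move=> g z Gg zr gr; have [A HA] := vinv g z Gg (sub.2 _ zr) (sub.2 _ gr).
  (* The new family is B v, while v transforms by A and is recovered as S applied to the new
     family. *)
  exists (B *m A *m S); apply: evW (evI HA (G_ball G_diff Gg zr gr)) => y [Ey [y1 y2]] i.
  rewrite /comb; under eq_bigr do rewrite Ey mulrCA.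
  rewrite -mulr_sumr; congr (_ * _).
  transitivity (\sum_l (B *m A) i l * v l y).
    under eq_bigr do rewrite mulr_sumr.
    rewrite exchange_big /=; apply: eq_bigr => l _; rewrite mxE mulr_suml.
    by apply: eq_bigr => k _; rewrite mulrA.
  under eq_bigr do rewrite (vE y y1) mulr_sumr.
  rewrite exchange_big /=; apply: eq_bigr => l _; rewrite mxE mulr_suml.
  by apply: eq_bigr => k _; rewrite mulrA.
Qed.

Section Weight.
Variables (d : nat) (w : 'I_d -> R[i] -> R[i]) (c : R[i]) (r : R).
Hypothesis dw : forall i y, nm (y - c) < r -> cdiff (w i) y.
Hypothesis winv : invariant_family w c r.

Let ev_dw i y : nm (y - c) < r -> ev y (cdiff (w i)).
Proof. by move=> yr; apply: evW (ev_ball_open yr) => u; exact: dw. Qed.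

Lemma wron_transform g z : G g z -> nm (z - c) < r -> nm (g z - c) < r ->
  exists a, ev z (fun y => a * wron w y = wron w (g y) * \prod_(k < d) ((cD g y)^-1 * cD g y ^+ k)).
Proof.
move=> Gg zr gr; have [A HA] := winv Gg zr gr.
have GE := G_ev G_diff G_neq0 Gg; have B := G_ball G_diff Gg zr gr.
pose w' i y := \sum_j A i j * w j y.
have L : ev z (fun y => wron w' y = \det A * wron w y).
  by apply: wron_lin; [move=> i; exact: ev_dw|apply: ev_all].
have dp : ev z (cdiff (fun y => (cD g y)^-1)).
  by apply: evW GE => y [_ [dg' g0]]; exact: cdiffV.
have dv i : ev z (fun y => ev (g y) (cdiff (w i))) by apply: evW B => y [_ y2]; exact: ev_dw.
have E i : ev z (fun y => (cD g y)^-1 * w i (g y) = w' i y).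
  by apply: evW (evI HA GE) => y [Ey [_ [_ g0]]]; rewrite Ey mulKf.
exists (\det A); apply: evW (evI L (wron_pull dp (G_diff Gg) dv E)) => y [<- ->].
reflexivity.
Qed.

Let m : R[i] := \sum_(k < d) (k%:R - 1).
Hypothesis Wnz : forall y, nm (y - c) < r -> wron w y != 0.

(** The logarithmic derivative of [wron_transform]: the constant factor disappears, and the factor
    g'^(k - 1) of index k contributes k - 1 to the weight [m]. *)
Lemma wron_logderiv g z : G g z -> nm (z - c) < r -> nm (g z - c) < r ->
  ev z (fun y => cD (wron w) y / wron w y =
     cD (wron w) (g y) / wron w (g y) * cD g y + m * (cD (cD g) y / cD g y)).
Proof.
move=> Gg zr gr; have [a Ha] := wron_transform Gg zr gr.
have GE := G_ev G_diff G_neq0 Gg; have B := G_ball G_diff Gg zr gr.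
apply: evW (evI (ev_ev Ha) (evI GE B)) => y [Ey [[dg [dg' g0]] [y1 y2]]].
have dW u : nm (u - c) < r -> cderiv (wron w) u (cD (wron w) u).
  by move=> ur; apply: cdiffP; apply: cdiff_wron => i; exact: ev_dw.
pose sig := cD (cD g) y / cD g y.
have dphi (k : 'I_d) : cderiv (fun u => (cD g u)^-1 * cD g u ^+ k) y
    ((k%:R - 1) * sig * ((cD g y)^-1 * cD g y ^+ k)).
  have := cderivM (cderivV g0 (cdiffP dg')) (cderivX k (cdiffP dg')).
  rewrite (_ : _ + _ = (k%:R - 1) * sig * ((cD g y)^-1 * cD g y ^+ k))//.
  rewrite /sig; case: (nat_of_ord k) => [|l] /=; first by rewrite !expr0; field.
  by rewrite [_ ^+ l.+1]exprS -natr1; field.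
have D1 := cderivZ a (dW y y1).
have D2 := cderivM (cderiv_comp (dW (g y) y2) (cdiffP dg)) (cderiv_prod_log (index_enum 'I_d) dphi).
have Ey' : ev y (fun u => wron w (g u) * \prod_(k < d) ((cD g u)^-1 * cD g u ^+ k) = a * wron w u).
  by apply: evW Ey => u; exact: esym.
have := cderiv_unique D1 (cderiv_ext Ey' D2).
have Ey0 := ev_self Ey.
have W1 := Wnz y1; have W2 := Wnz y2.
rewrite -/m /=; set P := \prod_(i <- _) _ in Ey0 *.
set W := wron w y in Ey0 W1 *; set Wg := wron w (g y) in Ey0 W2 *.
move=> D3.
have P0 : P != 0 by apply/prodf_neq0 => k _; rewrite mulf_neq0 ?invr_eq0 ?expf_neq0.
have a0 : a != 0.
  by apply: contraTneq isT => a0; move/eqP: Ey0; rewrite a0 mul0r eq_sym mulf_eq0 (negPf W2) (negPf P0).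
have -> : cD (wron w) y / W = (a * cD (wron w) y) / (a * W) by field; rewrite a0 W1.
rewrite D3 Ey0 /sig; field; rewrite W2 P0 g0; exact: isT.
Qed.

End Weight.

Lemma weight_sum d : (\sum_(k < d) (k%:R - 1 : R[i])) * 2 = d%:R * (d%:R - 3).
Proof.
elim: d => [|d IH]; first by rewrite big_ord0 !mul0r.
by rewrite big_ord_recr /= mulrDl IH -natr1; ring.
Qed.

Lemma wronskian_dichotomy n (v : 'I_n -> R[i] -> R[i]) c r : 0 < r ->
  (forall i y, nm (y - c) < r -> cdiff (v i) y) ->
  (forall y, nm (y - c) < r -> exists i, v i y != 0) -> invariant_family v c r ->
  moebius_coord G c r \/
  exists c' r' (w : 'I_3 -> R[i] -> R[i]), [/\ subball c r c' r',
    forall i y, nm (y - c') < r' -> cdiff (w i) y, indep w c' r', invariant_family w c' r' &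
    forall y, nm (y - c') < r' -> wron w y != 0 /\ cD (wron w) y = 0].
Proof.
move=> r0 dv vnz vinv; have [d [c1 [r1 [w [S1 dw iw winv]]]]] := minimal_span r0 dv vnz vinv.
have r10 : 0 < r1 by case: S1.
have [c2 c2r W2] := wron_neq0 r10 dw iw.
have ddw i y : nm (y - c1) < r1 -> ev y (cdiff (w i)).
  by move=> yr; apply: evW (ev_ball_open yr) => u; exact: dw.
have dW y : nm (y - c1) < r1 -> cdiff (wron w) y.
  by move=> yr; apply: cdiff_wron => i; exact: ddw.
have [r2 [S2 n0]] := ev_subball c2r (ccont_neq0 (cdiff_cont (dW _ c2r)) W2).
have S := subball_trans S1 S2.
have r20 : 0 < r2 by case: S2.
have dw2 i y : nm (y - c2) < r2 -> cdiff (w i) y by move=> yr; apply: dw; exact: S2.2.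
have dW2 y : nm (y - c2) < r2 -> cdiff (wron w) y by move=> yr; apply: dW; exact: S2.2.
have winv2 := invariant_sub S2 winv.
pose m : R[i] := \sum_(k < d.+1) (k%:R - 1).
have dom y : nm (y - c2) < r2 -> cdiff (fun y => cD (wron w) y / wron w y) y.
  move=> yr; apply: cdiffM; last exact: cdiffV (n0 _ yr) (dW2 _ yr).
  by apply: cdiff_cD; apply: evW (ev_ball_open yr) => u; exact: dW2.
have [m0|m0] := eqVneq m 0; last first.
  left; apply: (moebius_coord_sub S).
  apply: (@affine_coord R G G_diff G_neq0 (fun y => m^-1 * (cD (wron w) y / wron w y))) => //.
    by move=> y yr; apply: cdiffM (dom y yr); exact: cdiff_cst.
  move=> g z Gg zr gr; have := wron_logderiv dw2 winv2 n0 Gg zr gr; apply: evW => y ->.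
  by rewrite -/m mulrDr (mulKf m0); ring.
have [[c3 [c3r w3]]|H] := pselect (exists c3, nm (c3 - c2) < r2 /\ cD (wron w) c3 / wron w c3 != 0).
  left; apply: (moebius_coord_sub S).
  apply: (@form_coord R G G_diff G_neq0 0 _ c2 r2 c3 r20 dom c3r w3) => g z Gg zr gr.
  have := wron_logderiv dw2 winv2 n0 Gg zr gr; apply: evW => y ->.
  by rewrite -/m m0 mul0r addr0 expr1.
right.
(* The family has d + 1 members, so the vanishing of the weight reads (d + 1) (d - 2) = 0. *)
have : d = 2%N.
  have /eqP := weight_sum d.+1; rewrite -/m m0 mul0r eq_sym mulf_eq0 pnatr_eq0 /=.
  by rewrite subr_eq0 eqr_nat => /eqP[].
move=> d2; subst d; exists c2, r2, w; split=> //; first exact: indep_sub S2 iw.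
move=> y yr; split; first exact: n0.
apply/eqP; apply: contrapT => /negP W0; apply: H; exists y; split=> //.
by rewrite mulf_neq0 ?invr_eq0 ?n0.
Qed.

End MinimalSpan.

(** * Three-dimensional invariant families *)

Section ThirdOrder.
Variable R : realType.
Implicit Types (e r : R) (p z a b c x y : R[i]) (f g h F : R[i] -> R[i]).

Lemma cderiv_eq f z (l m : R[i]) : cderiv f z l -> l = m -> cderiv f z m.
Proof. by move=> H <-. Qed.

Lemma det33 (a : nat -> nat -> R[i]) : \det (\matrix_(i < 3, j < 3) a i j) =
  a 0%N 0%N * (a 1%N 1%N * a 2%N 2%N - a 1%N 2%N * a 2%N 1%N) - a 0%N 1%N * (a 1%N 0%N * a 2%N 2%N - a 1%N 2%N * a 2%N 0%N)
  + a 0%N 2%N * (a 1%N 0%N * a 2%N 1%N - a 1%N 1%N * a 2%N 0%N).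
Proof.
rewrite (expand_det_row _ 0) !big_ord_recl big_ord0 /cofactor !det22 !mxE /= /bump /=.
by ring.
Qed.

(** The minor of three rows in the columns k0, k1, k2. Indices are natural numbers so that a column
    of third derivatives can take part. *)
Definition det3 (a : nat -> nat -> R[i]) k0 k1 k2 :=
  a 0%N k0 * (a 1%N k1 * a 2%N k2 - a 1%N k2 * a 2%N k1) - a 0%N k1 * (a 1%N k0 * a 2%N k2 - a 1%N k2 * a 2%N k0)
  + a 0%N k2 * (a 1%N k0 * a 2%N k1 - a 1%N k1 * a 2%N k0).

(** Differentiating a column other than the last one makes two columns equal. *)
Lemma det3_deriv (f : nat -> nat -> R[i] -> R[i]) y :
  (forall i k, cderiv (f i k) y (f i k.+1 y)) ->
  cderiv (fun u => det3 (fun i k => f i k u) 0%N 1%N 2%N) y (det3 (fun i k => f i k y) 0%N 1%N 3%N).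
Proof.
move=> d'.
have := cderivD (cderivB
  (cderivM (d' 0%N 0%N) (cderivB (cderivM (d' 1%N 1%N) (d' 2%N 2%N)) (cderivM (d' 1%N 2%N) (d' 2%N 1%N))))
  (cderivM (d' 0%N 1%N) (cderivB (cderivM (d' 1%N 0%N) (d' 2%N 2%N)) (cderivM (d' 1%N 2%N) (d' 2%N 0%N)))))
  (cderivM (d' 0%N 2%N) (cderivB (cderivM (d' 1%N 0%N) (d' 2%N 1%N)) (cderivM (d' 1%N 1%N) (d' 2%N 0%N)))).
by move=> D; rewrite /det3; apply: cderiv_eq D _; ring.
Qed.

Lemma det3_diff (f : nat -> nat -> R[i] -> R[i]) y k0 k1 k2 :
  (forall i k, cdiff (f i k) y) -> cdiff (fun u => det3 (fun i k => f i k u) k0 k1 k2) y.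
Proof.
move=> df; have M3 i k i1 j1 i2 j2 i3 j3 i4 j4 :
    cdiff (fun y => f i k y * (f i1 j1 y * f i2 j2 y - f i3 j3 y * f i4 j4 y)) y.
  exact: cdiffM (df i k) (cdiffB (cdiffM (df i1 j1) (df i2 j2)) (cdiffM (df i3 j3) (df i4 j4))).
exact: cdiffD (cdiffB (M3 _ _ _ _ _ _ _ _ _ _) (M3 _ _ _ _ _ _ _ _ _ _)) (M3 _ _ _ _ _ _ _ _ _ _).
Qed.

(** Cramer's rule for column 3 in terms of columns 0, 1 and 2. For a Wronskian the hypothesis says
    W' = 0, and it kills the coefficient of the second derivatives. *)
Lemma det3_cramer (a : nat -> nat -> R[i]) i : (i < 3)%N -> det3 a 0%N 1%N 3%N = 0 ->
  det3 a 0%N 1%N 2%N * a i 3%N = det3 a 0%N 3%N 2%N * a i 1%N + det3 a 3%N 1%N 2%N * a i 0%N.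
Proof.
move=> i3 E.
have K : det3 a 0%N 1%N 2%N * a i 3%N =
    det3 a 0%N 3%N 2%N * a i 1%N + det3 a 3%N 1%N 2%N * a i 0%N + det3 a 0%N 1%N 3%N * a i 2%N.
  by rewrite /det3; case: i i3 => [|[|[|i]]] // _; ring.
by rewrite K E mul0r addr0.
Qed.

Lemma det3_kernel (a : nat -> nat -> R[i]) b d : det3 a 0%N 1%N 2%N != 0 ->
  (forall i, (i < 3)%N -> b * a i 1%N + d * a i 0%N = 0) -> b = 0 /\ d = 0.
Proof.
move=> W0 H.
have H0 := H 0%N isT; have H1 := H 1%N isT; have H2 := H 2%N isT.
split; apply: (mulIf W0); rewrite mul0r /det3.
  transitivity (- (b * a 0%N 1%N + d * a 0%N 0%N) * (a 1%N 0%N * a 2%N 2%N - a 1%N 2%N * a 2%N 0%N)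
    + (b * a 1%N 1%N + d * a 1%N 0%N) * (a 0%N 0%N * a 2%N 2%N - a 0%N 2%N * a 2%N 0%N)
    - (b * a 2%N 1%N + d * a 2%N 0%N) * (a 0%N 0%N * a 1%N 2%N - a 0%N 2%N * a 1%N 0%N)); first by ring.
  by rewrite H0 H1 H2; ring.
transitivity ((b * a 0%N 1%N + d * a 0%N 0%N) * (a 1%N 1%N * a 2%N 2%N - a 1%N 2%N * a 2%N 1%N)
    - (b * a 1%N 1%N + d * a 1%N 0%N) * (a 0%N 1%N * a 2%N 2%N - a 0%N 2%N * a 2%N 1%N)
    + (b * a 2%N 1%N + d * a 2%N 0%N) * (a 0%N 1%N * a 1%N 2%N - a 0%N 2%N * a 1%N 1%N)); first by ring.
by rewrite H0 H1 H2; ring.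
Qed.

Lemma wron3E (u : 'I_3 -> R[i] -> R[i]) y :
  wron u y = det3 (fun i k => cDn k (u (inord i)) y) 0%N 1%N 2%N.
Proof.
rewrite /det3 -(det33 (fun i k => cDn k (u (inord i)) y)) /wron; congr (\det _); apply/matrixP => i k.
by rewrite !mxE inord_val.
Qed.

(** [B] and [D] are the coefficients b and c of the overview. *)
Definition ode3 (B D h : R[i] -> R[i]) y := cDn 3 h y = - B y * cDn 1 h y - D y * h y.

Lemma cDn1 h y : cDn 1 h y = cD h y. Proof. by []. Qed.

Section Fam.
Variables (w : 'I_3 -> R[i] -> R[i]) (c : R[i]) (r : R).
Hypothesis dw : forall i y, nm (y - c) < r -> cdiff (w i) y.
Hypothesis Wnz : forall y, nm (y - c) < r -> wron w y != 0 /\ cD (wron w) y = 0.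

Let ev_dw i y : nm (y - c) < r -> ev y (cdiff (w i)).
Proof. by move=> yr; apply: evW (ev_ball_open yr) => u; exact: dw. Qed.

Lemma ev_dcDn h n y : (forall u, nm (u - c) < r -> cdiff h u) -> nm (y - c) < r -> 
  cderiv (cDn n h) y (cDn n.+1 h y).
Proof.
move=> dh yr; apply: cdiffP; apply: ev_self; apply: ev_cdiff_cDn.
by apply: evW (ev_ball_open yr) => u; exact: dh.
Qed.

Let F i k := cDn k (w (inord i)).

Lemma exists_ode3 : exists B D : R[i] -> R[i],
  (forall y, nm (y - c) < r -> cdiff B y /\ cdiff D y) /\
  (forall i y, nm (y - c) < r -> ode3 B D (w i) y).
Proof.
have dF i k y : nm (y - c) < r -> cderiv (F i k) y (F i k.+1 y).
  by move=> yr; apply: ev_dcDn => // u; exact: dw.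
have dF' i k y : nm (y - c) < r -> cdiff (F i k) y by move=> /(dF i k)/cderiv_diff.
have dW y : nm (y - c) < r -> cdiff (wron w) y.
  by move=> yr; apply: cdiff_wron => i; exact: ev_dw.
exists (fun y => - 1 * (det3 (fun i k => F i k y) 0%N 3%N 2%N / wron w y)),
  (fun y => - 1 * (det3 (fun i k => F i k y) 3%N 1%N 2%N / wron w y)); split.
  move=> y yr; have [W0 _] := Wnz yr.
  by split; apply: cdiffM (cdiff_cst _ _) _; apply: cdiffM (cdiffV W0 (dW y yr)); apply: det3_diff => i k;
    exact: dF'.
move=> i y yr; have [W0 W1] := Wnz yr.
have N2 : det3 (fun i k => F i k y) 0%N 1%N 3%N = 0.
  rewrite -W1; apply/esym/cderiv_cD.
  apply: cderiv_ext (det3_deriv (fun i k => dF i k y yr)).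
  by apply: ev_all => u; rewrite wron3E.
have := det3_cramer (ltn_ord i) N2; rewrite -wron3E /F inord_val => H.
have E x x' : x * x' = wron w y * (x / wron w y * x').
  by rewrite [wron w y * _]mulrA [wron w y * _]mulrC (divfK W0).
apply: (mulfI W0); rewrite H !mulN1r !opprK !mulNr !opprK mulrDr.
by congr (_ + _); exact: E.
Qed.

End Fam.

(* With y = h o g / g' and s = g'' / g'. *)
Lemma pull_derivatives g h z : ev z (fun u => cdiff g u /\ cdiff (cD g) u /\ cD g u != 0) ->
  ev z (fun u => ev (g u) (cdiff h)) ->
  let y := fun u => (cD g u)^-1 * h (g u) in let s := fun u => cD (cD g) u / cD g u in
  ev z (fun u => [/\ cdiff y u, cdiff s u,
    cDn 1 y u = cDn 1 h (g u) - s u * y u,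
    cDn 2 y u = cDn 2 h (g u) * cD g u - cD s u * y u - s u * cDn 1 y u &
    cDn 3 y u = cDn 3 h (g u) * cD g u ^+ 2 + (s u ^+ 2 - 2 * cD s u) * cDn 1 y u
       + (s u * cD s u - cD (cD s) u) * y u]).
Proof.
move=> Gz dh y s.
have dg : ev z (cdiff g) by apply: evW Gz => u [].
have ds : ev z (cdiff s).
  apply: evW (evI Gz (ev_cdiff_cDn 2 dg)) => u [[_ [dg' g0]] dg2].
  by apply: cdiffM dg2 (cdiffV g0 dg').
have dhg n : ev z (fun u => cderiv (fun u => cDn n h (g u)) u (cDn n.+1 h (g u) * cD g u)).
  apply: evW (evI dg dh) => u [gu hu]; apply: (@cderiv_comp _ (cDn n h) g); last exact: cdiffP.
  by apply: cdiffP; exact: ev_self (ev_cdiff_cDn n hu).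
have dy : ev z (cdiff y).
  apply: evW (evI Gz (dhg 0%N)) => u [[_ [dg' g0]] /cderiv_diff hu].
  by apply: cdiffM (cdiffV g0 dg') hu.
have E1 : ev z (fun u => cDn 1 y u = cDn 1 h (g u) - s u * y u).
  apply: evW (evI Gz (dhg 0%N)) => u [[_ [dg' g0]] hu].
  apply: cderiv_cD; have := cderivM (cderivV g0 (cdiffP dg')) hu.
  by move=> D; apply: cderiv_eq D _; rewrite /s /y /cDn /=; field.
have E2 : ev z (fun u => cDn 2 y u = cDn 2 h (g u) * cD g u - cD s u * y u - s u * cDn 1 y u).
  apply: evW (evI (ev_ev E1) (evI (dhg 1%N) (evI ds dy))) => u [Eu [hu [su yu]]].
  apply: cderiv_cD; apply: cderiv_ext (_ : cderiv (fun u => cDn 1 h (g u) - s u * y u) u _).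
    by apply: evW Eu => x; exact: esym.
  have := cderivB hu (cderivM (cdiffP su) (cdiffP yu)).
  by move=> D; apply: cderiv_eq D _; rewrite cDn1; ring.
have dy1 := ev_cdiff_cDn 1 dy; have ds1 := ev_cdiff_cDn 1 ds.
apply: evW (evI (evI E1 (ev_ev E2)) (evI (dhg 2%N) (evI Gz (evI (evI ds dy) (evI ds1 dy1))))).
move=> u [[E1u Eu] [hu [[_ [dg' g0]] [[su yu] [s1u y1u]]]]].
split=> //; first exact: ev_self Eu.
apply: cderiv_cD; apply: cderiv_ext (_ : cderiv (fun u => cDn 2 h (g u) * cD g u - cD s u * y u - s u * cDn 1 y u) u _).
  by apply: evW Eu => x; exact: esym.
have := cderivB (cderivB (cderivM hu (cdiffP dg')) (cderivM (cdiffP s1u) (cdiffP yu)))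
   (cderivM (cdiffP su) (cdiffP y1u)).
move=> D; apply: cderiv_eq D _.
have -> : cD (cD g) u = s u * cD g u by rewrite /s divfK.
have E2u := ev_self Eu; rewrite -![cD (cDn 1 y) u]/(cDn 2 y u) E2u.
rewrite -![cD y u]/(cDn 1 y u) -![cD (cDn 1 s) u]/(cD (cD s) u) -![cDn 1 s u]/(cD s u).
ring.
Qed.

End ThirdOrder.

Arguments cDn : simpl never.

Section Projective.
Variable R : realType.
Implicit Types (e r : R) (p z a b c x y : R[i]) (f g h F : R[i] -> R[i]).
Variables (G : (R[i] -> R[i]) -> R[i] -> Prop).
Hypothesis G_diff : forall g z, G g z -> ev z (cdiff g).
Hypothesis G_neq0 : forall g z, G g z -> cD g z != 0.

Section Fam.
Variables (w : 'I_3 -> R[i] -> R[i]) (c : R[i]) (r : R).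
Hypothesis r0 : 0 < r.
Hypothesis dw : forall i y, nm (y - c) < r -> cdiff (w i) y.
Hypothesis iw : indep w c r.
Hypothesis winv : invariant_family G w c r.
Hypothesis Wnz : forall y, nm (y - c) < r -> wron w y != 0 /\ cD (wron w) y = 0.
Variables (B D : R[i] -> R[i]).
Hypothesis dBD : forall y, nm (y - c) < r -> cdiff B y /\ cdiff D y.
Hypothesis ode : forall i y, nm (y - c) < r -> ode3 B D (w i) y.

Let ev_dw i y : nm (y - c) < r -> ev y (cdiff (w i)).
Proof. by move=> yr; apply: evW (ev_ball_open yr) => u; exact: dw. Qed.

Lemma ode3_lin (al : 'I_3 -> R[i]) h z : nm (z - c) < r -> ev z (fun u => \sum_j al j * w j u = h u) ->
  ev z (fun u => cdiff h u /\ ode3 B D h u).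
Proof.
move=> zr E; have dwz i := ev_dw i zr.
have ds : ev z (cdiff (fun u => \sum_j al j * w j u)).
  apply: evW (ev_forall dwz) => u du; apply: cdiff_sum => j.
  by apply: cdiffM (du j); exact: cdiff_cst.
have dh := ev_cdiff_ext E ds.
apply: evW (evI dh (evI (ev_ball_open zr) (evI E (evI (evI (ev_cDn 3 ds E) (ev_cDn 1 ds E))
  (evI (cDn_sum al 3 dwz) (cDn_sum al 1 dwz)))))).
move=> u [hu [ur [E0 [[E3 E1] [S3 S1]]]]]; split; first exact: hu.
rewrite /ode3 -E3 -E1 -E0 S3 S1 !mulr_sumr -sumrN -big_split /=; apply: eq_bigr => j _.
rewrite (ode j ur); ring.
Qed.

(** The functions w_i(g) / g' lie in the span of the family and so satisfy its equation; they also
    satisfy the equation transported by [g]. The difference is a first order operator that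
    annihilates three functions with non-zero Wronskian, hence it is 0 by [det3_kernel]. *)
Lemma ode3_transform g z : G g z -> nm (z - c) < r -> nm (g z - c) < r ->
  let s := fun u => cD (cD g) u / cD g u in
  ev z (fun u => B u = B (g u) * cD g u ^+ 2 + 2 * cD s u - s u ^+ 2 /\
    D u = B (g u) * cD g u ^+ 2 * s u + D (g u) * cD g u ^+ 3 - s u * cD s u + cD (cD s) u).
Proof.
move=> Gg zr gr s; have [A HA] := winv Gg zr gr.
have GE := G_ev G_diff G_neq0 Gg; have Bl := G_ball G_diff Gg zr gr.
pose y i u := (cD g u)^-1 * w i (g u).
have yE i : ev z (fun u => \sum_j A i j * w j u = y i u).
  by apply: evW (evI HA GE) => u [Eu [_ [_ g0]]]; rewrite /y Eu mulKf.
have O i := ode3_lin zr (yE i).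
have dv i : ev z (fun u => ev (g u) (cdiff (w i))) by apply: evW Bl => u [_ u2]; exact: ev_dw.
have PD i := pull_derivatives GE (dv i).
have dp : ev z (cdiff (fun y => (cD g y)^-1)).
  by apply: evW GE => u [_ [dg' g0]]; exact: cdiffV.
have WP : ev z (fun u => wron y u = wron w (g u) * \prod_(k < 3) ((cD g u)^-1 * cD g u ^+ k)).
  by apply: (wron_pull dp (G_diff Gg) dv) => i; apply: ev_all.
apply: evW (evI (evI WP Bl) (evI GE (evI (ev_forall O) (ev_forall PD)))).
move=> u [[Wu [u1 u2]] [[_ [_ g0]] [Ou Pu]]].
have W0 : det3 (fun i k => cDn k (y (inord i)) u) 0%N 1%N 2%N != 0.
  rewrite -wron3E Wu mulf_neq0 ?(Wnz u2).1//.
  by apply/prodf_neq0 => k _; rewrite mulf_neq0 ?invr_eq0 ?expf_neq0.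
pose b := B (g u) * cD g u ^+ 2 + 2 * cD s u - s u ^+ 2 - B u.
pose d := B (g u) * cD g u ^+ 2 * s u + D (g u) * cD g u ^+ 3 - s u * cD s u + cD (cD s) u - D u.
have [|b0 d0] := det3_kernel (b := b) (d := d) W0.
  move=> i _; set h := w (inord i); set yi := y (inord i).
  have [_ O3] : cdiff yi u /\ ode3 B D yi u := Ou (inord i).
  have [_ _ E1 E2 E3] : [/\ cdiff yi u, cdiff s u,
    cDn 1 yi u = cDn 1 h (g u) - s u * yi u,
    cDn 2 yi u = cDn 2 h (g u) * cD g u - cD s u * yi u - s u * cDn 1 yi u &
    cDn 3 yi u = cDn 3 h (g u) * cD g u ^+ 2 + (s u ^+ 2 - 2 * cD s u) * cDn 1 yi u
       + (s u * cD s u - cD (cD s) u) * yi u] := Pu (inord i).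
  have O3' : ode3 B D h (g u) := ode (inord i) u2.
  move: O3 E1 E2 E3 O3'; rewrite /ode3.
  have hE : h (g u) = cD g u * yi u by rewrite /yi /y mulVKf.
  rewrite hE /b /d; change (cDn 0 yi u) with (yi u).
  move: (yi u) (cDn 1 yi u) (cDn 2 yi u) (cDn 3 yi u) (cDn 1 h (g u)) (cDn 2 h (g u)) (cDn 3 h (g u)).
  move: (B u) (D u) (B (g u)) (D (g u)) (cD g u) (s u) (cD s u) (cD (cD s) u).
  move=> Bu Du Bg Dg q s0 s1 s2 y0 y1 y2 y3 h1 h2 h3 O3 E1 E2 E3 O3'.
  have h1E : h1 = y1 + s0 * y0 by rewrite E1; ring.
  have K : (- Bu * y1 - Du * y0) - ((- Bg * (y1 + s0 * y0) - Dg * (q * y0)) * q ^+ 2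
      + (s0 ^+ 2 - 2 * s1) * y1 + (s0 * s1 - s2) * y0) = 0.
    by rewrite -h1E -O3' -E3 -O3 subrr.
  rewrite -[RHS]K; ring.
split; apply/esym/eqP; rewrite -subr_eq0; first by rewrite -/b b0.
by rewrite -/d d0.
Qed.

(** Twice the cubic differential R of the overview. *)
Let Rf u := 2 * D u - cD B u.

(** In 2 D - B' all terms of [ode3_transform] that contain s = g''/g' or its derivatives cancel. *)
Lemma cubic_form g z : G g z -> nm (z - c) < r -> nm (g z - c) < r ->
  ev z (fun u => Rf u = Rf (g u) * cD g u ^+ 3).
Proof.
move=> Gg zr gr; have /= T := ode3_transform Gg zr gr.
have GE := G_ev G_diff G_neq0 Gg; have Bl := G_ball G_diff Gg zr gr.
set s := (fun u => cD (cD g) u / cD g u) in T.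
have ds : ev z (cdiff s).
  apply: evW (evI GE (ev_cdiff_cDn 2 (G_diff Gg))) => u [[_ [dg' g0]] dg2].
  by apply: cdiffM dg2 (cdiffV g0 dg').
apply: evW (evI (ev_ev T) (evI (evI GE Bl) (evI ds (ev_cdiff_cD ds)))).
move=> u [Tu [[[dg [dg' g0]] [u1 u2]] [su s1u]]].
have [_ TD] := ev_self Tu; rewrite /Rf TD -/(s u).
have dBg := cdiffP (dBD u2).1.
have := cderivB (cderivD (cderivM (cderiv_comp dBg (cdiffP dg)) (cderivX 2 (cdiffP dg')))
   (cderivM (cderiv_cst 2 u) (cdiffP s1u))) (cderivX 2 (cdiffP su)).
have E : ev u (fun x => B (g x) * cD g x ^+ 2 + 2 * cD s x - s x ^+ 2 = B x).
  by apply: evW Tu => x [-> _].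
move=> /(cderiv_ext E)/cderiv_cD ->.
have -> : cD (cD g) u = s u * cD g u by rewrite /s divfK.
rewrite /= !expr1; move: (B (g u)) (D (g u)) (cD B (g u)) (cD g u) (s u) (cD s u) (cD (cD s) u).
by move=> *; ring.
Qed.

Hypothesis Rf0 : forall y, nm (y - c) < r -> Rf y = 0.

(** For a product h = y1 y2 of solutions of y'' = - (B / 4) y this is minus the square of the
    Wronskian of y1 and y2; it is a discriminant that vanishes on squares. *)
Definition disc3 h u := 2 * h u * cDn 2 h u - cDn 1 h u ^+ 2 + B u * h u ^+ 2.

Lemma disc3_const h z : nm (z - c) < r -> ev z (fun u => cdiff h u /\ ode3 B D h u) ->
  ev z (fun u => cderiv (disc3 h) u 0).
Proof.
move=> zr H; have dh : ev z (cdiff h) by apply: evW H => u [].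
apply: evW (evI (evI H (ev_ball_open zr)) (evI dh (evI (ev_cdiff_cDn 1 dh) (ev_cdiff_cDn 2 dh)))).
move=> u [[[_ O] ur] [h0 [h1 h2]]].
have DB : cD B u = 2 * D u by have := Rf0 ur; rewrite /Rf => /eqP; rewrite subr_eq0 => /eqP.
have := cderivD (cderivB (cderivM (cderivM (cderiv_cst 2 u) (cdiffP h0)) (cdiffP h2)) (cderivX 2 (cdiffP h1)))
  (cderivM (cdiffP (dBD ur).1) (cderivX 2 (cdiffP h0))).
move=> E; apply: cderiv_eq E _.
rewrite -[cD (cDn 2 h) u]/(cDn 3 h u) O -[cD (cDn 1 h) u]/(cDn 2 h u) -[cD h u]/(cDn 1 h u) DB /= !expr1.
move: (h u) (cDn 1 h u) (cDn 2 h u) (B u) (D u) => *; ring.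
Qed.

(** A binary quadratic form over R[i] has a non-trivial zero, so a combination of the first two
    functions will do. The value at [c] determines [disc3] on the disc, by [disc3_const]. *)
Lemma isotropic : exists al : 'I_3 -> R[i], (exists j, al j != 0) /\
  disc3 (fun u => \sum_j al j * w j u) c = 0.
Proof.
have cc : nm (c - c) < r by rewrite subrr nm0.
pose Q al := disc3 (fun u => \sum_j al j * w j u) c.
pose i0 : 'I_3 := inord 0; pose i1 : 'I_3 := inord 1.
have i10 : i1 != i0 by rewrite -val_eqE /= !inordK.
pose be a b (j : 'I_3) : R[i] := if j == i0 then a else if j == i1 then b else 0.
have sumE a b (F : 'I_3 -> R[i]) : \sum_j be a b j * F j = a * F i0 + b * F i1.
  rewrite (bigD1 i0)//= (bigD1 i1)//= /be eqxx (negPf i10) eqxx big1 ?addr0// => j /andP[j0 j1].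
  by rewrite (negPf j0) (negPf j1) mul0r.
have QE a b : Q (be a b) = a ^+ 2 * disc3 (w i0) c + b ^+ 2 * disc3 (w i1) c +
    2 * (a * b * (w i0 c * cDn 2 (w i1) c + w i1 c * cDn 2 (w i0) c - cDn 1 (w i0) c * cDn 1 (w i1) c + B c * (w i0 c * w i1 c))).
  have S n := ev_self (cDn_sum (be a b) n (fun i => ev_dw i cc)).
  rewrite /Q /disc3 (S 2) (S 1) !sumE.
  move: (w i0 c) (w i1 c) (cDn 1 (w i0) c) (cDn 2 (w i0) c) (cDn 1 (w i1) c) (cDn 2 (w i1) c) (B c) => *; ring.
move: QE; set q0 := disc3 (w i0) c; set q1 := disc3 (w i1) c; set q := (w i0 c * _ + _ - _ + _) => QE.
have [E|E] := eqVneq q1 0.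
  exists (be 0 1); split; first by exists i1; rewrite /be (negPf i10) eqxx oner_neq0.
  by rewrite -/(Q _) QE E; ring.
(* A root of q1 t^2 + 2 q t + q0 = 0. *)
pose t := (sqrtc (q ^+ 2 - q0 * q1) - q) / q1.
exists (be 1 t); split; first by exists i0; rewrite /be eqxx oner_neq0.
rewrite -/(Q _) QE; have sE : sqrtc (q ^+ 2 - q0 * q1) ^+ 2 = q ^+ 2 - q0 * q1 by exact: sqr_sqrtc.
have -> : 1 ^+ 2 * q0 + t ^+ 2 * q1 + 2 * (1 * t * q) =
   (sqrtc (q ^+ 2 - q0 * q1) ^+ 2 - (q ^+ 2 - q0 * q1)) / q1 by rewrite /t; field.
by rewrite sE subrr mul0r.
Qed.

End Fam.
End Projective.

(** * Solutions as quadratic polynomials in the isotropic coordinate *)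

Section IsotropicCoordinate.
Variable R : realType.
Implicit Types (e r : R) (p z a b c x y : R[i]) (f g h F : R[i] -> R[i]).

(** Differentiation with respect to [wc] is v d/du. The second such derivative of yy / v is [E], and
    E' = 0, so yy / v is a quadratic polynomial in [wc]; the value 0 of [disc3] on [yy] makes the
    discriminant of this polynomial vanish. *)
Lemma quad_in_coord (B D v yy wc : R[i] -> R[i]) z :
  ev z (fun u => [/\ cdiff v u, ode3 B D v u, disc3 B v u = 0 & v u != 0]) ->
  ev z (fun u => [/\ cdiff yy u, ode3 B D yy u & disc3 B yy u = 0]) ->
  ev z (fun u => cderiv wc u (v u)^-1) ->
  exists al be ga : R[i], be ^+ 2 = 4 * al * ga /\
    ev z (fun u => yy u = v u * (al + be * wc u + ga * wc u ^+ 2)).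
Proof.
move=> Hv Hy Hw.
have dv : ev z (cdiff v) by apply: evW Hv => u [].
have dy : ev z (cdiff yy) by apply: evW Hy => u [].
have dv1 := ev_cdiff_cDn 1 dv; have dv2 := ev_cdiff_cDn 2 dv.
have dy1 := ev_cdiff_cDn 1 dy; have dy2 := ev_cdiff_cDn 2 dy.
have DD : ev z (fun u => [/\ cderiv v u (cDn 1 v u), cderiv (cDn 1 v) u (cDn 2 v u), cderiv (cDn 2 v) u (cDn 3 v u) &
   [/\ cderiv yy u (cDn 1 yy u), cderiv (cDn 1 yy) u (cDn 2 yy u) & cderiv (cDn 2 yy) u (cDn 3 yy u)]]).
  apply: evW (evI (evI dv (evI dv1 dv2)) (evI dy (evI dy1 dy2))).
  by move=> u [[h1 [h2 h3]] [h4 [h5 h6]]]; split; [exact: cdiffP..|split; exact: cdiffP].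
pose E u := cDn 2 yy u * v u - yy u * cDn 2 v u - cDn 1 yy u * cDn 1 v u + yy u * cDn 1 v u ^+ 2 / v u.
have dE : ev z (fun u => cderiv E u 0).
  apply: evW (evI Hv (evI Hy DD)) => u [[_ O1 Q1 v0] [[_ O2 Q2] [h1 h2 h3 [k1 k2 k3]]]].
  have K := cderivD (cderivB (cderivB (cderivM k3 h1) (cderivM k1 h3)) (cderivM k2 h2))
    (cderivM (cderivM k1 (cderivX 2 h2)) (cderivV v0 h1)).
  apply: cderiv_eq K _; rewrite O1 O2 /= expr1.
  have BE : B u = (cDn 1 v u ^+ 2 - 2 * v u * cDn 2 v u) / v u ^+ 2.
    move: Q1 v0; rewrite /disc3; move: (v u) (cDn 1 v u) (cDn 2 v u) (B u) => x0 x1 x2 b Q0 x00.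
    apply/eqP; rewrite -subr_eq0.
    have -> : b - (x1 ^+ 2 - 2 * x0 * x2) / x0 ^+ 2 = (2 * x0 * x2 - x1 ^+ 2 + b * x0 ^+ 2) / x0 ^+ 2 by field.
    by rewrite Q0 mul0r.
  rewrite BE; move: v0; move: (v u) (cDn 1 v u) (cDn 2 v u) (yy u) (cDn 1 yy u) (cDn 2 yy u) (D u).
  by move=> x0 x1 x2 y0 y1 y2 d x00; field.
pose g2 := E z; have Ec : ev z (fun u => E u = g2) := ev_const dE.
pose N u := (cDn 1 yy u * v u - yy u * cDn 1 v u) / v u - g2 * wc u.
have dN : ev z (fun u => cderiv N u 0).
  apply: evW (evI Hv (evI (evI Ec Hw) DD)) => u [[_ O1 Q1 v0] [[Eu wu] [h1 h2 h3 [k1 k2 k3]]]].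
  have K := cderivB (cderivM (cderivB (cderivM k2 h1) (cderivM k1 h2)) (cderivV v0 h1)) (cderivZ g2 wu).
  apply: cderiv_eq K _; rewrite -Eu /E.
  move: v0; move: (v u) (cDn 1 v u) (cDn 2 v u) (yy u) (cDn 1 yy u) (cDn 2 yy u).
  by move=> x0 x1 x2 y0 y1 y2 x00; field.
pose be := N z; have Nc : ev z (fun u => N u = be) := ev_const dN.
(* The Taylor coefficient of order two: [g2] is the constant second derivative of yy / v with
   respect to [wc]. *)
pose ga := g2 / 2.
pose A u := yy u / v u - be * wc u - ga * wc u ^+ 2.
have dA : ev z (fun u => cderiv A u 0).
  apply: evW (evI Hv (evI (evI Nc Hw) DD)) => u [[_ O1 Q1 v0] [[Nu wu] [h1 h2 h3 [k1 k2 k3]]]].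
  have K := cderivB (cderivB (cderivM k1 (cderivV v0 h1)) (cderivZ be wu)) (cderivZ ga (cderivX 2 wu)).
  apply: cderiv_eq K _; rewrite -Nu /N /ga /= expr1.
  move: v0; move: (v u) (cDn 1 v u) (yy u) (cDn 1 yy u) (wc u) (g2).
  by move=> x0 x1 y0 y1 ww gg x00; field.
pose al := A z; have Ac : ev z (fun u => A u = al) := ev_const dA.
exists al, be, ga; split.
  have [_ _ Q1 v0] := ev_self Hv; have [_ _ Q2] := ev_self Hy.
  have : 4 * al * ga - be ^+ 2 = ((v z) ^+ 2 * disc3 B yy z - yy z ^+ 2 * disc3 B v z) / v z ^+ 2.
    rewrite /al /be /A -/be /be /N /ga /g2 /E /disc3.
    move: v0; move: (v z) (cDn 1 v z) (cDn 2 v z) (yy z) (cDn 1 yy z) (cDn 2 yy z) (wc z) (B z).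
    by move=> x0 x1 x2 y0 y1 y2 ww bb x00; field.
  by rewrite Q1 Q2 !mulr0 subrr mul0r => /eqP; rewrite subr_eq0 => /eqP.
apply: evW (evI Hv Ac) => u [[_ _ _ v0] <-]; rewrite /A.
by move: v0; move: (v u) (yy u) (wc u) => x0 y0 ww x00; field.
Qed.

(** A double root gives yy = v * ga * (wc + k)^2, so d rho / d wc = 1 / (ga (wc + k)^2) and rho is a
    constant minus 1 / (ga (wc + k)). For ga = 0 the polynomial is constant and rho is affine in
    [wc]. *)
Lemma moebius_of_square (v yy wc rho : R[i] -> R[i]) al be ga z : be ^+ 2 = 4 * al * ga ->
  ev z (fun u => yy u = v u * (al + be * wc u + ga * wc u ^+ 2)) ->
  ev z (fun u => [/\ v u != 0, yy u != 0, cderiv wc u (v u)^-1 & cderiv rho u (yy u)^-1]) ->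
  exists2 A : 'M[R[i]]_2, \det A = 1 &
    ev z (fun u => A 1 0 * wc u + A 1 1 != 0 /\ rho u * (A 1 0 * wc u + A 1 1) = A 0 0 * wc u + A 0 1).
Proof.
move=> disc E H.
have [ga0|ga0] := eqVneq ga 0.
  have be0 : be = 0 by apply/eqP; move/eqP: disc; rewrite ga0 mulr0 sqrf_eq0.
  have yE : ev z (fun u => yy u = v u * al).
    by apply: evW E => u ->; rewrite be0 ga0 !mul0r !addr0.
  have al0 : al != 0.
    by have := ev_self yE; have [_ y0 _ _] := ev_self H => yz; apply: contraNneq y0 => a0; rewrite yz a0 mulr0.
  pose K u := rho u - al^-1 * wc u.
  have dK : ev z (fun u => cderiv K u 0).
    apply: evW (evI yE H) => u [yu [v0 y0 wu ru]].
    have := cderivB ru (cderivZ al^-1 wu) => X; apply: cderiv_eq X _.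
    by rewrite yu invfM mulrC subrr.
  have [|A A1 HA] := @moebius_normalize R al^-1 (K z) 0 1.
    by rewrite mulr1 mulr0 subr0 invr_eq0.
  exists A => //; apply: evW (ev_const dK) => u Ku; apply: HA; first by rewrite mul0r add0r oner_neq0.
  by rewrite mul0r add0r mulr1 -Ku /K addrC subrK.
pose k := be / (2 * ga).
have qE x : al + be * x + ga * x ^+ 2 = ga * (x + k) ^+ 2.
  have -> : al = be ^+ 2 / (4 * ga) by rewrite disc; field.
  by rewrite /k; field.
have n0 : ev z (fun u => wc u + k != 0).
  apply: evW (evI E H) => u [yu [_ y0 _ _]]; apply: contraNneq y0 => w0.
  by rewrite yu qE w0 expr0n /= !mulr0.
pose K u := rho u + (ga * (wc u + k))^-1.
have dK : ev z (fun u => cderiv K u 0).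
  apply: evW (evI (evI E n0) H) => u [[yu w0] [v0 y0 wu ru]].
  have gw : ga * (wc u + k) != 0 by rewrite mulf_neq0.
  have := cderivD ru (@cderivV R (fun x => ga * (wc x + k)) u _ gw (cderivZ ga (cderivD wu (cderiv_cst k u)))).
  move=> X; apply: cderiv_eq X _; rewrite yu qE addr0.
  by move: v0 w0; move: (v u) (wc u + k) => x0 x1 h0 h1; field; rewrite ?h1 ?h0 ?ga0.
have [|A A1 HA] := @moebius_normalize R (K z * ga) (K z * (ga * k) - 1) ga (ga * k).
  by rewrite (_ : _ - _ = ga)//; ring.
exists A => //; apply: evW (evI (ev_const dK) n0) => u [Ku w0].
have gw : ga * (wc u + k) != 0 by rewrite mulf_neq0.
apply: HA; first by rewrite -mulrDr.
rewrite -Ku /K -mulrDr; move: w0 gw; move: (wc u) (rho u) => x0 x1 w0 gw.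
by field; rewrite ?w0 ?ga0.
Qed.

End IsotropicCoordinate.

Section LocalTheorem.
Variable R : realType.
Implicit Types (e r : R) (p z a b c x y : R[i]) (f g h F : R[i] -> R[i]).
Variables (G : (R[i] -> R[i]) -> R[i] -> Prop).
Hypothesis G_diff : forall g z, G g z -> ev z (cdiff g).
Hypothesis G_neq0 : forall g z, G g z -> cD g z != 0.

Lemma moebius_three (w : 'I_3 -> R[i] -> R[i]) c r : 0 < r ->
  (forall i y, nm (y - c) < r -> cdiff (w i) y) -> indep w c r -> invariant_family G w c r ->
  (forall y, nm (y - c) < r -> wron w y != 0 /\ cD (wron w) y = 0) -> moebius_coord G c r.
Proof.
move=> r0 dw iw winv Wnz.
have [B [D [dBD ode]]] := exists_ode3 dw Wnz.
pose Rf u := 2 * D u - cD B u.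
have dRf y : nm (y - c) < r -> cdiff Rf y.
  move=> yr; apply: cdiffB; first exact: cdiffM (cdiff_cst _ _) (dBD y yr).2.
  by apply: cdiff_cD; apply: evW (ev_ball_open yr) => u /dBD[].
have [[c1 [c1r R1]]|H] := pselect (exists c1, nm (c1 - c) < r /\ Rf c1 != 0).
  apply: (form_coord G_diff G_neq0 (n := 2) r0 dRf c1r R1) => g z Gg zr gr.
  exact: (cubic_form G_diff G_neq0 dw winv Wnz dBD ode Gg zr gr).
have Rf0 y : nm (y - c) < r -> Rf y = 0.
  by move=> yr; apply/eqP; apply: contrapT => /negP Ry; apply: H; exists y.
have [al [[j alj] Q0]] := isotropic r0 dw B.
pose v u := \sum_j al j * w j u.
have Ov y : nm (y - c) < r -> ev y (fun u => cdiff v u /\ ode3 B D v u).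
  by move=> yr; apply: (ode3_lin dw ode (al := al) yr); apply: ev_all.
have Qv y : nm (y - c) < r -> disc3 B v y = 0.
  move=> yr; rewrite -Q0; apply: (@cderiv0_const R (disc3 B v) c r) => //; last by rewrite subrr nm0.
  by move=> u ur; exact: ev_self (disc3_const dBD Rf0 ur (Ov u ur)).
have [c1 c1r v1] : exists2 c1, nm (c1 - c) < r & v c1 != 0.
  apply: contrapT => H'; move: alj; rewrite (iw c r (subball_refl c r0) al) ?eqxx// => y yr.
  by apply/eqP; apply: contrapT => /negP vy; apply: H'; exists y.
have dv y : nm (y - c) < r -> cdiff v y by move=> /Ov/ev_self[].
have [r1 [S1 v0]] := ev_subball c1r (ccont_neq0 (cdiff_cont (dv _ c1r)) v1).
have [wc Hw] : exists wc : R[i] -> R[i], ev c1 (fun z => cderiv wc z (v z)^-1).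
  apply: primitive; exists r1; first by case: S1.
  by move=> y yr; apply: cdiffV (v0 y yr) (dv y (S1.2 _ yr)).
have c11 : nm (c1 - c1) < r1 by rewrite subrr nm0; case: S1.
have [r2 [S2 H2]] := ev_subball c11 Hw.
have S := subball_trans S1 S2.
exists c1, r2, wc; split=> //.
  move=> y yr; split; first exact: cderiv_diff (H2 y yr).
  by rewrite (cderiv_cD (H2 y yr)) invr_eq0 v0//; exact: S2.2.
move=> g z Gg zr gr.
have zc := S.2 _ zr; have gc := S.2 _ gr.
have [A HA] := winv g z Gg zc gc.
have GE := G_ev G_diff G_neq0 Gg; have Bl := G_ball G_diff Gg zr gr.
(* [wc] o [g] is a primitive of 1 / y. Since [y] is again an isotropic member of the span,
   [quad_in_coord] and [moebius_of_square] apply to it. *)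
pose y u := (cD g u)^-1 * v (g u).
have yE : ev z (fun u => \sum_l (\sum_j al j * A j l) * w l u = y u).
  apply: evW (evI HA GE) => u [Eu [_ [_ g0]]]; rewrite /y /v.
  under [in RHS]eq_bigr do rewrite Eu mulrCA.
  rewrite -mulr_sumr mulKf//.
  under [in RHS]eq_bigr do rewrite mulr_sumr.
  rewrite exchange_big /=; apply: eq_bigr => l _; rewrite mulr_suml.
  by apply: eq_bigr => j' _; rewrite mulrA.
have Oy := ode3_lin dw ode zc yE.
have dvg : ev z (fun u => ev (g u) (cdiff v)).
  by apply: evW Bl => u [_ /S.2 u2]; apply: evW (Ov _ u2) => x [].
have Hv : ev z (fun u => [/\ cdiff v u, ode3 B D v u, disc3 B v u = 0 & v u != 0]).
  apply: evW (evI (Ov z zc) Bl) => u [[h1 h2] [u1 _]]; split=> //; first exact: Qv (S.2 _ u1).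
  exact: v0 (S2.2 _ u1).
have Hy : ev z (fun u => [/\ cdiff y u, ode3 B D y u & disc3 B y u = 0]).
  have /= T := ode3_transform G_diff G_neq0 dw winv Wnz ode Gg zc gc.
  have /= PD := pull_derivatives GE dvg.
  apply: evW (evI (evI Oy Bl) (evI GE (evI T PD))) => u [[[h1 h2] [_ u2]] [[_ [_ g0]] [[T1 _] [_ _ E1 E2 _]]]].
  split=> //; have := Qv _ (S.2 _ u2); rewrite /disc3 T1.
  have hE : v (g u) = cD g u * y u by rewrite /y mulVKf.
  move: E1 E2; rewrite -/(y u) hE -/y.
  set s := fun u => cD (cD g) u / cD g u.
  rewrite -/(s u) -/(cD s u).
  move: (y u) (cDn 1 y u) (cDn 2 y u) (cDn 1 v (g u)) (cDn 2 v (g u)) (B (g u)) (s u) (cD s u) (cD g u) g0.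
  move=> y0 y1 y2 v1' v2' bg s0 s1 q q0 E1 E2 Q.
  have v1E : v1' = y1 + s0 * y0 by rewrite E1; ring.
  rewrite -[RHS]Q E2 v1E; ring.
have Hr : ev z (fun u => [/\ v u != 0, y u != 0, cderiv wc u (v u)^-1 & cderiv (fun u => wc (g u)) u (y u)^-1]).
  apply: evW (evI (evI Hv Bl) GE) => u [[[_ _ _ vu] [u1 u2]] [dg [_ g0]]].
  have vg : v (g u) != 0 by apply: v0; exact: S2.2.
  split=> //; [by rewrite mulf_neq0 ?invr_eq0|exact: H2|].
  by apply: cderiv_eq (cderiv_comp (H2 _ u2) (cdiffP dg)) _; rewrite /y invfM invrK mulrC.
have Hw' : ev z (fun u => cderiv wc u (v u)^-1) by apply: evW Hr => u [].
have [a [b [g' [disc E]]]] := quad_in_coord Hv Hy Hw'.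
exact: (moebius_of_square disc E Hr).
Qed.

Theorem local_moebius n (v : 'I_n -> R[i] -> R[i]) c r : 0 < r ->
  (forall i y, nm (y - c) < r -> cdiff (v i) y) ->
  (forall y, nm (y - c) < r -> exists i, v i y != 0) -> invariant_family G v c r ->
  moebius_coord G c r.
Proof.
move=> r0 dv vnz vinv.
have [//|[c' [r' [w [S dw iw winv Wnz]]]]] := wronskian_dichotomy G_diff G_neq0 r0 dv vnz vinv.
have r'0 : 0 < r' by case: S.
exact: moebius_coord_sub S (moebius_three r'0 dw iw winv Wnz).
Qed.

End LocalTheorem.

(** * Lie groups and coset spaces *)

Section DifferentialFacts.
Variables (K : numFieldType).

Lemma diff_near (V W : normedModType K) (f g : V -> W) (x : V) :
  (\forall y \near x, f y = g y) -> differentiable f x ->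
  differentiable g x /\ 'd g x = 'd f x :> (V -> W).
Proof.
move=> fg df; have gfx : f x = g x := nbhs_singleton fg.
have E : g \o shift x = cst (g x) + 'd f x +o_ 0 id.
  apply/eqaddoP => e e0; have /eqaddoP/(_ e e0) := diff_locally df.
  have fg0 : \forall y \near 0, f (y + x) = g (y + x).
    by move: fg; rewrite (near_shift 0 x); apply: filterS => y /=; rewrite subr0.
  apply: filter_app; apply: filterS fg0 => y fgy.
  have -> // : (g \o shift x - (cst (g x) + 'd f x)) y = (f \o shift x - (cst (f x) + 'd f x)) y.
  by rewrite !fctE /= fgy gfx.
have dE : 'd g x = 'd f x :> (V -> W) by exact: diff_unique (diff_continuous df) E.
by split=> //; apply/diff_locallyP; rewrite dE; split=> //; exact: diff_continuous.
Qed.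

Lemma diff_factor (V U W : normedModType K) (f : V -> W) (g : U -> W) (h : V -> U) (x : V) :
  (\forall y \near x, g (h y) = f y) -> differentiable g (h x) -> differentiable h x ->
  differentiable f x /\ forall v, 'd f x v = 'd g (h x) ('d h x v).
Proof.
move=> E dg dh; have dgh : differentiable (g \o h) x by exact: differentiable_comp.
have [df ->] := diff_near E dgh; split=> // v.
by rewrite diff_comp.
Qed.

Lemma differentiable_affine (V : normedModType K) (a u : V) (t : K^o) :
  differentiable (fun s : K^o => u + s *: a) t /\
  forall h, 'd (fun s : K^o => u + s *: a) t h = h *: a.
Proof.
have dl : is_diff t (fun s : K^o => s *: a) (fun s => s *: a).
  exact: is_diff_scalel.
have := is_diffD (is_diff_cst u t) dl => D.
have -> : (fun s : K^o => u + s *: a) = cst u + (fun s : K^o => s *: a) by [].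
split; first exact: ex_diff.
by move=> h; rewrite diff_val /= fctE add0r.
Qed.

End DifferentialFacts.

(** * From the differentials of normed modules to complex derivatives *)

Section ComplexBridge.
Variable R : realType.
Implicit Types (z w : R[i]).

Lemma nmE z : `|z| = (nm z)%:C%C.
Proof. by case: z. Qed.

(** The radii of the balls of [Cplx R] are positive elements of R[i], and these are real. *)
Lemma nearC_ev (z : Cplx R) (P : R[i] -> Prop) : (\forall w \near z, P w) <-> ev z P.
Proof.
split=> [/nbhs_normP[e /= e0 H]|[d d0 H]].
  have := e0; rewrite /= => e0'.
  have eE : e = (complex.Re e)%:C%C.
    by case: e e0' {e0 H} => a b; rewrite ltcE /= => /andP[/eqP -> _].
  exists (complex.Re e); first by move: e0'; rewrite eE ltcR.
  by move=> w wz; apply: H => /=; rewrite -[z - w]/((z : R[i]) - w) nmE nmC eE ltcR.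
apply/nbhs_normP; exists (d%:C%C) => /=; first by rewrite ltcR.
by move=> w /=; rewrite -[z - w]/((z : R[i]) - w) nmE nmC ltcR; exact: H.
Qed.

Lemma differentiable_cderiv (f : Cplx R -> Cplx R) (z : Cplx R) : differentiable f z ->
  cderiv f z ('d f z 1).
Proof.
move=> df e e0; have e0' : 0 < e%:C%C :> R[i] by rewrite ltcR.
have /eqaddoP/(_ _ e0') := diff_locally df.
move=> /nearC_ev[d d0 H]; exists d => // w wz.
have := H (w - z); rewrite subr0 => /(_ wz).
rewrite !fctE /= subrK.
have -> : 'd f z (w - z) = 'd f z 1 * (w - z) :> R[i].
  by rewrite -[w - z in LHS]mulr1 -[_ * 1]/((w - z : R[i]) *: (1 : Cplx R)) linearZ /= mulrC.
rewrite opprD addrA.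
have K (a b : R[i]) : `|a| <= e%:C%C * `|b| -> nm a <= e * nm b.
  by rewrite !nmE -rmorphM lecR.
exact: K.
Qed.

Lemma cderiv_differentiable (f : Cplx R -> Cplx R) (z : Cplx R) (l : R[i]) : cderiv f z l ->
  differentiable f z.
Proof.
move=> H; apply/derivable1_diffP; apply/cvg_ex; exists (l : Cplx R).
apply/cvgrPdist_le => e e0.
have eE : e = (complex.Re e)%:C%C.
  by case: e e0 => a b; rewrite ltcE /= => /andP[/eqP -> _].
have e0' : 0 < complex.Re e by move: e0; rewrite eE ltcR.
have [d d0 D] := H _ e0'.
have : \forall h \near (0 : Cplx R), nm (h - 0 : R[i]) < d by apply/nearC_ev; exists d.
rewrite near_withinE; apply: filterS => h; rewrite subr0 => hd h0.
rewrite [h *: 1]mulr1 /=.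
have := D (h + z); rewrite addrK => /(_ hd) {}D.
rewrite [X in X <= _](nmE _) eE lecR -(ler_pM2r (_ : 0 < nm h)) ?nm_gt0// -nmM.
have -> : (l - h^-1 *: (f (h + z) - f z)) * h = - (f (h + z) - f z - l * h) :> R[i].
  by rewrite mulrBl -[_ *: _]/(_ * _) [_ * _ * h]mulrAC (mulVf h0) mul1r [RHS]opprB.
by rewrite nmN.
Qed.

Lemma diff_cD (f : Cplx R -> Cplx R) (z w : Cplx R) : differentiable f z -> 'd f z w = cD f z * w.
Proof.
move=> df; rewrite (cderiv_cD (differentiable_cderiv df)) mulrC.
by rewrite -[in LHS](mulr1 w) -[w * 1]/(w *: (1 : Cplx R)) linearZ.
Qed.

Lemma differentiable_cdiff (f : Cplx R -> Cplx R) (z : Cplx R) : differentiable f z <-> cdiff f z.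
Proof.
split=> [/differentiable_cderiv|[l]]; last exact: cderiv_differentiable.
by exists ('d f z 1).
Qed.

Lemma diff_chain (V : normedModType R[i]) (f h : V -> Cplx R) (g : R[i] -> R[i]) (chi : V -> V) x y a :
  (\forall u \near x, g (h (chi u)) = f u) -> cdiff g y -> differentiable h x -> differentiable chi x ->
  chi x = x -> h x = y -> 'd f x a = cD g y * 'd h x ('d chi x a).
Proof.
move=> E gy Dh Dchi chix hx.
have Dh' : differentiable h (chi x) by rewrite chix.
have Dg : differentiable (g : Cplx R -> Cplx R) ((h \o chi) x).
  by rewrite /= chix hx; exact/differentiable_cdiff.
have [_ E1] := @diff_factor _ V (Cplx R) (Cplx R) f g (h \o chi) x E Dg (differentiable_comp Dchi Dh').
have E3 w := @diff_cD g _ w Dg.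
have hx' : (h \o chi) x = y by rewrite /= chix.
have E2 : 'd (h \o chi) x a = 'd h (chi x) ('d chi x a) := congr1 (fun F : V -> Cplx R => F a) (diff_comp Dchi Dh').
refine (etrans (E1 a) (etrans (E3 _) (f_equal2 *%R (congr1 (cD g) hx') (etrans E2 _)))).
exact (congr1 (fun p => 'd h p ('d chi x a)) chix).
Qed.

Lemma cderiv_line (V : normedModType R[i]) (f : V -> Cplx R) (u a : V) (t : R[i]) :
  differentiable f (u + t *: a) ->
  cderiv (fun s : R[i] => f (u + s *: a)) t ('d f (u + t *: a) a).
Proof.
move=> df; have [da dE] := differentiable_affine a u (t : Cplx R).
have dc := differentiable_comp da df.
have := differentiable_cderiv dc; rewrite (diff_comp da df) /= dE.
by rewrite -[1 *: a]/((1 : R[i]) *: a) scale1r.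
Qed.

End ComplexBridge.

Lemma continuous_pairr (X Y : topologicalType) (b : Y) : continuous (fun a : X => (a, b)).
Proof. by move=> a; exact: (cvg_pair cvg_id (cvg_cst b)). Qed.

Lemma continuous_pairl (X Y : topologicalType) (a : X) : continuous (fun b : Y => (a, b)).
Proof. by move=> b; exact: (cvg_pair (cvg_cst a) cvg_id). Qed.

Section Charts.
Variables (X E : topologicalType) (c : chart X E).
Hypothesis cc : is_chart c.

Lemma chart_bwdK x : dom c x -> bwd c (fwd c x) = x.
Proof. by case: cc => _ _ + _ _; apply. Qed.

Lemma chart_near x : dom c x -> \forall u \near fwd c x, dom c (bwd c u) /\ fwd c (bwd c u) = u.
Proof.
case: cc => o1 o2 K _ _ cx.
have : nbhs (fwd c x) (fwd c @` dom c) by apply: open_nbhs_nbhs; split=> //; exists x.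
by apply: filterS => _ [y cy <-]; rewrite K.
Qed.

Lemma chart_near_bwd x (P : X -> Prop) : dom c x -> (\forall y \near x, P y) ->
  \forall u \near fwd c x, P (bwd c u).
Proof.
move=> cx nP; case: cc => _ _ K _ cb.
have cb' := cb (fwd c x) (ex_intro2 _ _ x cx erefl).
by apply: cb'; rewrite K.
Qed.

Lemma chart_near_dom x : dom c x -> \forall y \near x, dom c y.
Proof. by case: cc => o1 _ _ _ _ cx; apply: open_nbhs_nbhs; split. Qed.

Lemma chart_near_fwd x (P : E -> Prop) : dom c x -> (\forall u \near fwd c x, P u) ->
  \forall y \near x, P (fwd c y).
Proof. by case: cc => _ _ _ cf _ cx nP; apply: (cf x cx). Qed.

End Charts.

(* A named normed module, since over R[i] a matrix type by itself carries no canonical topology. *)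
Definition lie_model (R : realType) (G : complexLieGroup R) : normedModType R[i] :=
  'rV[R[i]]_(lie_dim G).

Section LieGroup.
Variables (R : realType) (G : complexLieGroup R).
Implicit Types (x y g h : G).
Notation V := (lie_model G).
Notation lchart := (chart G V).

Lemma lie_chart (e : lchart) : lie_atlas e -> @is_chart G V e.
Proof. by case: (lie_atlasP G) => + _ _; apply. Qed.

Lemma lie_cover x : exists2 e : lchart, lie_atlas e & dom e x.
Proof.
case: (lie_atlasP G) => _ + _ => /(congr1 (fun A => A x)) E.
have : (\bigcup_(c in @lie_atlas R G) dom c) x by rewrite E.
by case=> e Ae ex; exists e.
Qed.

Lemma lie_transition (e e' : lchart) x : lie_atlas e -> lie_atlas e' -> dom e x -> dom e' x ->
  differentiable (fwd e' \o bwd e) (fwd e x).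
Proof.
case: (lie_atlasP G) => _ _ T Ae Ae' ex e'x; apply: (T e e' Ae Ae').
by exists x.
Qed.

Lemma lie_mul_cont x y : {for (x, y), continuous (fun q : G * G => (q.1 * q.2)%g)}.
Proof. by case: (lie_mul (x, y)). Qed.

Lemma lie_mulr_cont x : continuous (fun y : G => (y * x)%g).
Proof. by move=> y; exact: (@continuous_comp _ _ _ (fun a : G => (a, x)) (fun q : G * G => (q.1 * q.2)%g) y (@continuous_pairr G G x y) (@lie_mul_cont y x)). Qed.

Lemma lie_mull_cont x : continuous (fun y : G => (x * y)%g).
Proof. by move=> y; exact: (@continuous_comp _ _ _ (fun b : G => (x, b)) (fun q : G * G => (q.1 * q.2)%g) y (@continuous_pairl G G x y) (@lie_mul_cont x y)). Qed.

(** [holomorphic_at] provides differentiability in one pair of charts; the transition maps carry it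
    over to any other pair. *)
Lemma lie_change_charts (f : G -> G) (c d e e' : lchart) x :
  lie_atlas c -> lie_atlas d -> lie_atlas e -> lie_atlas e' ->
  dom c x -> dom d (f x) -> dom e x -> dom e' (f x) -> {for x, continuous f} ->
  differentiable (fun u => fwd d (f (bwd c u))) (fwd c x) ->
  differentiable (fun u => fwd e' (f (bwd e u))) (fwd e x).
Proof.
move=> Ac Ad Ae Ae' cx dx ex e'x cf D.
have D1 := lie_transition Ae Ac ex cx.
have D2 := lie_transition Ad Ae' dx e'x.
have cK := chart_bwdK (lie_chart Ac) cx; have eK := chart_bwdK (lie_chart Ae) ex.
pose f' : V -> V := fun u => fwd d (f (bwd c u)).
pose g : V -> V := (fwd e' \o bwd d) \o f'.
have D2' : differentiable (fwd e' \o bwd d : V -> V) (f' (fwd c x)) by rewrite /f' cK.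
have Dg : differentiable g (fwd c x) := differentiable_comp D D2'.
have Dg' : differentiable g ((fwd c \o bwd e) (fwd e x)) by rewrite /= eK.
have N : \forall y \near x, dom c y /\ dom d (f y).
  apply: filterI; first exact: (chart_near_dom (lie_chart Ac)).
  by apply: cf; exact: (chart_near_dom (lie_chart Ad)).
refine (diff_factor _ Dg' D1).1.
have := chart_near_bwd (lie_chart Ae) ex N; apply: filterS => u [h1 h2].
by rewrite /g /f' /= (chart_bwdK (lie_chart Ac) h1) (chart_bwdK (lie_chart Ad) h2).
Qed.

Lemma lie_mul_charts x y : exists c1 c2 d : lchart,
  [/\ lie_atlas c1 /\ dom c1 x, lie_atlas c2 /\ dom c2 y, lie_atlas d /\ dom d (x * y)%g &
      differentiable (fun q : V * V => fwd d (bwd c1 q.1 * bwd c2 q.2)%g : V) (fwd c1 x : V, fwd c2 y : V)].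
Proof.
case: (lie_mul (x, y)) => _ [_ [d [[c1 [c2 [A1 A2 ->]]] Ad [/= c1x c2y] dxy D]]].
by exists c1, c2, d; split=> //; exact: D.
Qed.

Lemma lie_mulr_diff (e e' : lchart) h x : lie_atlas e -> lie_atlas e' -> dom e h -> dom e' (h * x)%g ->
  differentiable (fun u => fwd e' (bwd e u * x)%g) (fwd e h).
Proof.
move=> Ae Ae' eh e'x; have [c1 [c2 [d [[A1 c1h] [A2 c2x] [Ad dx] D]]]] := lie_mul_charts h x.
refine (@lie_change_charts (fun y => y * x)%g c1 d e e' h A1 Ad Ae Ae' c1h dx eh e'x (@lie_mulr_cont x h) _).
have D1 : differentiable (fun u : V => (u, fwd c2 x : V)) (fwd c1 h).
  by apply: differentiable_pair; [exact: ex_diff|exact: differentiable_cst].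
have := differentiable_comp D1 D.
suff -> : (fun q : V * V => fwd d (bwd c1 q.1 * bwd c2 q.2)%g : V) \o (fun u : V => (u, fwd c2 x : V)) =
  (fun u => fwd d (bwd c1 u * x)%g) by [].
by apply/funext => u /=; rewrite (chart_bwdK (lie_chart A2) c2x).
Qed.

Lemma lie_mull_diff (e e' : lchart) h x : lie_atlas e -> lie_atlas e' -> dom e h -> dom e' (x * h)%g ->
  differentiable (fun u => fwd e' (x * bwd e u)%g) (fwd e h).
Proof.
move=> Ae Ae' eh e'x; have [c1 [c2 [d [[A1 c1x] [A2 c2h] [Ad dx] D]]]] := lie_mul_charts x h.
refine (@lie_change_charts (fun y => x * y)%g c2 d e e' h A2 Ad Ae Ae' c2h dx eh e'x (@lie_mull_cont x h) _).
have D1 : differentiable (fun u : V => (fwd c1 x : V, u)) (fwd c2 h).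
  by apply: differentiable_pair; [exact: differentiable_cst|exact: ex_diff].
have := differentiable_comp D1 D.
suff -> : (fun q : V * V => fwd d (bwd c1 q.1 * bwd c2 q.2)%g : V) \o (fun u : V => (fwd c1 x : V, u)) =
  (fun u => fwd d (x * bwd c2 u)%g) by [].
by apply/funext => u /=; rewrite (chart_bwdK (lie_chart A1) c1x).
Qed.

End LieGroup.

(** * Topology of the coset space *)

Section Coset.
Variables (R : realType) (G : complexLieGroup R) (H : set G).
Hypothesis H1 : H 1%g.
Hypothesis HM : forall x y, H x -> H y -> H (x * y)%g.
Hypothesis HV : forall x, H x -> H (x^-1)%g.
Implicit Types (x y g h : G) (p q : coset_space H).

Lemma coset_proj_eq x y : coset_proj H x = coset_proj H y <-> H (x^-1 * y)%g.
Proof.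
have -> : (coset_proj H x = coset_proj H y) <-> same_coset H x y.
  by split=> [/eqmodP|E]; [|apply/eqmodP].
split=> [/asboolP E|Hxy].
  have : [set (y * h)%g | h in H] y by exists 1%g => //; rewrite mulg1.
  by rewrite -E => -[h Hh <-]; rewrite mulKg.
apply/asboolP/seteqP; split=> _ [h Hh <-].
  exists ((x^-1 * y)^-1 * h)%g; first exact: HM (HV Hxy) Hh.
  by rewrite invgM invgK mulgA mulgA mulgV mul1g.
exists (x^-1 * y * h)%g; first exact: HM Hxy Hh.
by rewrite !mulgA mulgV mul1g.
Qed.

Lemma coset_projM x h : H h -> coset_proj H (x * h)%g = coset_proj H x.
Proof. by move=> Hh; apply/esym/coset_proj_eq; rewrite mulKg. Qed.

Lemma coset_proj_repr p : coset_proj H (repr p) = p.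
Proof. exact: reprK. Qed.

Lemma left_translation_proj g x : left_translation g (coset_proj H x) = coset_proj H (g * x)%g.
Proof.
rewrite /left_translation; apply/coset_proj_eq.
have /coset_proj_eq : coset_proj H (repr (coset_proj H x)) = coset_proj H x by exact: coset_proj_repr.
by rewrite invgM -mulgA mulKg.
Qed.

Lemma left_translationM g h p : left_translation g (left_translation h p) = left_translation (g * h)%g p.
Proof. by rewrite -(coset_proj_repr p) !left_translation_proj mulgA. Qed.

Lemma left_translation1 p : left_translation 1%g p = p.
Proof. by rewrite -[in LHS](coset_proj_repr p) left_translation_proj mul1g coset_proj_repr. Qed.

Lemma left_translationK g : cancel (@left_translation G H g) (left_translation g^-1%g).
Proof. by move=> p; rewrite left_translationM mulVg left_translation1. Qed.

Lemma left_translationVK g : cancel (@left_translation G H g^-1%g) (left_translation g).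
Proof. by move=> p; rewrite left_translationM mulgV left_translation1. Qed.

Lemma coset_proj_cont : continuous (coset_proj H).
Proof. exact: pi_continuous. Qed.

Lemma coset_proj_open (A : set G) : open A -> open (coset_proj H @` A).
Proof.
move=> oA; suff : open (coset_proj H @^-1` (coset_proj H @` A)) by [].
have -> : coset_proj H @^-1` (coset_proj H @` A) = \bigcup_(h in H) [set y | A (y * h)%g].
  apply/seteqP; split=> y /=.
    by move=> [x Ax /esym/coset_proj_eq Hyx]; exists (y^-1 * x)%g => //=; rewrite mulVKg.
  by move=> [h Hh /= Ah]; exists (y * h)%g => //; exact: coset_projM.
apply: bigcup_open => h Hh; apply: open_comp => // y _; exact: lie_mulr_cont.
Qed.

(** The projection is continuous and open, so properties near a coset can be tested near a
    representative. *)
Lemma coset_near x (P : coset_space H -> Prop) :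
  (\forall y \near x, P (coset_proj H y)) <-> (\forall p \near coset_proj H x, P p).
Proof.
split; last by move=> nP; apply: coset_proj_cont.
rewrite /prop_near1 nbhsE => -[A [oA Ax] AP].
apply: (@filterS _ _ _ (coset_proj H @` A)); first by move=> _ [y Ay <-]; exact: AP.
by apply: open_nbhs_nbhs; split; [exact: coset_proj_open|exists x].
Qed.

Lemma left_translation_cont2 g p :
  {for (g, p), continuous (fun q : G * coset_space H => left_translation q.1 q.2)}.
Proof.
move=> U nU0; have nU : \forall z \near (g * repr p)%g, U (coset_proj H z) by exact/coset_near.
have [[A B] /= [nA nB] AB] := lie_mul_cont nU.
exists (A, [set q | exists2 y, B y & coset_proj H y = q]) => /=.
  split=> //; rewrite -(coset_proj_repr p); apply/coset_near.
  by apply: filterS nB => y By; exists y.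
by move=> [h q] /= [Ah [y By <-]]; rewrite left_translation_proj; exact: (AB (h, y)).
Qed.

Lemma left_translation_cont g : continuous (@left_translation G H g).
Proof. by move=> p; exact: (@continuous_comp _ _ _ (fun p => (g, p)) (fun q : G * coset_space H => left_translation q.1 q.2) p (@continuous_pairl G (coset_space H) g p) (@left_translation_cont2 g p)). Qed.

Lemma left_translation_contl p : continuous (fun g => left_translation g p).
Proof. by move=> g; exact: (@continuous_comp _ _ _ (fun g => (g, p)) (fun q : G * coset_space H => left_translation q.1 q.2) g (@continuous_pairr G (coset_space H) p g) (@left_translation_cont2 g p)). Qed.

End Coset.

Lemma submersive_change (K : numFieldType) (V U W : normedModType K) (f : V -> W) (g : U -> W)
    (h : V -> U) (h' : U -> V) (x : V) :
  (\forall y \near x, g (h y) = f y) -> (\forall u \near h x, f (h' u) = g u) -> h' (h x) = x ->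
  differentiable h x -> differentiable h' (h x) -> submersive_at g (h x) -> submersive_at f x.
Proof.
move=> E E' hK dh dh' [dg gT]; have [df dfE] := diff_factor E dg dh.
have df' : differentiable f (h' (h x)) by rewrite hK.
have [_ dgE] := diff_factor E' df' dh'.
split=> //; apply/seteqP; split=> // w _; have : range ('d g (h x)) w by rewrite gT.
case=> v _ <-; rewrite dgE; move: df' dgE; rewrite hK => _ _.
by exists ('d h' (h x) v).
Qed.

Section CosetCharts.
Variables (R : realType) (G : complexLieGroup R) (H : set G).
Hypothesis H1 : H 1%g.
Hypothesis HM : forall x y, H x -> H y -> H (x * y)%g.
Hypothesis HV : forall x, H x -> H (x^-1)%g.
Implicit Types (x y g h k : G) (p q : coset_space H).
Notation V := (lie_model G).
Notation lchart := (chart G V).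
Notation cchart := (chart (coset_space H) (Cplx R)).
Notation Pi := (coset_proj H).

Lemma coset_chart (c : cchart) : coset_atlas c -> is_chart c.
Proof. by case. Qed.

Lemma coset_lift (c : cchart) (e : lchart) x : coset_atlas c -> lie_atlas e -> dom e x -> dom c (Pi x) ->
  submersive_at (fun u : V => fwd c (Pi (bwd e u))) (fwd e x).
Proof.
move=> [cc /(_ x) S] Ae ex cx.
have [e0 [Ae0 e0x S0]] : exists e0 : lchart,
  [/\ lie_atlas e0, dom e0 x & submersive_at (fwd c \o Pi \o bwd e0 : V -> _) (fwd e0 x)] := S cx.
have eK := chart_bwdK (lie_chart Ae) ex; have e0K := chart_bwdK (lie_chart Ae0) e0x.
have S0' : submersive_at (fun u : V => fwd c (Pi (bwd e0 u))) ((fwd e0 \o bwd e) (fwd e x)).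
  by rewrite /= eK; exact: S0.
have T' : differentiable (fwd e \o bwd e0) ((fwd e0 \o bwd e) (fwd e x)).
  by rewrite /= eK; exact: lie_transition.
refine (submersive_change _ _ _ (lie_transition Ae Ae0 ex e0x) T' S0').
- have N := chart_near_bwd (lie_chart Ae) ex (chart_near_dom (lie_chart Ae0) e0x).
  by apply: filterS N => u h1 /=; rewrite (chart_bwdK (lie_chart Ae0) h1).
- have N := chart_near_bwd (lie_chart Ae0) e0x (chart_near_dom (lie_chart Ae) ex).
  by rewrite /= eK; apply: filterS N => u h1 /=; rewrite (chart_bwdK (lie_chart Ae) h1).
- by rewrite /= eK e0K.
Qed.

Definition translate_chart k (c : cchart) : cchart :=
  Chart [set p | dom c (left_translation k p)] (fwd c \o left_translation k)
        (left_translation k^-1%g \o bwd c).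

Lemma translate_chart_image k c : fwd (translate_chart k c) @` dom (translate_chart k c) = fwd c @` dom c.
Proof.
apply/seteqP; split=> _ [p cp <-]; first by exists (left_translation k p).
by exists (left_translation k^-1%g p); rewrite /= left_translationVK.
Qed.

Lemma translate_is_chart k c : is_chart c -> is_chart (translate_chart k c).
Proof.
case=> o1 o2 K cf cb; split.
- by apply: open_comp => // p _; exact: left_translation_cont.
- by rewrite translate_chart_image.
- by move=> p cp /=; rewrite K // left_translationK.
- by move=> p cp; apply: continuous_comp; [exact: left_translation_cont|exact: cf].
- rewrite translate_chart_image => u cu.
  by apply: continuous_comp; [exact: cb|exact: left_translation_cont].
Qed.

Lemma translate_coset_atlas k c : coset_atlas c -> coset_atlas (translate_chart k c).
Proof.
move=> Ac; split; first exact/translate_is_chart/coset_chart.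
move=> x /=; rewrite left_translation_proj // => cx.
have [e Ae ex] := lie_cover x; have [e' Ae' e'x] := lie_cover (k * x)%g.
exists e; split=> //; have S := coset_lift Ac Ae' e'x cx.
have eK := chart_bwdK (lie_chart Ae) ex; have e'K := chart_bwdK (lie_chart Ae') e'x.
pose h (u : V) : V := fwd e' (k * bwd e u)%g.
pose h' (u : V) : V := fwd e (k^-1 * bwd e' u)%g.
have hx : h (fwd e x) = fwd e' (k * x)%g by rewrite /h eK.
have S' : submersive_at (fun u : V => fwd c (Pi (bwd e' u))) (h (fwd e x)) by rewrite hx.
have D : differentiable h (fwd e x) by exact: lie_mull_diff.
have D' : differentiable h' (h (fwd e x)) by rewrite hx; apply: lie_mull_diff; rewrite ?mulKg.
refine (submersive_change _ _ _ D D' S').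
- have N : \forall y \near x, dom e' (k * y)%g.
    by apply: lie_mull_cont; exact: (chart_near_dom (lie_chart Ae') e'x).
  apply: filterS (chart_near_bwd (lie_chart Ae) ex N) => u h1 /=.
  by rewrite /h left_translation_proj // (chart_bwdK (lie_chart Ae') h1).
- have N : \forall y \near (k * x)%g, dom e (k^-1 * y)%g.
    by apply: lie_mull_cont; rewrite mulKg; exact: (chart_near_dom (lie_chart Ae) ex).
  rewrite hx; apply: filterS (chart_near_bwd (lie_chart Ae') e'x N) => u h1 /=.
  by rewrite /h' (chart_bwdK (lie_chart Ae) h1) left_translation_proj // mulVKg.
- by rewrite hx /h' e'K mulKg.
Qed.

Lemma submersive_vector (U : normedModType R[i]) (f : U -> Cplx R) u : submersive_at f u ->
  exists v, 'd f u v = 1.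
Proof. by case=> _ fT; have : range ('d f u) 1 by [rewrite fT]; case=> v _ E; exists v. Qed.

Lemma ev_line (P : V -> Prop) (u v : V) : (\forall w \near u, P w) -> ev (0 : R[i]) (fun t => P (u + t *: v)).
Proof.
move=> nP; apply/nearC_ev.
have C : {for (0 : Cplx R), continuous (fun t : Cplx R => u + t *: v)}.
  exact: differentiable_continuous (differentiable_affine v u (0 : Cplx R)).1.
by apply: C; rewrite -[0 *: v]/((0 : R[i]) *: v) scale0r addr0.
Qed.

(** In a chart of G, a line along which the submersion given by [c] has derivative 1 acts as a local
    section. Its image in [c] is locally invertible by [inverse_function], and the transition map is
    the image in [d] composed with this inverse. *)
Lemma coset_transition (c d : cchart) p : coset_atlas c -> coset_atlas d -> dom c p -> dom d p ->
  cdiff (fun z => fwd d (bwd c z)) (fwd c p).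
Proof.
move=> Ac Ad; rewrite -(coset_proj_repr p); move: (repr p) => x cx dx.
have [e Ae ex] := lie_cover x; have lc := lie_chart Ae.
have [v dv] := submersive_vector (coset_lift Ac Ae ex cx).
pose u : V := fwd e x.
pose P t := fwd c (Pi (bwd e (u + t *: v))) : R[i].
pose Q t := fwd d (Pi (bwd e (u + t *: v))) : R[i].
have uE : u + (0 : R[i]) *: v = u by rewrite scale0r addr0.
have N : \forall w \near u, [/\ dom e (bwd e w), fwd e (bwd e w) = w, dom c (Pi (bwd e w)) & dom d (Pi (bwd e w))].
  have n1 := chart_near lc ex.
  have n2 : \forall y \near x, dom c (Pi y) /\ dom d (Pi y).
    apply/(@coset_near _ G H H1 HM HV x (fun q => dom c q /\ dom d q)).
    exact: (filterI (chart_near_dom (coset_chart Ac) cx) (chart_near_dom (coset_chart Ad) dx)).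
  by apply: filterS (filterI n1 (chart_near_bwd lc ex n2)) => w [[h1 h2] [h3 h4]]; split.
have [r0 r00 B] := ev_line v N.
have B' t : nm (t - 0) < r0 -> [/\ dom c (Pi (bwd e (u + t *: v))), cdiff P t & cdiff Q t].
  move=> /B[h1 h2 h3 h4]; split=> //.
    have [+ _] := coset_lift Ac Ae h1 h3; rewrite h2 => /cderiv_line D.
    by exists ('d (fun u0 : V => fwd c (Pi (bwd e u0))) (u + t *: v) v).
  have [+ _] := coset_lift Ad Ae h1 h4; rewrite h2 => /cderiv_line D.
  by exists ('d (fun u0 : V => fwd d (Pi (bwd e u0))) (u + t *: v) v).
have P0 : P 0 = fwd c (Pi x) by rewrite /P uE (chart_bwdK lc ex).
have dP : cD P 0 != 0.
  have [+ _] := coset_lift Ac Ae ex cx; rewrite -/u -uE => /cderiv_line; rewrite uE dv.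
  by move=> /cderiv_cD ->; exact: oner_neq0.
have dPB t : nm (t - 0) < r0 -> cdiff P t by case/B'.
have [r [rho [sg [/andP[r0' rr0] rho0 S inj _]]]] := inverse_function r00 dPB dP.
have bP : nm (P 0 - P 0) < rho by rewrite subrr nm0.
have s0 : sg (P 0) = 0.
  have [a b _] := S (P 0) bP.
  by apply: inj; rewrite // subrr nm0.
rewrite -P0; apply: (@cdiff_ext _ (fun z => Q (sg z))).
  exists rho => // w /S[a b _]; rewrite -[in RHS]b /P.
  have [h1 _ _] := B' _ (lt_le_trans a rr0).
  by rewrite (chart_bwdK (coset_chart Ac) h1).
have Dsg : cdiff sg (P 0) by have [_ _ D] := S _ bP; exists (cD P (sg (P 0)))^-1.
have DQ : cdiff Q (sg (P 0)) by rewrite s0; case: (B' 0) => //; rewrite subrr nm0.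
exact: (cdiff_comp DQ Dsg).
Qed.

End CosetCharts.

(** * The pseudogroup of a coset chart *)

Section OrbitFamily.
Variables (R : realType) (G : complexLieGroup R) (H : set G).
Hypothesis H1 : H 1%g.
Hypothesis HM : forall x y, H x -> H y -> H (x * y)%g.
Hypothesis HV : forall x, H x -> H (x^-1)%g.
Notation V := (lie_model G).
Notation lchart := (chart G V).
Notation cchart := (chart (coset_space H) (Cplx R)).
Notation Pi := (coset_proj H).
Variable c : cchart.
Hypothesis Ac : coset_atlas c.
Let cc := coset_chart Ac.
Implicit Types (x g k : G) (p q : coset_space H) (z : R[i]).

Definition coset_trans k z : R[i] := fwd c (left_translation k (bwd c z)).

Definition coset_pseudogroup (f : R[i] -> R[i]) z :=
  (fwd c @` dom c) z /\ exists k, f = coset_trans k /\ dom c (left_translation k (bwd c z)).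

Lemma coset_range_open z : (fwd c @` dom c) z -> ev z (fwd c @` dom c).
Proof.
by case: cc => _ o2 _ _ _ Zz; apply/(nearC_ev z (fwd c @` dom c)); apply: open_nbhs_nbhs; split.
Qed.

Lemma coset_bwdP z : (fwd c @` dom c) z -> dom c (bwd c z) /\ fwd c (bwd c z) = z.
Proof. by move=> [p cp <-]; rewrite (chart_bwdK cc cp). Qed.

Lemma coset_pseudogroup_ev k z : (fwd c @` dom c) z -> dom c (left_translation k (bwd c z)) ->
  ev z (fun y => (fwd c @` dom c) y /\ dom c (left_translation k (bwd c y))).
Proof.
move=> Zz kz; apply: evI; first exact: coset_range_open.
have [cz zE] := coset_bwdP Zz.
rewrite -zE; apply/nearC_ev.
apply: (chart_near_bwd cc cz (P := fun p => dom c (left_translation k p))).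
exact: (@left_translation_cont _ G H H1 HM HV k (bwd c z) _ (chart_near_dom cc kz)).
Qed.

Lemma coset_trans_cdiff k z : (fwd c @` dom c) z -> dom c (left_translation k (bwd c z)) ->
  cdiff (coset_trans k) z.
Proof.
move=> Zz kz; have [cz zE] := coset_bwdP Zz.
have := coset_transition H1 HM HV Ac (translate_coset_atlas H1 HM HV k Ac) cz kz.
by rewrite zE.
Qed.

Lemma coset_transK k z : (fwd c @` dom c) z -> dom c (left_translation k (bwd c z)) ->
  coset_trans k^-1%g (coset_trans k z) = z.
Proof.
move=> Zz kz; have [cz zE] := coset_bwdP Zz.
by rewrite /coset_trans (chart_bwdK cc kz) left_translationK.
Qed.

Lemma coset_pseudogroup_diff f z : coset_pseudogroup f z -> ev z (cdiff f).
Proof.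
move=> [Zz [k [-> kz]]]; apply: evW (coset_pseudogroup_ev Zz kz) => y [Zy ky].
exact: coset_trans_cdiff.
Qed.

Lemma coset_pseudogroup_neq0 f z : coset_pseudogroup f z -> cD f z != 0.
Proof.
move=> [Zz [k [-> kz]]]; have [cz zE] := coset_bwdP Zz.
have D := cdiffP (coset_trans_cdiff Zz kz).
have Z' : (fwd c @` dom c) (coset_trans k z) by exists (left_translation k (bwd c z)).
have k' : dom c (left_translation k^-1%g (bwd c (coset_trans k z))).
  by rewrite /coset_trans (chart_bwdK cc kz) left_translationK.
have D' := cdiffP (coset_trans_cdiff Z' k').
have E : cderiv (fun y => y) z (cD (coset_trans k^-1%g) (coset_trans k z) * cD (coset_trans k) z).
  apply: cderiv_ext (cderiv_comp D' D).
  by apply: evW (coset_pseudogroup_ev Zz kz) => y [Zy ky]; exact: coset_transK.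
apply/eqP => D0; move: E; rewrite D0 mulr0 => /cderiv_unique/(_ (cderiv_id z))/esym/eqP.
by rewrite oner_eq0.
Qed.

Definition orbit_map (e : lchart) p (u : V) : Cplx R := fwd c (left_translation (bwd e u) p).

(* On a point [Pi x] the orbit map is a chart of [G/H] after right multiplication by [x]. *)
Lemma orbit_submersive (e : lchart) g p : lie_atlas e -> dom e g -> dom c (left_translation g p) ->
  submersive_at (orbit_map e p) (fwd e g).
Proof.
rewrite -(coset_proj_repr p); move: (repr p) => x Ae eg; rewrite left_translation_proj // => cx.
have [e' Ae' e'x] := lie_cover (g * x)%g.
have eK := chart_bwdK (lie_chart Ae) eg; have e'K := chart_bwdK (lie_chart Ae') e'x.
pose h (u : V) : V := fwd e' (bwd e u * x)%g.
pose h' (u : V) : V := fwd e (bwd e' u * x^-1)%g.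
have hx : h (fwd e g) = fwd e' (g * x)%g by rewrite /h eK.
have S' : submersive_at (fun u : V => fwd c (Pi (bwd e' u))) (h (fwd e g)).
  by rewrite hx; exact: coset_lift.
have D : differentiable h (fwd e g) by exact: lie_mulr_diff.
have D' : differentiable h' (h (fwd e g)) by rewrite hx; apply: lie_mulr_diff; rewrite ?mulgK.
refine (submersive_change _ _ _ D D' S').
- have N : \forall y \near g, dom e' (y * x)%g.
    by apply: lie_mulr_cont; exact: (chart_near_dom (lie_chart Ae') e'x).
  apply: filterS (chart_near_bwd (lie_chart Ae) eg N) => u h1 /=.
  by rewrite /h /orbit_map left_translation_proj // (chart_bwdK (lie_chart Ae') h1).
- have N : \forall y \near (g * x)%g, dom e (y * x^-1)%g.
    by apply: lie_mulr_cont; rewrite mulgK; exact: (chart_near_dom (lie_chart Ae) eg).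
  rewrite hx; apply: filterS (chart_near_bwd (lie_chart Ae') e'x N) => u h1 /=.
  by rewrite /orbit_map /h' (chart_bwdK (lie_chart Ae) h1) left_translation_proj // mulgVK.
- by rewrite hx /h' e'K mulgK.
Qed.

Variable e : lchart.
Hypothesis Ae : lie_atlas e.
Hypothesis e1 : dom e 1%g.
Let ec := lie_chart Ae.
Let o : V := fwd e 1%g.

(** The coefficient, in the coordinate of [c], of the fundamental vector field of the tangent vector
    [a] at 1. A line in the chart [e] stands for the one-parameter subgroup, as both have the same
    velocity at t = 0. *)
Definition orbit_field (a : V) z : R[i] := cD (fun t : R[i] => orbit_map e (bwd c z) (o + t *: a)) 0.

Lemma orbit_fieldE a z : (fwd c @` dom c) z -> orbit_field a z = 'd (orbit_map e (bwd c z)) o a.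
Proof.
move=> Zz; have [cz _] := coset_bwdP Zz.
have oE : o + (0 : R[i]) *: a = o by rewrite scale0r addr0.
have [D _] : submersive_at (orbit_map e (bwd c z)) o.
  by apply: orbit_submersive => //; rewrite left_translation1.
have D' : differentiable (orbit_map e (bwd c z)) (o + (0 : R[i]) *: a) by rewrite oE.
have E := cderiv_cD (cderiv_line D').
rewrite oE in E; exact: E.
Qed.

Lemma orbit_field_near a z0 : (fwd c @` dom c) z0 -> ev z0 (cdiff (orbit_field a)).
Proof.
move=> Zz; have [cz zE] := coset_bwdP Zz.
(* Distance less than 1 from [z0] yields the uniform bound that [param_derivative] asks for; joint
   continuity of the action gives one range of t valid for all z near [z0]. *)
pose P q := dom c q /\ nm ((fwd c q : R[i]) - z0) < 1.
have nP : \forall q \near bwd c z0, P q.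
  have n2 : \forall w \near fwd c (bwd c z0), nm ((w : R[i]) - z0) < 1.
    by rewrite zE; apply/nearC_ev; exists 1.
  exact: (filterI (chart_near_dom cc cz) (chart_near_fwd cc cz n2)).
have := @left_translation_cont2 _ G H H1 HM HV 1%g (bwd c z0) P.
rewrite /= left_translation1 // => /(_ nP)[[A B] /= [nA nB] AB].
have [r1 r10 T] : ev (0 : R[i]) (fun t => [/\ A (bwd e (o + t *: a)), dom e (bwd e (o + t *: a)) &
    fwd e (bwd e (o + t *: a)) = o + t *: a]).
  apply: (@ev_line _ G (fun u => [/\ A (bwd e u), dom e (bwd e u) & fwd e (bwd e u) = u])).
  by apply: filterS (filterI (chart_near_bwd ec e1 nA) (chart_near ec e1)) => u [h1 [h2 h3]]; split.
have [r2 r20 Z] : ev z0 (fun z => (fwd c @` dom c) z /\ B (bwd c z)).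
  apply: evI; first exact: coset_range_open.
  by rewrite -zE; apply/nearC_ev; apply: chart_near_bwd.
have r0 : 0 < Num.min r1 r2 by rewrite lt_min r10 r20.
have M0 : 0 <= nm z0 + 1 by rewrite addr_ge0 ?nm_ge0.
apply: (@param_derivative _ (fun t z => orbit_map e (bwd c z) (o + t *: a)) z0 (Num.min r1 r2) _ r0 M0).
move=> t z; rewrite !lt_min => /andP[tr1 _] /andP[_ zr2].
have [h1 h2 h3] : [/\ A (bwd e (o + t *: a)), dom e (bwd e (o + t *: a)) &
    fwd e (bwd e (o + t *: a)) = o + t *: a] by apply: T; rewrite subr0.
have [h4 h5] := Z z zr2.
have [h6 h7] : P (left_translation (bwd e (o + t *: a)) (bwd c z)).
  exact: (AB (_, _) (conj h1 h5)).
split.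
- rewrite /orbit_map; move: h7; set w := fwd c _ => h7.
  have E : w = z0 + (w - z0) :> R[i] by rewrite addrC subrK.
  have T1 := nmD z0 (w - z0); rewrite -E in T1.
  by apply: le_trans T1 _; rewrite lerD2l; exact: ltW.
- have [+ _] := orbit_submersive Ae h2 h6; rewrite h3 => /cderiv_line; exact: cderiv_diff.
- exact: coset_trans_cdiff.
Qed.

Lemma orbit_field_cdiff a z : (fwd c @` dom c) z -> cdiff (orbit_field a) z.
Proof. by move=> Zz; apply: ev_self; exact: orbit_field_near. Qed.

Definition orbit_basis (j : 'I_(lie_dim G)) : R[i] -> R[i] := orbit_field (delta_mx 0 j : 'rV[R[i]]_(lie_dim G)).

Lemma orbit_field_basis (a : V) z : (fwd c @` dom c) z ->
  orbit_field a z = \sum_j (a : 'rV[R[i]]_(lie_dim G)) 0 j * orbit_basis j z.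
Proof.
move=> Zz; rewrite orbit_fieldE //.
have aE : a = \sum_j (a : 'rV[R[i]]_(lie_dim G)) 0 j *: (delta_mx 0 j : V) := row_sum_delta a.
rewrite {1}aE linear_sum; apply: eq_bigr => j _.
by rewrite linearZ /orbit_basis orbit_fieldE.
Qed.

Lemma orbit_basis_neq0 z : (fwd c @` dom c) z -> exists j, orbit_basis j z != 0.
Proof.
move=> Zz; have [cz _] := coset_bwdP Zz.
have [v dv] : exists v, 'd (orbit_map e (bwd c z)) o v = 1.
  by apply/submersive_vector/orbit_submersive => //; rewrite left_translation1.
apply: contrapT => N; have := oner_neq0 R[i]; rewrite -[X in X != 0]dv -orbit_fieldE //.
rewrite orbit_field_basis // big1 ?eqxx // => j _.
have [->|h] := eqVneq (orbit_basis j z) 0; first by rewrite mulr0.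
by case: N; exists j.
Qed.

(* The differential of [chi] at [o] is the adjoint action of [k^-1], which permutes the orbit fields. *)
Lemma conjugation_diff k : exists chi : V -> V, [/\ differentiable chi o, chi o = o &
  \forall u \near o, bwd e (chi u) = (k^-1 * (bwd e u * k))%g].
Proof.
have [e' Ae' e'k] := lie_cover k.
have eK := chart_bwdK ec e1; have e'K := chart_bwdK (lie_chart Ae') e'k.
pose h (u : V) : V := fwd e' (bwd e u * k)%g.
pose h' (u : V) : V := fwd e (k^-1 * bwd e' u)%g.
have ho : h o = fwd e' k by rewrite /h /o eK mul1g.
have D : differentiable h o by apply: lie_mulr_diff => //; rewrite mul1g.
have D' : differentiable h' (h o) by rewrite ho; apply: lie_mull_diff => //; rewrite mulVg.
exists (h' \o h); split; first exact (differentiable_comp D D').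
  by rewrite /= ho /h' e'K mulVg.
have N : \forall y \near (1%g : G), dom e' (y * k)%g /\ dom e (k^-1 * (y * k))%g.
  apply: filterI.
    by apply: lie_mulr_cont; rewrite mul1g; exact: (chart_near_dom (lie_chart Ae') e'k).
  have n : \forall y \near (1%g * k)%g, dom e (k^-1 * y)%g.
    by apply: lie_mull_cont; rewrite mul1g mulVg; exact: chart_near_dom.
  exact: (@lie_mulr_cont _ G k 1%g _ n).
apply: filterS (chart_near_bwd ec e1 N) => u [h1 h2].
by rewrite /= /h /h' (chart_bwdK (lie_chart Ae') h1) (chart_bwdK ec h2).
Qed.

(** The map chi depends on k alone, so a single matrix serves all points y in [orbit_invariant]. *)
Lemma orbit_field_trans k : exists chi : V -> V, forall y (a : V),
  (fwd c @` dom c) y -> dom c (left_translation k (bwd c y)) ->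
  orbit_field a (coset_trans k y) = cD (coset_trans k) y * orbit_field ('d chi o a) y.
Proof.
have [chi [Dchi chio chiE]] := conjugation_diff k; exists chi => y a Zy ky.
have [cy yE] := coset_bwdP Zy.
have Zk : (fwd c @` dom c) (coset_trans k y) by exists (left_translation k (bwd c y)).
rewrite (orbit_fieldE _ Zk) (orbit_fieldE _ Zy).
have kE : bwd c (coset_trans k y) = left_translation k (bwd c y) by rewrite /coset_trans chart_bwdK.
have [D2 _] : submersive_at (orbit_map e (bwd c y)) o.
  by apply: orbit_submersive => //; rewrite left_translation1.
have oy : orbit_map e (bwd c y) o = y by rewrite /orbit_map /o (chart_bwdK ec e1) left_translation1.
(* This is the identity k (k^-1 h k) p = h (k p), read in the charts. *)
have N : \forall u \near o, coset_trans k (orbit_map e (bwd c y) (chi u)) =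
    orbit_map e (bwd c (coset_trans k y)) u.
  have n1 : \forall u \near o, dom c (left_translation (k^-1 * (bwd e u * k))%g (bwd c y)).
    have n2 : \forall g \near (1%g : G), dom c (left_translation (k^-1 * (g * k))%g (bwd c y)).
      pose S q := dom c (left_translation k^-1%g q).
      have nS : \forall q \near left_translation k (bwd c y), S q.
        have cq : dom c (left_translation k^-1%g (left_translation k (bwd c y))).
          by rewrite left_translationK.
        exact: (@left_translation_cont _ G H H1 HM HV k^-1%g _ _ (chart_near_dom cc cq)).
      have nS1 : \forall q \near left_translation 1%g (left_translation k (bwd c y)), S q.
        by rewrite left_translation1.
      have nL : \forall g \near (1%g : G), S (left_translation g (left_translation k (bwd c y))).
        exact: (@left_translation_contl _ G H H1 HM HV _ 1%g S nS1).
      apply: filterS nL => g.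
      by rewrite /S !left_translationM // -!mulgA.
    exact: (chart_near_bwd ec e1 n2).
  apply: filterS (filterI n1 chiE) => u [h1 h2].
  rewrite /= /orbit_map h2 /coset_trans (chart_bwdK cc h1) (chart_bwdK cc ky).
  by rewrite !left_translationM // mulVKg.
exact: (diff_chain a N (coset_trans_cdiff Zy ky) D2 Dchi chio oy).
Qed.

Lemma orbit_invariant f z : coset_pseudogroup f z ->
  exists A : 'M[R[i]]_(lie_dim G), ev z (fun y => forall j, orbit_basis j (f y) = cD f y * \sum_l A j l * orbit_basis l y).
Proof.
move=> [Zz [k [-> kz]]]; have [chi chiE] := orbit_field_trans k.
exists (\matrix_(j, l) ('d chi o (delta_mx 0 j : V) : 'rV[R[i]]_(lie_dim G)) 0 l).
apply: evW (coset_pseudogroup_ev Zz kz) => y [Zy ky] j.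
under eq_bigr do rewrite mxE.
rewrite -(orbit_field_basis ('d chi o (delta_mx 0 j : V)) Zy).
exact: chiE.
Qed.

End OrbitFamily.

(** * A chart of the coset space in which translations are Moebius maps *)

Section MoebiusChart.
Variables (R : realType) (G : complexLieGroup R) (H : set G).
Hypothesis H1 : H 1%g.
Hypothesis HM : forall x y, H x -> H y -> H (x * y)%g.
Hypothesis HV : forall x, H x -> H (x^-1)%g.
Notation V := (lie_model G).
Notation lchart := (chart G V).
Notation cchart := (chart (coset_space H) (Cplx R)).
Notation Pi := (coset_proj H).

Lemma coset_moebius_coord (c : cchart) z0 : coset_atlas c -> (fwd c @` dom c) z0 ->
  exists2 r, forall z, nm (z - z0 : R[i]) < r -> (fwd c @` dom c) z & moebius_coord (coset_pseudogroup c) z0 r.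
Proof.
move=> Ac Zz; have [r r0 Zr] := coset_range_open Ac Zz; exists r => //.
have [e Ae e1] := lie_cover (1%g : G).
apply: (@local_moebius _ _ _ _ _ (@orbit_basis _ _ _ c e) z0 r) => //.
- by move=> f z; exact: coset_pseudogroup_diff.
- by move=> f z; exact: coset_pseudogroup_neq0.
- by move=> j y /Zr Zy; apply: orbit_field_cdiff.
- by move=> y /Zr Zy; apply: orbit_basis_neq0.
- by move=> f z Gf _ _; apply: orbit_invariant.
Qed.

Lemma submersive_post (U : normedModType R[i]) (f : U -> Cplx R) (w : R[i] -> R[i]) u :
  submersive_at f u -> cdiff w (f u) -> cD w (f u) != 0 -> submersive_at (w \o f : U -> Cplx R) u.
Proof.
move=> [df fT] dw w0.
have Dw : differentiable (w : Cplx R -> Cplx R) (f u) by exact/differentiable_cdiff.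
have dE : forall v, 'd (w \o f : U -> Cplx R) u v = cD w (f u) * 'd f u v.
  move=> v; refine (etrans (congr1 (fun F : U -> Cplx R => F v) (diff_comp df Dw)) _).
  exact: (@diff_cD _ w _ _ Dw).
split; first exact (differentiable_comp df Dw).
apply/seteqP; split=> // z _.
have : range ('d f u) ((cD w (f u))^-1 * z) by rewrite fT.
by case=> v _ E; exists v => //; refine (etrans (dE v) _); rewrite E mulVKf.
Qed.

Definition compose_chart (c : cchart) (w sg : R[i] -> R[i]) (B : set R[i]) : cchart :=
  Chart [set p | dom c p /\ B (fwd c p)] (w \o fwd c) (bwd c \o sg).

Lemma compose_coset_atlas (c : cchart) (w sg : R[i] -> R[i]) (B : set R[i]) : coset_atlas c ->
  (forall z, B z -> (fwd c @` dom c) z) -> (forall z, B z -> ev z B) ->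
  (forall z, B z -> [/\ cdiff w z, cD w z != 0 & sg (w z) = z]) ->
  (forall z, B z -> ev (w z) (fun u => B (sg u) /\ w (sg u) = u) /\ cdiff sg (w z)) ->
  coset_atlas (compose_chart c w sg B).
Proof.
move=> Ac BZ Bo wB sgB; have cc := coset_chart Ac.
have im : fwd (compose_chart c w sg B) @` dom (compose_chart c w sg B) = w @` B.
  apply/seteqP; split=> [_ [p [cp Bp] <-]|_ [z Bz <-]]; first by exists (fwd c p).
  have [p cp pz] := BZ z Bz; exists p; rewrite /= pz //.
have wcont z : B z -> {for (z : Cplx R), continuous (w : Cplx R -> Cplx R)}.
  by move=> /wB[dw _ _]; exact/differentiable_continuous/differentiable_cdiff.
split; first split.
- rewrite openE => p [cp Bp]; rewrite /interior.
  have n1 : \forall z \near fwd c p, B z by exact/nearC_ev/Bo.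
  exact: (filterI (chart_near_dom cc cp) (chart_near_fwd cc cp n1)).
- rewrite im openE => _ [z Bz <-]; rewrite /interior.
  have [S _] := sgB z Bz; have n1 : \forall u \near (w z : Cplx R), B (sg u) /\ w (sg u) = u by exact/nearC_ev.
  by apply: filterS n1 => u [h1 h2]; exists (sg u).
- by move=> p [cp Bp] /=; have [_ _ ->] := wB _ Bp; exact: (chart_bwdK cc cp).
- move=> p [cp Bp]; case: (cc) => _ _ _ cf _.
  exact: (@continuous_comp _ (Cplx R) (Cplx R) (fwd c) w p (cf p cp) (wcont _ Bp)).
- rewrite im => _ [z Bz <-]; have [_ dsg] := sgB z Bz.
  have csg : {for (w z : Cplx R), continuous (sg : Cplx R -> Cplx R)}.
    exact/differentiable_continuous/differentiable_cdiff.
  case: (cc) => _ _ _ _ cb.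
  have cb' : {for (sg (w z) : Cplx R), continuous (bwd c)}.
    by apply: cb; have [_ _ ->] := wB _ Bz; exact: BZ.
  exact: (@continuous_comp (Cplx R) (Cplx R) _ sg (bwd c) (w z) csg cb').
move=> x [cx Bx]; have [e Ae ex] := lie_cover x; exists e; split=> //.
have eK := chart_bwdK (lie_chart Ae) ex.
have S := coset_lift Ac Ae ex cx.
have [dw w0 _] := wB _ Bx.
apply: (@submersive_post _ (fun u : V => fwd c (Pi (bwd e u))) w (fwd e x) S); by rewrite eK.
Qed.

Lemma moebius_chart (c : cchart) p0 : coset_atlas c -> dom c p0 -> exists (psi : cchart) (p1 : coset_space H),
  [/\ coset_atlas psi, dom psi p1 & forall k p, dom psi p -> dom psi (left_translation k p) ->
    exists2 A : 'M[R[i]]_2, \det A = 1 & \forall q \near p,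
      A 1 0 * fwd psi q + A 1 1 != 0 /\
      fwd psi (left_translation k q) * (A 1 0 * fwd psi q + A 1 1) = A 0 0 * fwd psi q + A 0 1].
Proof.
move=> Ac cp0; have cc := coset_chart Ac.
have [r BZ [c1 [r1 [w [[r10 S] wD wM]]]]] := coset_moebius_coord Ac (ex_intro2 _ _ p0 cp0 erefl).
have c11 : nm (c1 - c1) < r1 by rewrite subrr nm0.
have [r2 [rho [sg [/andP[r20 r21] rho0 sgP inj wN]]]] := inverse_function r10 (fun z h => (wD z h).1) (wD c1 c11).2.
(* Both conditions are imposed so that [sg] inverts the coordinate [w] on [B] and maps points near
   w(B) back into [B], which makes w(B) open. *)
pose B : set R[i] := [set z | nm (z - c1) < r2 /\ nm (w z - w c1) < rho].
have Br1 z : B z -> nm (z - c1) < r1 by case=> h _; exact: lt_le_trans h r21.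
have BZ' z : B z -> (fwd c @` dom c) z by move=> /Br1/S; exact: BZ.
have sgK z : B z -> sg (w z) = z.
  by move=> [h1 h2]; have [h3 h4 _] := sgP _ h2; exact: inj.
have Ap : coset_atlas (compose_chart c w sg B).
  apply: compose_coset_atlas => //.
  - move=> z Bz; case: (Bz) => h1 h2; apply: evI; first exact: ev_ball_open.
    have [dw _] := wD z (Br1 z Bz).
    exact: (ccont_ev (cdiff_cont dw) (ev_ball_open h2)).
  - by move=> z Bz; have [h1 h2] := wD z (Br1 z Bz); split=> //; exact: sgK.
  - move=> z Bz; case: (Bz) => h1 h2; split.
      apply: evW (ev_ball_open h2) => u uR; have [h3 h4 _] := sgP u uR.
      by rewrite /B /= h4.
    by have [_ _ D] := sgP _ h2; exists (cD w (sg (w z)))^-1.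
have [p1 cp1 p1E] : (fwd c @` dom c) c1 by apply: BZ'; rewrite /B /= !subrr !nm0.
exists (compose_chart c w sg B), p1; split=> //; first by rewrite /= p1E /B /= !subrr !nm0.
move=> k p [cp Bp] [ckp Bkp].
have Gk : coset_pseudogroup c (coset_trans c k) (fwd c p).
  split; first by exists p.
  by exists k; split=> //; rewrite (chart_bwdK cc cp).
have kE : coset_trans c k (fwd c p) = fwd c (left_translation k p).
  by rewrite /coset_trans (chart_bwdK cc cp).
have h2 : nm (coset_trans c k (fwd c p) - c1) < r1 by rewrite kE; exact: Br1.
have [A detA EA] := wM _ _ Gk (Br1 _ Bp) h2.
exists A => //.
have n1 : \forall z \near fwd c p, A 1 0 * w z + A 1 1 != 0 /\
    w (coset_trans c k z) * (A 1 0 * w z + A 1 1) = A 0 0 * w z + A 0 1 by exact/nearC_ev.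
apply: filterS (filterI (chart_near_dom cc cp) (chart_near_fwd cc cp n1)) => q [cq].
by rewrite /= /coset_trans (chart_bwdK cc cq).
Qed.

End MoebiusChart.

(** * Transverse structures *)

Section Foliation.
Variables (R : realType) (M : smoothManifold R) (F : thFoliation M).

(** Smoothness is stated in charts of [M] and through R^2; its clause of order 0 gives continuity of
    both real coordinates. *)
Lemma fol_continuous u x : fol_atlas F u -> u.1 x -> {for x, continuous u.2}.
Proof.
move=> Fu ux; have [ou S] := fol_submersion Fu.
have [Ach Acov _] := smooth_atlasP M.
have : (\bigcup_(c in @smooth_atlas R M) dom c) x by rewrite Acov.
case=> c Ac cx; have [/(_ 0%N) C0 _] := S c Ac.
have cc := Ach c Ac; case: (cc) => _ _ _ cf _.
have Cx := C0 (fwd c x) (ex_intro2 _ _ x (conj ux cx) erefl).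
have near_coord (j : 'I_2) (e : R) : 0 < e ->
    \forall y \near x, `|C_to_R2 (u.2 y) 0 j - C_to_R2 (u.2 x) 0 j| < e.
  move=> e0.
  have C2 : {for x, continuous (fun y => C_to_R2 (u.2 (bwd c (fwd c y))) 0 j)}.
    have D := @continuous_comp _ _ _ (fwd c) (C_to_R2 (R := R) \o u.2 \o bwd c) x (cf x cx) Cx.
    exact: (@continuous_comp _ _ _ _ (fun A : 'rV[R]_2 => A 0 j) x D (@coord_continuous _ _ _ _ _ _)).
  have B : \forall t \near C_to_R2 (u.2 (bwd c (fwd c x))) 0 j, `|C_to_R2 (u.2 (bwd c (fwd c x))) 0 j - t| < e.
    by apply/nbhs_normP; exists e.
  apply: filterS (filterI (chart_near_dom cc cx) (C2 _ B)) => y [cy] /=.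
  by rewrite (chart_bwdK cc cy) (chart_bwdK cc cx) distrC.
move=> U nU; have /nearC_ev[e e0 eU] : \forall w \near u.2 x, U w := nU.
have e2 : 0 < e / 2 by rewrite divr_gt0.
apply: filterS (filterI (near_coord 0 _ e2) (near_coord 1 _ e2)) => y [].
rewrite !mxE /= => h1 h2; apply: eU; apply: le_lt_trans (nm_le_ReIm _) _.
rewrite [ltRHS](splitr e) ltrD //.
  by move: h1; case: (u.2 y) (u.2 x) => [? ?] [? ?].
by move: h2; case: (u.2 y) (u.2 x) => [? ?] [? ?].
Qed.

Lemma transversely_related_cont (X : topologicalType) (A : set (chart X (Cplx R))) u (y : M -> X) x :
  fol_atlas F u -> u.1 x -> transversely_related A u.2 y x -> {for x, continuous y}.
Proof.
move=> Fu ux [W [g [[_ _ hg _] Wx yE]]].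
have [cg _] := hg _ Wx.
have C := @continuous_comp _ _ _ u.2 g x (fol_continuous Fu ux) cg.
have yx : y x = g (u.2 x) := nbhs_singleton yE.
move=> U; rewrite yx => nU.
by apply: filterS (filterI yE (C U nU)) => z [/= ->].
Qed.

Lemma fol_cover_ex x : exists2 u, fol_atlas F u & u.1 x.
Proof.
have : (\bigcup_(u in fol_atlas F) u.1) x by rewrite fol_cover.
by case=> u Fu ux; exists u.
Qed.

Lemma defines_on_cont (X : topologicalType) (A : set (chart X (Cplx R))) (U : set M) (y : M -> X) x :
  defines_on F A U y -> U x -> {for x, continuous y}.
Proof.
move=> [_ D] Ux; have [u Fu ux] := fol_cover_ex x.
exact: transversely_related_cont Fu ux (D u Fu x Ux ux).
Qed.

End Foliation.

(** * Charts of a Riemann surface as maps to the sphere *)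

Section SphereCoordinate.
Variables (R : realType) (X : topologicalType) (A : set (chart X (Cplx R))).
Hypothesis Ach : forall c, A c -> is_chart c.
Hypothesis Atr : forall c d p, A c -> A d -> dom c p -> dom d p ->
  cdiff (fun z => fwd d (bwd c z)) (fwd c p).
Variable psi : chart X (Cplx R).
Hypothesis Apsi : A psi.
Let pc := Ach Apsi.

(** The values avoid the point at infinity, so holomorphy can be checked in [sphere_chart0]
    alone. *)
Definition sphere_coord (p : X) : sphere R := Some (fwd psi p).

Lemma sphere_coord_holomorphic (g : Cplx R -> X) w : holomorphic_at (@plane_atlas R) A g w ->
  dom psi (g w) -> holomorphic_at (@plane_atlas R) (@sphere_atlas R) (sphere_coord \o g) w.
Proof.
move=> [cg [_ [d [-> Ad _ dg D]]]] pg; split.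
  case: (pc) => _ _ _ cf _.
  have C := @continuous_comp _ _ _ g (fwd psi) w cg (cf _ pg).
  by move=> U nU; exact: (C _ nU).
exists (Chart setT id id), (sphere_chart0 R); split; [reflexivity|by left|exact I|by []|].
have D1 := Atr Ad Apsi dg pg.
have D2 : differentiable (fun z : Cplx R => fwd psi (bwd d z) : Cplx R) ((fwd d \o g) w).
  exact/differentiable_cdiff.
have Dg : differentiable (fwd d \o g : Cplx R -> Cplx R) w by exact: D.
refine (diff_factor _ D2 Dg).1.
have N : \forall z \near w, dom d (g z) := cg _ (chart_near_dom (Ach Ad) dg).
by apply: filterS N => z dz /=; rewrite (chart_bwdK (Ach Ad) dz).
Qed.

Lemma sphere_coord_biholomorphic (W : set (Cplx R)) (g : Cplx R -> X) : biholomorphic_on A W g ->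
  biholomorphic_on (@sphere_atlas R) [set w | W w /\ dom psi (g w)] (sphere_coord \o g).
Proof.
move=> [oW ogW hg [h [hK hh]]].
have Wn w : W w -> \forall z \near w, W z by move=> Ww; apply: open_nbhs_nbhs; split.
split.
- rewrite openE => w [Ww pw]; rewrite /interior.
  have [cg _] := hg w Ww.
  exact: (filterI (Wn w Ww) (cg _ (chart_near_dom pc pw))).
- have -> : (sphere_coord \o g) @` [set w | W w /\ dom psi (g w)] =
      Some @` (fwd psi @` ((g @` W) `&` dom psi)) :> set (sphere R).
    apply/seteqP; split.
      by move=> _ [w [Ww pw] <-]; exists (fwd psi (g w)) => //; exists (g w) => //; split=> //; exists w.
    by move=> _ [_ [_ [[w Ww <-] pw] <-] <-]; exists w.
  apply: one_point_compactification_open_some.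
  rewrite openE => _ [p [gp pp] <-]; rewrite /interior.
  have n1 : \forall q \near p, (g @` W) q by apply: open_nbhs_nbhs; split.
  apply: filterS (filterI (chart_near pc pp) (chart_near_bwd pc pp n1)) => u [[h1 h2] h3].
  by exists (bwd psi u).
- by move=> w [Ww pw]; apply: sphere_coord_holomorphic => //; exact: hg.
(* The value at infinity is arbitrary, since that point is outside the image. *)
exists (fun p => if p is Some z then h (bwd psi z) else 0); split.
  by move=> w [Ww pw] /=; rewrite (chart_bwdK pc pw) hK.
move=> _ [w [Ww pw] <-].
have gK := chart_bwdK pc pw.
have [ch [d [_ [Ad -> dg _ D]]]] := hh (g w) (ex_intro2 _ _ w Ww erefl).
split.
  case: (pc) => _ _ _ _ cb.
  have cb' := cb (fwd psi (g w)) (ex_intro2 _ _ (g w) pw erefl).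
  have ch' : {for bwd psi (fwd psi (g w)), continuous h} by rewrite gK.
  have C := @continuous_comp _ _ _ (bwd psi) h (fwd psi (g w)) cb' ch'.
  by move=> U nU; exact: (C U nU).
exists (sphere_chart0 R), (Chart setT id id); split; [by left|reflexivity|by []|exact I|].
have D1 : differentiable (fun z : Cplx R => fwd d (bwd psi z) : Cplx R) (fwd psi (g w)).
  by apply/differentiable_cdiff; exact: Atr.
have Dh : differentiable (h \o bwd d : Cplx R -> Cplx R) ((fun z : Cplx R => fwd d (bwd psi z) : Cplx R) (fwd psi (g w))).
  by rewrite /= gK; exact: D.
refine (diff_factor _ Dh D1).1.
have N := chart_near_bwd pc pw (chart_near_dom (Ach Ad) dg).
by apply: filterS N => z dz /=; rewrite (chart_bwdK (Ach Ad) dz).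
Qed.

Lemma sphere_coord_defines (M : smoothManifold R) (F : thFoliation M) (U : set M) (y : M -> X) :
  defines_on F A U y ->
  defines_on F (@sphere_atlas R) [set x | U x /\ dom psi (y x)] (sphere_coord \o y).
Proof.
move=> D; have [oU Du] := D; split.
  rewrite openE => x [Ux px]; rewrite /interior.
  have Un : \forall z \near x, U z by apply: open_nbhs_nbhs; split.
  exact: (filterI Un (defines_on_cont D Ux (chart_near_dom pc px))).
move=> u Fu x [Ux px] ux; have [W [g [bg Wx yE]]] := Du u Fu x Ux ux.
exists [set w | W w /\ dom psi (g w)], (sphere_coord \o g); split.
- exact: sphere_coord_biholomorphic.
- by split=> //; rewrite -(nbhs_singleton yE : y x = g (u.2 x)).
- by apply: filterS yE => z /= ->.
Qed.

End SphereCoordinate.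

(** * Matrices that represent the germ of a Moebius map *)

Section MobiusGerms.
Variable R : realType.
Implicit Types (A B : 'M[R[i]]_2) (z w : R[i]).

Definition mobius_rel A z w := A 1 0 * z + A 1 1 != 0 /\ w * (A 1 0 * z + A 1 1) = A 0 0 * z + A 0 1.

Lemma mobius_relE A z w : mobius_rel A z w -> mobius A (Some z) = Some w.
Proof.
by move=> [d0 E]; rewrite /mobius /= (negbTE d0) -E mulfK.
Qed.

(** Equality of the coefficients of the cross-multiplied Moebius maps; for matrices of determinant 1
    it means A = B or A = - B. *)
Definition same_mobius A B :=
  [/\ A 0 0 * B 1 0 = B 0 0 * A 1 0, A 0 0 * B 1 1 + A 0 1 * B 1 0 = B 0 0 * A 1 1 + B 0 1 * A 1 0 &
      A 0 1 * B 1 1 = B 0 1 * A 1 1].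

(** Three distinct points z, z + h and z - h of the disc suffice. *)
Lemma quadratic_vanish (a b c z : R[i]) : ev z (fun u => a * u ^+ 2 + b * u + c = 0) -> [/\ a = 0, b = 0 & c = 0].
Proof.
move=> [d d0 E]; pose h : R[i] := (d / 2)%:C%C.
have d2 : 0 < d / 2 by rewrite divr_gt0.
have h0 : h != 0 by rewrite /h eq_complex /= eqxx andbT gt_eqF.
have nh : nm h < d by rewrite nm_real gtr0_norm // ltr_pdivrMr // ltr_pMr // ltr1n.
have E0 := E z; rewrite subrr nm0 in E0; have {}E0 := E0 d0.
have E1 := E (z + h); rewrite addrAC subrr add0r in E1; have {}E1 := E1 nh.
have E2 := E (z - h); rewrite addrAC subrr add0r nmN in E2; have {}E2 := E2 nh.
have two0 : (2 : R[i]) != 0 by rewrite pnatr_eq0.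
have a0 : a = 0.
  have : 2 * h ^+ 2 * a = 0.
    have -> : 2 * h ^+ 2 * a = (a * (z + h) ^+ 2 + b * (z + h) + c) + (a * (z - h) ^+ 2 + b * (z - h) + c)
      - 2 * (a * z ^+ 2 + b * z + c) by ring.
    by rewrite E0 E1 E2 mulr0 addr0 subr0.
  by move/eqP; rewrite !mulf_eq0 (negbTE two0) (negbTE h0) /= => /eqP.
have b0 : b = 0.
  have : h * b = 0.
    have -> : h * b = (a * (z + h) ^+ 2 + b * (z + h) + c) - (a * z ^+ 2 + b * z + c) - a * (2 * z * h + h ^+ 2) by ring.
    by rewrite E0 E1 a0 mul0r !subr0.
  by move/eqP; rewrite mulf_eq0 (negbTE h0) /= => /eqP.
by split=> //; move: E0; rewrite a0 b0 !mul0r !add0r.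
Qed.

Lemma same_mobius_rel A B z w : \det A = 1 -> same_mobius A B -> mobius_rel B z w -> mobius_rel A z w.
Proof.
rewrite det22 => dA [e1 e2 e3] [d0 E].
have I : (A 0 0 * z + A 0 1) * (B 1 0 * z + B 1 1) = (B 0 0 * z + B 0 1) * (A 1 0 * z + A 1 1).
  have -> : (A 0 0 * z + A 0 1) * (B 1 0 * z + B 1 1) =
    A 0 0 * B 1 0 * z ^+ 2 + (A 0 0 * B 1 1 + A 0 1 * B 1 0) * z + A 0 1 * B 1 1 by ring.
  by rewrite e1 e2 e3; ring.
split; last first.
  apply: (mulIf d0); rewrite I -E; ring.
(* A zero of the denominator would be one of the numerator too, which contradicts the
   determinant. *)
apply/eqP => Az.
have A2 : A 0 0 * z + A 0 1 = 0.
  by move/eqP: I; rewrite Az mulr0 mulf_eq0 (negbTE d0) orbF => /eqP.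
have := oner_neq0 R[i]; rewrite -dA.
have -> : A 0 0 * A 1 1 - A 0 1 * A 1 0 = A 0 0 * (A 1 0 * z + A 1 1) - A 1 0 * (A 0 0 * z + A 0 1) by ring.
by rewrite Az A2 !mulr0 subrr eqxx.
Qed.

Lemma rel_same_mobius A B z (w : R[i] -> R[i]) :
  ev z (fun u => mobius_rel A u (w u) /\ mobius_rel B u (w u)) -> same_mobius A B.
Proof.
move=> E.
have [|a b c] := @quadratic_vanish (A 0 0 * B 1 0 - B 0 0 * A 1 0)
  (A 0 0 * B 1 1 + A 0 1 * B 1 0 - (B 0 0 * A 1 1 + B 0 1 * A 1 0)) (A 0 1 * B 1 1 - B 0 1 * A 1 1) z.
  apply: evW E => u [[_ h1] [_ h2]].
  have -> : (A 0 0 * B 1 0 - B 0 0 * A 1 0) * u ^+ 2 +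
    (A 0 0 * B 1 1 + A 0 1 * B 1 0 - (B 0 0 * A 1 1 + B 0 1 * A 1 0)) * u + (A 0 1 * B 1 1 - B 0 1 * A 1 1) =
    (A 0 0 * u + A 0 1) * (B 1 0 * u + B 1 1) - (B 0 0 * u + B 0 1) * (A 1 0 * u + A 1 1) by ring.
  by rewrite -h1 -h2; ring.
by split; apply/eqP; rewrite -subr_eq0; apply/eqP.
Qed.

Section Germ.
Variables (X : topologicalType) (psi : chart X (Cplx R)).
Hypothesis pc : is_chart psi.

(** The set of all representing matrices, instead of one of them, settles the ambiguity of sign: the
    set is locally constant by [mobius_germ_near], and [xget] picks the same element from equal
    sets. *)
Definition mobius_germ (T : X -> X) (p : X) : set 'M[R[i]]_2 :=
  [set A | \det A = 1 /\ \forall q \near p, mobius_rel A (fwd psi q) (fwd psi (T q))].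

Lemma mobius_germE T p B : dom psi p -> mobius_germ T p B ->
  mobius_germ T p = [set A | \det A = 1 /\ same_mobius A B].
Proof.
move=> pp [dB nB]; apply/seteqP; split=> A [dA HA]; split=> //.
  apply: (@rel_same_mobius _ _ (fwd psi p) (fun u => fwd psi (T (bwd psi u)))).
  apply/nearC_ev.
  apply: filterS (filterI (chart_near pc pp) (chart_near_bwd pc pp (filterI HA nB))) => u [[_ uE] h].
  by move: h; rewrite /= uE.
by apply: filterS nB => q; exact: same_mobius_rel.
Qed.

Lemma mobius_germ_near T p B : dom psi p -> mobius_germ T p B ->
  \forall q \near p, mobius_germ T q = mobius_germ T p.
Proof.
move=> pp gB; have [dB nB] := gB.
have N : \forall q \near p, \forall r \near q, dom psi r /\ mobius_rel B (fwd psi r) (fwd psi (T r)).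
  exact: (nbhs_interior (filterI (chart_near_dom pc pp) nB)).
apply: filterS N => q Nq.
have qq : dom psi q by have [] := nbhs_singleton Nq.
have gq : mobius_germ T q B by split=> //; apply: filterS Nq => r [].
by rewrite (mobius_germE qq gq) (mobius_germE pp gB).
Qed.

End Germ.
End MobiusGerms.

Theorem proposition2p4 (R : realType) (M : smoothManifold R)
    (F : thFoliation M) (hF : transversely_homogeneous F) :
  transversely_additive F \/ transversely_affine F \/ transversely_projective F.
Proof.
right; right; case: hF => G [H [[H1 HM HV _ _] _ [I [U [y [g [cover D lc tr]]]]]]].
have [[c [p0 [Ac cp0]]]|N] := pselect (exists c p0, @coset_atlas R G H c /\ dom c p0); last first.
  (* Without coset charts [M] has no point, since [defines_on] provides a chart at every point; the
     empty family is then an atlas. *)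
  have M0 (x : M) : False.
    have : (\bigcup_i U i) x by rewrite cover.
    case=> i _ Ux; have [u Fu ux] := fol_cover_ex F x.
    have [_ /(_ u Fu x Ux ux)[W [f [[_ _ hf _] Wx _]]]] := D i.
    have [_ [c [d [_ Ad _ dp _]]]] := hf _ Wx.
    by apply: N; exists d, (f (u.2 x)).
  exists False, (fun _ => set0), (fun _ x => None), (fun _ _ x => 1%:M); split=> //.
  by apply/seteqP; split=> // x; case: (M0 x).
have [psi [p1 [Apsi p1d mob]]] := moebius_chart H1 HM HV Ac cp0.
have pc := coset_chart Apsi.
pose L := @left_translation G H.
(* One chart [psi] serves all of G/H: the index (i, k) stands for y_i followed by translation by k,
   restricted to the points that land in [psi]. *)
pose U' (a : I * G) := [set x | U a.1 x /\ dom psi (L a.2 (y a.1 x))].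
pose y' (a : I * G) (x : M) : sphere R := Some (fwd psi (L a.2 (y a.1 x))).
pose s (a b : I * G) x : G := (a.2 * g a.1 b.1 x * b.2^-1)%g.
pose p (b : I * G) x := L b.2 (y b.1 x).
(* The default 1 does not occur on overlaps, where [mob] provides an element of the germ. *)
pose A' (a b : I * G) x := xget 1%:M (mobius_germ psi (L (s a b x)) (p b x)).
have sE a b x : U a.1 x -> U b.1 x -> L (s a b x) (p b x) = L a.2 (y a.1 x).
  move=> Ua Ub; have [_ ->] := tr a.1 b.1 x (conj Ua Ub).
  by rewrite /L /s /p !left_translationM // mulgVK.
have germ a b x : U' a x -> U' b x -> mobius_germ psi (L (s a b x)) (p b x) (A' a b x).
  move=> [Ua da] [Ub db]; rewrite /A'; apply: xgetPex.
  have [|B detB EB] := mob (s a b x) (p b x) db; first by rewrite -/L sE.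
  by exists B.
exists (I * G)%type, U', y', A'; split.
- apply/seteqP; split=> // x _.
  (* G acts transitively, so some translation moves y_i(x) to the point [p1] of the domain of
     [psi]. *)
  have : (\bigcup_i U i) x by rewrite cover.
  case=> i _ Ux; exists (i, (repr p1 * (repr (y i x))^-1)%g) => //; split=> //=.
  rewrite /L -[X in left_translation _ X]coset_proj_repr left_translation_proj //.
  by rewrite -mulgA mulVg mulg1 coset_proj_repr.
- move=> [i k].
  have Ak := translate_coset_atlas H1 HM HV k Apsi.
  apply: (@sphere_coord_defines _ _ (@coset_atlas R G H) _ _ (translate_chart k psi) Ak).
  + by move=> d; exact: coset_chart.
  + by move=> d e q; exact: coset_transition.
  + exact: D.
- move=> a b x [Uax Ubx]; have gx := germ a b x Uax Ubx.
  case: (Uax) (Ubx) => Ua da [Ub db].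
  have n1 := mobius_germ_near pc db gx.
  have cp : {for x, continuous (p b)}.
    have cy := defines_on_cont (D b.1) Ub.
    exact: (@continuous_comp _ _ _ (y b.1) (L b.2) x cy (@left_translation_cont _ G H H1 HM HV b.2 _)).
  have n2 : \forall z \near x, mobius_germ psi (L (s a b x)) (p b z) = mobius_germ psi (L (s a b x)) (p b x).
    exact: (cp _ n1).
  (* Near x both the group element [s a b] and the set of representing matrices stay the same, hence
     so does the matrix that [xget] selects. *)
  apply: filterS (filterI n2 (lc a.1 b.1 x (conj Ua Ub))) => z [h1 h2] [[Uaz _] [Ubz _]].
  by rewrite /A' /s (h2 (conj Uaz Ubz)) -/(s a b x) h1.
- move=> a b x [Uax Ubx]; have [dA nA] := germ a b x Uax Ubx.
  case: (Uax) (Ubx) => Ua da [Ub db]; split=> //.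
  rewrite /y' -/(p b x) (mobius_relE (nbhs_singleton nA)).
  by rewrite sE.
Qed.
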